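(* Let $p\ge1$ and let $(T^{([p])}(\mathcal V),\mathcal G_{[p]},\mathcal P_{[p]})$ be a triple satisfying the structural conditions (S1), (S2), (S3) of the context. Let $g\in C^{p-var}([0,T],\mathcal G_{[p]})$ and let $\mathcal U^1,\mathcal U^2$ be Banach spaces. Suppose that $\int_0^\cdot\beta^i_u(g_u)\,dg_u:[0,T]\to\mathcal U^i$, $i=1,2$, are two dominated paths with $\|\beta^i\|^{\omega_i}_{\theta_i}<\infty$ for controls $\omega_i$ and $\theta_i>1$, $i=1,2$. Put $\omega:=\omega_1+\omega_2+\|g\|_{p-var}^p$ and $\theta:=\min(\theta_1,\theta_2)$. Then there exists a dominated path $\int_0^\cdot\beta_u(g_u)\,dg_u:[0,T]\to\mathcal U^1\otimes\mathcal U^2$ such that $$\|\beta\|^{\omega}_{\theta}\le C\,\|\beta^1\|^{\omega_1}_{\theta_1}\|\beta^2\|^{\omega_2}_{\theta_2}$$ and $$\int_0^t\beta_u(g_u)\,dg_u=\int_0^t\beta^1_u(g_u)\,dg_u\otimes\int_0^t\beta^2_u(g_u)\,dg_u,\qquad\forall\,0\le t\le T,$$ where $C$ depends only on $p$, $\theta_1,\theta_2$, $\omega(0,T)$ and the fixed triple (including the norms of the maps in (S2) and (S3)).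
   Context: **The triple** (with $n=[p]$, the integer part of $p$). $\mathcal V$ is a Banach space whose tensor powers carry admissible norms: $\|\varrho v\|=\|v\|$ for $v\in\mathcal V^{\otimes k}$ and $\varrho$ in the symmetric group of degree $k$, and $\|u\otimes v\|=\|u\|\|v\|$. (1) $T^{(n)}(\mathcal V)$ is a unital associative Banach algebra which as a Banach space equals $\mathbb R\oplus\mathcal V\oplus\dots\oplus\mathcal V^{\otimes n}$ with norm $\|v\|=\sum_{k=0}^n\|\pi_k(v)\|$, $\pi_k$ the projection to $\mathcal V^{\otimes k}$. (2) $\mathcal P_n$ is a finite set of continuous linear maps $\sigma\in L(T^{(n)}(\mathcal V),\mathcal V^{\otimes|\sigma|})$, $|\sigma|\in\{0,\dots,n\}$, such that: the projection $\sigma_0$ onto $\mathbb R$ is in $\mathcal P_n$; $\sigma\circ\sigma=\sigma$ and $a=\sum_{\sigma\in\mathcal P_n}\sigma(a)$; there is a comultiplication with $\triangle\sigma_0=\sigma_0\otimes\sigma_0$ and, for $|\sigma|\ge1$, $\triangle\sigma=\sigma\otimes\sigma_0+\sigma_0\otimes\sigma+\sum_{i=1}^{N(\sigma)}\sigma^{1,i}\otimes\sigma^{2,i}$, $\sigma^{j,i}\in\mathcal P_n$, $|\sigma^{j,i}|\ge1$, $|\sigma^{1,i}|+|\sigma^{2,i}|=|\sigma|$ ($N(\sigma)=0$ if $|\sigma|=1$); and $\sigma_0(ab)=\sigma_0(a)\sigma_0(b)$, $\sigma(ab)=\sigma(a)\sigma_0(b)+\sigma_0(a)\sigma(b)+\sum_i\sigma^{1,i}(a)\otimes\sigma^{2,i}(b)$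 for $|\sigma|\ge1$. (3) $\mathcal G_n\subset T^{(n)}(\mathcal V)$ is closed and connected, is a topological group for the unit, multiplication and topology of $T^{(n)}(\mathcal V)$, and $\sigma_0(a)=1$ for $a\in\mathcal G_n$. **Structural conditions.** $T^{(n)}(\mathcal V)^{\otimes2}$ is a Banach algebra with admissible norm and $(a_1\otimes b_1)(a_2\otimes b_2)=(a_1a_2)\otimes(b_1b_2)$. (S1) If $\mathcal U$ is a Banach space and $\alpha\in L(T^{(n)}(\mathcal V),\mathcal U)$ vanishes on $\mathcal G_n$, then $\alpha=0$. (S2) For $\sigma_1,\dots,\sigma_k\in\mathcal P_n$ with $m:=|\sigma_1|+\dots+|\sigma_k|\le n$ there is $\sigma_1*\dots*\sigma_k\in L(\mathcal V^{\otimes m},\mathcal V^{\otimes|\sigma_1|}\otimes\dots\otimes\mathcal V^{\otimes|\sigma_k|})$ with $(\sigma_1*\dots*\sigma_k)(a)=\sigma_1(a)\otimes\dots\otimes\sigma_k(a)$ for $a\in\mathcal G_n$, where on the left the map is applied to $\pi_m(a)$. (S3) There is a continuous linear map $\mathcal I:T^{(n)}(\mathcal V)\to T^{(n)}(\mathcal V)^{\otimes2}$ with $\mathcal I(1)=\mathcal I(\mathcal V)=0$, $\mathcal I(\mathcal V^{\otimes k})\subseteq\sum_{j_1+j_2=k,j_i\ge1}\mathcal V^{\otimes j_1}\otimes\mathcal V^{\otimes j_2}$ for $k=2,\dots,n$, and $\mathcal I(ab)=\mathcal I(a)+1_{n,2}((a\otimes a)\mathcal I(b))+1_{n,2}((a-1)\otimes(a(b-1)))$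 for $a,b\in\mathcal G_n$, where $1_{n,2}$ is the projection of $T^{(n)}(\mathcal V)^{\otimes2}$ onto $\sum_{j_1+j_2\le n,j_i\ge1}\mathcal V^{\otimes j_1}\otimes\mathcal V^{\otimes j_2}$. **Paths.** For $a\in\mathcal G_n$, $|a|:=\sum_{\sigma\in\mathcal P_n,|\sigma|\ge1}\|\sigma(a)\|^{1/|\sigma|}$; $g_{s,t}:=g_s^{-1}g_t$; $\|g\|_{p-var,[s,t]}:=\sup_D(\sum_{t_k\in D}|g_{t_k,t_{k+1}}|^p)^{1/p}$ over finite partitions $D$ of $[s,t]$; $C^{p-var}([0,T],\mathcal G_n)$ is the set of continuous paths with finite $p$-variation; $\|g\|_{p-var}^p$ as a control is $(s,t)\mapsto\|g\|_{p-var,[s,t]}^p$. A control is a continuous $\omega:\{0\le s\le t\le T\}\to[0,\infty)$, zero on the diagonal, with $\omega(s,u)+\omega(u,t)\le\omega(s,t)$. **One-forms, integral, dominated paths.** For a Banach space $\mathcal U$, $B(\mathcal G_n,\mathcal U)$ is the set of cocyclic one-forms: continuous $\beta:\mathcal G_n\to L(T^{(n)}(\mathcal V),\mathcal U)$, written $\beta(a,v)$, with $\beta(a,b)+\beta(ab,c)=\beta(a,bc)$ for $a,b,c\in\mathcal G_n$. $\beta\in C([0,T],B(\mathcal G_n,\mathcal U))$ means $t\mapsto\beta_t(a,\cdot)$ is operator-norm continuous for each $a$. $\int_s^t\beta_u(g_u)dg_u:=\lim_{|D|\to0}\sum_k\beta_{t_k}(g_{t_k},g_{t_k,t_{k+1}})$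 over partitions $D$ of $[s,t]$. For $\alpha\in L(T^{(n)}(\mathcal V),\mathcal U)$, $\|\alpha\|$ is the operator norm and $\|\alpha\|_k:=\sup_{v\in\mathcal V^{\otimes k},\|v\|=1}\|\alpha(v)\|$. $\beta$ is slowly-varying (w.r.t. $g$) if for some $M>0$, control $\omega$, $\theta>1$: $\|\beta_t(g_t,\cdot)\|\le M$ for all $t$ and $\|(\beta_t-\beta_s)(g_t,\cdot)\|_k\le\omega(s,t)^{\theta-k/p}$ for $0\le s<t\le T$, $k=1,\dots,[p]$. Operator norm: $\|\beta\|_\theta^\omega:=\sup_t\|\beta_t(g_t,\cdot)\|+\max_{1\le k\le[p]}\sup_{s<t}\|(\beta_t-\beta_s)(g_t,\cdot)\|_k\,\omega(s,t)^{-(\theta-k/p)}$ (with $0/0=0$, $c/0=\infty$ for $c>0$). A path $h:[0,T]\to\mathcal U$ is dominated by $g$ with one-form $\beta$ if $\beta\in C([0,T],B(\mathcal G_n,\mathcal U))$ is slowly-varying and $h_t=h_0+\int_0^t\beta_u(g_u)dg_u$. Tensor products of Banach spaces are completed in norms with $\|u\otimes v\|=\|u\|\|v\|$ for which tensor products of continuous linear maps extend to continuous linear maps with $\|A\otimes B\|\le\|A\|\|B\|$.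
   Formalization: The exponent θ is taken as min(θ_1, θ_2, ([p]+1)/p) instead of min(θ_1, θ_2); the claim fails when min(θ_1, θ_2) > ([p]+1)/p (e.g. p=1, g_t=(1,t), both integrals equal to t, ω_i=0, θ_i=3), and is unchanged otherwise. *)

(* Defs.v *)
From HB Require Import structures.
From mathcomp Require Import all_boot all_order all_algebra all_fingroup.
From mathcomp Require Import all_classical all_reals all_analysis.
Set Implicit Arguments.
Unset Strict Implicit.
Unset Printing Implicit Defensive.
Import Order.TTheory GRing.Theory Num.Theory.
Import numFieldNormedType.Exports.
Local Open Scope classical_set_scope.
Local Open Scope ring_scope.

Section ContinuousLinearMaps.
Context {R : realType}.

Definition cont_linear {E F : normedModType R} (f : E -> F) : Prop :=
  linear f /\ continuous f.

Definition opnorm {E F : normedModType R} (f : E -> F) : R :=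
  sup [set `|f v| | v in [set v : E | `|v| <= 1]].

End ContinuousLinearMaps.

(* A choice of completed tensor product for Banach spaces.  [tens_ker] says
   that the span of the elementary tensors is the algebraic tensor product: a
   sum of elementary tensors vanishes only if bilinearity forces it to.
   [tmap A B] is A (x) B; it is only constrained for continuous linear A, B. *)
Record tensor_system (R : realType) := TensorSystem {
  tsp :> completeNormedModType R -> completeNormedModType R ->
         completeNormedModType R ;
  tens : forall E F : completeNormedModType R, {bilinear E -> F -> tsp E F} ;
  tmap : forall E F E' F' : completeNormedModType R,
    (E -> E') -> (F -> F') -> tsp E F -> tsp E' F' ;
  tens_norm : forall (E F : completeNormedModType R) (u : E) (v : F),
    `|tens E F u v| = `|u| * `|v| ;
  tens_ker : forall (E F : completeNormedModType R) (m : nat)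
      (u : 'I_m -> E) (v : 'I_m -> F),
    \sum_(i < m) tens E F (u i) (v i) = 0 ->
    forall (X : lmodType R) (b : {bilinear E -> F -> X}),
      \sum_(i < m) b (u i) (v i) = 0 ;
  tens_dense : forall E F : completeNormedModType R,
    closure [set w | exists (m : nat) (u : 'I_m -> E) (v : 'I_m -> F),
                       w = \sum_(i < m) tens E F (u i) (v i)] = setT ;
  tmap_cont_linear : forall (E F E' F' : completeNormedModType R)
      (A : E -> E') (B : F -> F'),
    cont_linear A -> cont_linear B -> cont_linear (tmap A B) ;
  tmap_tens : forall (E F E' F' : completeNormedModType R)
      (A : E -> E') (B : F -> F'),
    cont_linear A -> cont_linear B ->
    forall u v, tmap A B (tens E F u v) = tens E' F' (A u) (B v) ;
  tmap_norm : forall (E F E' F' : completeNormedModType R)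
      (A : E -> E') (B : F -> F'),
    cont_linear A -> cont_linear B -> opnorm (tmap A B) <= opnorm A * opnorm B
}.

Arguments tens {R} t {E F}.
Arguments tmap {R} t {E F E' F'}.

Section TensorPowers.
Context {R : realType} (TS : tensor_system R) (V : completeNormedModType R).

(* W, with u (x) v := b u v, is the completed tensor product of E and F up to
   an isometric isomorphism. *)
Definition is_tensor_product {E F W : completeNormedModType R}
    (b : {bilinear E -> F -> W}) : Prop :=
  exists f : {linear TS E F -> W},
    [/\ forall w, `|f w| = `|w|, forall x, exists w, f w = x &
        forall u v, f (tens TS u v) = b u v].

Definition tpow_of (W : nat -> completeNormedModType R) (k : nat) :
    completeNormedModType R :=
  match k with 0 => R | 1 => V | k'.+2 => W k' end.

Fixpoint pure_tensor (W : nat -> completeNormedModType R)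
    (cat : forall j k,
      {bilinear tpow_of W j -> tpow_of W k -> tpow_of W (j + k)})
    (k : nat) : ('I_k -> V) -> tpow_of W k :=
  match k return ('I_k -> V) -> tpow_of W k with
  | 0 => fun _ => 1 : R
  | k'.+1 => fun v =>
      cat 1 k' (v ord0) (pure_tensor cat (fun i => v (lift ord0 i)))
  end.

(* [tp_cat j k u v] is the element u (x) v of the (j+k)-th power; equality in
   {k & tpow k} compares elements of powers with provably equal exponents. *)
Record tensor_powers := TensorPowers {
  tp_high : nat -> completeNormedModType R ;
  tpow := tpow_of tp_high ;
  tp_cat : forall j k, {bilinear tpow j -> tpow k -> tpow (j + k)} ;
  tp_cat_tensor : forall j k, is_tensor_product (tp_cat j k) ;
  tp_cat1l : forall k (v : tpow k), tp_cat 0 k (1 : R) v = v ;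
  tp_cat1r : forall k (v : tpow k),
    existT tpow (k + 0)%N (tp_cat k 0 v (1 : R)) = existT tpow k v ;
  tp_catA : forall i j k (u : tpow i) (v : tpow j) (w : tpow k),
    existT tpow (i + (j + k))%N (tp_cat i (j + k) u (tp_cat j k v w)) =
    existT tpow (i + j + k)%N (tp_cat (i + j) k (tp_cat i j u v) w) ;
  tp_perm : forall k (r : 'S_k), exists f : {linear tpow k -> tpow k},
    (forall w, `|f w| = `|w|) /\
    (forall v : 'I_k -> V,
       f (pure_tensor tp_cat v) = pure_tensor tp_cat (v \o r))
}.

End TensorPowers.

Arguments tpow {R TS V}.
Arguments tp_cat {R TS V} t {j k}.

Record banach_algebra (R : realType) (A : completeNormedModType R) :=
  BanachAlgebra {
  bmul :> {bilinear A -> A -> A} ;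
  bone : A ;
  bmulA : associative bmul ;
  bmul1l : left_id bone bmul ;
  bmul1r : right_id bone bmul ;
  bmul_norm : forall a b, `|bmul a b| <= `|a| * `|b|
}.

(* [inj k] and [proj k] are the inclusion of the k-th tensor power and the
   projection pi_k; both are irrelevant for k > n.  The maps of the finite set
   P_n are indexed without repetition by [idx].  [comul s] lists the terms of
   the comultiplication of the index [s], and [comul_red s] those of its
   reduced part, i.e. the pairs (sigma^{1,i}, sigma^{2,i}), i = 1..N(sigma). *)
Record triple (R : realType) (TS : tensor_system R)
    (V : completeNormedModType R) (TP : tensor_powers TS V) (n : nat) :=
  Triple {
  car :> completeNormedModType R ;
  alg : banach_algebra car ;
  proj : forall k, {linear car -> tpow TP k} ;
  inj : forall k, {linear tpow TP k -> car} ;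
  injK : forall k, (k <= n)%N -> cancel (inj k) (proj k) ;
  proj_inj0 : forall j k, (j <= n)%N -> (k <= n)%N -> j <> k ->
    forall v, proj j (inj k v) = 0 ;
  sum_proj : forall a, a = \sum_(k < n.+1) inj k (proj k a) ;
  norm_proj : forall a, `|a| = \sum_(k < n.+1) `|proj k a| ;

  idx : finType ;
  deg : idx -> nat ;
  deg_le : forall s, (deg s <= n)%N ;
  sig : forall s, {linear car -> tpow TP (deg s)} ;
  sig_cont : forall s, continuous (sig s) ;
  sig_inj : injective (fun s =>
    existT (fun k => car -> tpow TP k) (deg s) (sig s)) ;
  s0 : idx ;
  sig_s0 : existT (fun k => car -> tpow TP k) (deg s0) (sig s0) =
           existT (fun k => car -> tpow TP k) 0%N (proj 0) ;
  sig_idem : forall s a, sig s (inj (deg s) (sig s a)) = sig s a ;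
  sum_sig : forall a, a = \sum_(s : idx) inj (deg s) (sig s a) ;
  comul : idx -> seq (idx * idx) ;
  comul_red : idx -> seq (idx * idx) ;
  comul_s0 : comul s0 = [:: (s0, s0)] ;
  comulE : forall s, (1 <= deg s)%N ->
    comul s = (s, s0) :: (s0, s) :: comul_red s ;
  comul_red_deg : forall s, (1 <= deg s)%N ->
    forall q, q \in comul_red s ->
      [/\ (1 <= deg q.1)%N, (1 <= deg q.2)%N & (deg q.1 + deg q.2)%N = deg s] ;
  sig0_mul : forall a b, (proj 0 (alg a b) : R) = proj 0 a * proj 0 b ;
  sig_mul : forall s, (1 <= deg s)%N -> forall a b,
    inj (deg s) (sig s (alg a b)) =
      (proj 0 b : R) *: inj (deg s) (sig s a)
      + (proj 0 a : R) *: inj (deg s) (sig s b)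
      + \sum_(q <- comul_red s)
          inj (deg q.1 + deg q.2) (tp_cat TP (sig q.1 a) (sig q.2 b)) ;

  grp : set car ;
  ginv : car -> car ;
  grp_closed : closed grp ;
  grp_connected : connected grp ;
  grp1 : grp (bone alg) ;
  grpM : forall a b, grp a -> grp b -> grp (alg a b) ;
  grpV : forall a, grp a -> grp (ginv a) ;
  grpVl : forall a, grp a -> alg (ginv a) a = bone alg ;
  grpVr : forall a, grp a -> alg a (ginv a) = bone alg ;
  grpM_cont : {within grp `*` grp, continuous (fun q => alg q.1 q.2)} ;
  grpV_cont : {within grp, continuous ginv} ;
  grp_sig0 : forall a, grp a -> (proj 0 a : R) = 1
}.

Arguments alg {R TS V TP n}.
Arguments proj {R TS V TP n}.
Arguments inj {R TS V TP n}.
Arguments sig {R TS V TP n}.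
Arguments grp {R TS V TP n}.
Arguments ginv {R TS V TP n}.

Section StructuralConditions.
Context {R : realType} {TS : tensor_system R} {V : completeNormedModType R}.
Context {TP : tensor_powers TS V} {n : nat} (X : triple TP n).

Local Notation "u ⊗ v" := (tens TS u v) (at level 40, left associativity).
Local Notation one := (bone (alg X)).

Definition is_tensor_square_algebra (A2 : banach_algebra (TS X X)) : Prop :=
  (forall a1 b1 a2 b2 : X,
     A2 (a1 ⊗ b1) (a2 ⊗ b2) = (alg X a1 a2) ⊗ (alg X b1 b2)) /\
  (exists f : {linear TS X X -> TS X X},
     (forall w, `|f w| = `|w|) /\ (forall a b : X, f (a ⊗ b) = b ⊗ a)).

Definition S1 : Prop :=
  forall (U : completeNormedModType R) (f : X -> U), cont_linear f ->
    (forall a, grp X a -> f a = 0) -> forall v, f v = 0.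

(* The target of sigma_1 * ... * sigma_k, the tensor product of the tensor
   powers of degrees |sigma_i|, is identified with the power of degree
   |sigma_1| + ... + |sigma_k|, as [tp_cat_tensor] allows. *)
Definition degs (l : seq (idx X)) : nat := sumn (map (@deg _ _ _ _ _ X) l).

Fixpoint sigs (l : seq (idx X)) (a : X) : tpow TP (degs l) :=
  match l return tpow TP (degs l) with
  | [::] => 1 : R
  | s :: l' => tp_cat TP (sig X s a) (sigs l' a)
  end.

Definition S2 : Prop :=
  forall l : seq (idx X), (degs l <= n)%N ->
    exists f : tpow TP (degs l) -> tpow TP (degs l),
      cont_linear f /\ (forall a, grp X a -> f (proj X (degs l) a) = sigs l a).

(* The projection onto the components of bidegree (i, j) with i, j >= 1 and
   i + j <= n, along the other ones. *)
Definition trunc2 (w : TS X X) : TS X X :=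
  \sum_(i < n.+1) \sum_(j < n.+1 | [&& 1 <= i, 1 <= j & i + j <= n]%N)
    tmap TS (inj X i \o proj X i) (inj X j \o proj X j) w.

Definition S3 (A2 : banach_algebra (TS X X)) : Prop :=
  exists I : X -> TS X X,
  [/\ cont_linear I,
      I one = 0,
      forall v : V, I (inj X 1 v) = 0,
      forall k, (2 <= k <= n)%N -> forall v : tpow TP k,
        exists w : forall j1 j2, TS (tpow TP j1) (tpow TP j2),
          I (inj X k v) =
          \sum_(i < n.+1) \sum_(j < n.+1 | [&& 1 <= i, 1 <= j & i + j == k]%N)
            tmap TS (inj X i) (inj X j) (w i j) &
      forall a b, grp X a -> grp X b ->
        I (alg X a b) =
          I a + trunc2 (A2 (a ⊗ a) (I b))
          + trunc2 ((a - one) ⊗ (alg X a (b - one)))].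

End StructuralConditions.

Section Paths.
Context {R : realType} {TS : tensor_system R} {V : completeNormedModType R}.
Context {TP : tensor_powers TS V} {n : nat} {X : triple TP n}.

Definition hnorm (a : X) : R :=
  \sum_(s : idx X | (1 <= deg s)%N) `|sig X s a| `^ ((deg s)%:R^-1).

Definition incr (g : R -> X) (s t : R) : X := alg X (ginv X (g s)) (g t).

(* For the partition s < D_0 < ... < D_m = t, [part_sum F s D] is the sum of
   the F t_k t_{k+1} and [mesh s D] the maximum of the t_{k+1} - t_k. *)
Definition part_sum {U : zmodType} (F : R -> R -> U) (s : R) (D : seq R) : U :=
  \sum_(0 <= i < size D) F (nth 0 (s :: D) i) (nth 0 (s :: D) i.+1).

Definition mesh (s : R) (D : seq R) : R :=
  \big[Num.max/0]_(0 <= i < size D)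
    (nth 0 (s :: D) i.+1 - nth 0 (s :: D) i).

Definition mesh_to0 (s t : R) : set_system (seq R) :=
  filter_from [set d : R | 0 < d]
    (fun d => [set D | itv_partition s t D /\ mesh s D < d]).

Definition pvar (p : R) (g : R -> X) (s t : R) : \bar R :=
  (ereal_sup
    [set (part_sum (fun u v => hnorm (incr g u v) `^ p) s D)%:E
      | D in itv_partition s t] `^ p^-1)%E.

Definition pvar_path (p T : R) (g : R -> X) : Prop :=
  [/\ forall t, 0 <= t <= T -> grp X (g t),
      {within `[0, T], continuous g} &
      (pvar p g 0 T < +oo)%E].

Definition is_control (T : R) (w : R -> R -> R) : Prop :=
  [/\ forall s t, 0 <= s <= t -> t <= T -> 0 <= w s t,
      forall t, 0 <= t <= T -> w t t = 0,
      {within [set q : R * R | 0 <= q.1 /\ q.1 <= q.2 /\ q.2 <= T],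
        continuous (fun q => w q.1 q.2)} &
      forall s u t, 0 <= s <= u -> u <= t <= T -> w s u + w u t <= w s t].

Section OneForms.
Context {U : completeNormedModType R}.

Definition one_form (b : X -> X -> U) : Prop :=
  [/\ forall a, grp X a -> cont_linear (b a),
      forall a, grp X a ->
        (fun c => opnorm (fun v => b c v - b a v)) @ within (grp X) (nbhs a)
          --> (0 : R) &
      forall a1 a2 a3, grp X a1 -> grp X a2 -> grp X a3 ->
        b a1 a2 + b (alg X a1 a2) a3 = b a1 (alg X a2 a3)].

(* Continuity in time is required for each fixed first argument only. *)
Definition cont_one_forms (T : R) (b : R -> X -> X -> U) : Prop :=
  (forall t, 0 <= t <= T -> one_form (b t)) /\
  (forall a, grp X a -> forall t, 0 <= t <= T ->
     (fun s => opnorm (fun v => b s a v - b t a v)) @ within `[0, T] (nbhs t)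
       --> (0 : R)).

Definition dintegral (b : R -> X -> X -> U) (g : R -> X) (s t : R) : U :=
  lim (part_sum (fun u v => b u (g u) (incr g u v)) s @ mesh_to0 s t).

Definition dintegrable (b : R -> X -> X -> U) (g : R -> X) (s t : R) : Prop :=
  cvg (part_sum (fun u v => b u (g u) (incr g u v)) s @ mesh_to0 s t).

Definition opnorm_deg (k : nat) (f : X -> U) : R :=
  sup [set `|f (inj X k v)| | v in [set v : tpow TP k | `|v| = 1]].

Definition form_diff (b : R -> X -> X -> U) (g : R -> X) (s t : R) : X -> U :=
  fun v => b t (g t) v - b s (g t) v.

Definition slowly_varying (p T : R) (g : R -> X) (b : R -> X -> X -> U) :
    Prop :=
  exists (M : R) (w : R -> R -> R) (th : R),
  [/\ 0 < M, is_control T w, 1 < th,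
      forall t, 0 <= t <= T -> opnorm (b t (g t)) <= M &
      forall s t, 0 <= s -> s < t -> t <= T ->
      forall k, (1 <= k <= Num.truncn p)%N ->
        opnorm_deg k (form_diff b g s t) <= w s t `^ (th - k%:R / p)].

Definition equot (c x : R) : \bar R :=
  if x == 0 then (if c == 0 then 0%E else +oo%E) else (c / x)%:E.

(* The base 0 of the maximum also covers the empty suprema, equal to -oo. *)
Definition form_norm (p T : R) (g : R -> X) (w : R -> R -> R) (th : R)
    (b : R -> X -> X -> U) : \bar R :=
  (ereal_sup [set (opnorm (b t (g t)))%:E | t in `[0%R, T]%classic]
   + \big[maxe/0]_(1 <= k < (Num.truncn p).+1)
       ereal_sup
         [set equot (opnorm_deg k (form_diff b g q.1 q.2))
                    (w q.1 q.2 `^ (th - k%:R / p))%R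
           | q in [set q : R * R | (0 <= q.1 /\ q.1 < q.2 /\ q.2 <= T)%R]])%E.

Definition dominated (p T : R) (g : R -> X) (h : R -> U)
    (b : R -> X -> X -> U) : Prop :=
  [/\ cont_one_forms T b, slowly_varying p T g b &
      forall t, 0 <= t <= T ->
        dintegrable b g 0 t /\ h t = h 0 + dintegral b g 0 t].

End OneForms.

Definition sum_control (p : R) (g : R -> X) (w1 w2 : R -> R -> R)
    (s t : R) : R :=
  w1 s t + w2 s t + fine (pvar p g s t) `^ p.

End Paths.

(* Main.v *)
Require Import Defs.
From HB Require Import structures.
From mathcomp Require Import all_boot all_order all_algebra all_fingroup.
From mathcomp Require Import all_classical all_reals all_analysis.
From mathcomp Require Import ring lra zify.
(* so that [proj] is the projection of a triple, not that of a product space *)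
Import Defs.
Set Implicit Arguments.
Unset Strict Implicit.
Unset Printing Implicit Defensive.
Import Order.TTheory GRing.Theory Num.Theory.
Import numFieldNormedType.Exports.
Local Open Scope classical_set_scope.
Local Open Scope ring_scope.

(** A cocyclic one-form is determined by its value at one point of the group.
    Conversely, for every continuous linear map phi and every g in the group,
      (a, v) |-> phi (g^-1 a (v - s0(v) 1)),
    s0 being the projection onto the scalars, is a cocyclic one-form, and its
    value at g is v |-> phi (v - s0(v) 1).  Hence a dominated path amounts to
    a path of continuous linear maps A_t = b_t(g_t, .) that kill the unit and
    satisfy, for v of degree k and a = g_s^-1 g_t,
      |A_t v - A_s (a v)| <= M w(s,t)^(th - k/p) |v|,
    together with its integral h, for which
      |h_t - h_s - A_s a| <= M w(s,t)^th.
    [path_data] records these bounds.  [form_path_data] extracts them from a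
    dominated path; the bound on h is the sewing argument [sewing_bound].
    Conversely [path_form_dominated], [path_form_norm] and
    [path_form_integral] turn them back into a dominated path, since
    increments of h within M w^th of A_s a force the Riemann sums to converge
    to h ([telescope_cvg]).

    For two such paths (A, x) and (B, y), the increment of the tensor product
    of x and y over [s, t] is, up to order w^th,
      A_s a (x) y_s + x_s (x) B_s a + A_s a (x) B_s a.
    The last term is quadratic in a, but by (S2) its components of total
    degree at most n agree on the group with a linear map of a: for each pair
    q of indices of total degree at most n there is a linear J q with
    J q a = q.1 a (x) q.2 a on the group ([linearization_exists]).  This gives
    the linear map [prod_form].  The components of total degree above n are of
    order w^((n+1)/p), which is why th is at most (n+1)/p.

    It remains to compare [prod_form] at times s and t.  By (S1) an identity
    between continuous linear maps may be checked on the group, where the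
    multiplicativity of the maps of P_n yields an exact formula for
    J q (a c), linear in c ([J_mul], [quad_mul]).  Subtracting, every term
    contains either a difference already controlled by the hypotheses or a
    component of total degree above n ([product_bounds], [product_path]).

    The p-variation of g to the power p is part of the control, so its
    continuity in (s, t) is needed as well ([pcontrol_control]): inserting a
    point close to an end of a partition changes the sum by an amount
    controlled by the modulus of continuity of its terms. *)

(** * Continuous linear maps and tensor products *)

Section ContinuousLinear.
Context {R : realType}.
Implicit Types E F G : normedModType R.

Lemma clP E F (f : E -> F) a u v : cont_linear f ->
  f (a *: u + v) = a *: f u + f v.
Proof. by case=> lf _; exact: lf. Qed.

Lemma clD E F (f : E -> F) u v : cont_linear f -> f (u + v) = f u + f v.
Proof. by move=> /(clP 1 u v); rewrite !scale1r. Qed.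

Lemma cl0 E F (f : E -> F) : cont_linear f -> f 0 = 0.
Proof.
move=> cf; have /eqP := clD 0 0 cf.
by rewrite addr0 -subr_eq subrr eq_sym => /eqP.
Qed.

Lemma clZ E F (f : E -> F) a u : cont_linear f -> f (a *: u) = a *: f u.
Proof. by move=> cf; have := clP a u 0 cf; rewrite (cl0 cf) !addr0. Qed.

Lemma clN E F (f : E -> F) u : cont_linear f -> f (- u) = - f u.
Proof. by move=> cf; rewrite -scaleN1r (clZ _ _ cf) scaleN1r. Qed.

Lemma clB E F (f : E -> F) u v : cont_linear f -> f (u - v) = f u - f v.
Proof. by move=> cf; rewrite (clD _ _ cf) (clN _ cf). Qed.

Lemma cl_sum E F (f : E -> F) I (r : seq I) (P : pred I) (u : I -> E) :
  cont_linear f -> f (\sum_(i <- r | P i) u i) = \sum_(i <- r | P i) f (u i).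
Proof.
move=> cf; apply: (big_morph f) => [x y|]; first exact: clD.
exact: cl0.
Qed.

Lemma cl_bound E F (f : E -> F) : cont_linear f ->
  exists2 K, 0 <= K & forall v, `|f v| <= K * `|v|.
Proof.
case=> lf cf.
pose f' : {linear E -> F} := HB.pack f (GRing.isLinear.Build _ _ _ _ f lf).
have /linear_boundedP : bounded_near f' (nbhs 0).
  exact/linear_bounded_continuous.
by case/pinfty_ex_gt0 => K K0 fK; exists K => //; exact: ltW.
Qed.

Lemma bound_cl E F (f : E -> F) K : linear f ->
  (forall v, `|f v| <= K * `|v|) -> cont_linear f.
Proof.
move=> lf fK; split=> //.
pose f' : {linear E -> F} := HB.pack f (GRing.isLinear.Build _ _ _ _ f lf).
apply: (@bounded_linear_continuous _ _ _ f'); apply/linear_boundedP.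
apply: (filterS _ (nbhs_pinfty_ge (num_real K))) => r Kr x.
exact: le_trans (fK x) (ler_wpM2r (normr_ge0 _) Kr).
Qed.

Lemma cl_linear E F (f : {linear E -> F}) : continuous f -> cont_linear f.
Proof. by move=> cf; split=> // a u v; rewrite linearP. Qed.

Lemma isom_cl E F (f : {linear E -> F}) : (forall x, `|f x| = `|x|) ->
  cont_linear f.
Proof.
move=> fn; apply: (@bound_cl _ _ _ 1) => [a u v|v]; first by rewrite linearP.
by rewrite fn mul1r.
Qed.

Lemma cl_comp E F G (f : E -> F) (g : F -> G) :
  cont_linear f -> cont_linear g -> cont_linear (g \o f).
Proof.
move=> cf cg; split=> [a u v /=|x]; first by rewrite (clP _ _ _ cf) clP.
by apply: continuous_comp; [case: cf => _; exact|case: cg => _; exact].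
Qed.

Lemma cl_add E F (f g : E -> F) : cont_linear f -> cont_linear g ->
  cont_linear (fun x => f x + g x).
Proof.
move=> cf cg; split=> [a u v /=|x].
  by rewrite (clP _ _ _ cf) (clP _ _ _ cg) scalerDr addrACA.
by apply: cvgD; [case: cf => _; exact|case: cg => _; exact].
Qed.

Lemma cl_scale E F (k : R) (f : E -> F) : cont_linear f ->
  cont_linear (fun x => k *: f x).
Proof.
move=> cf; split=> [a u v /=|x].
  by rewrite (clP _ _ _ cf) scalerDr !scalerA mulrC.
by apply: continuousZl_tmp; case: cf => _; exact.
Qed.

Lemma cl_opp E F (f : E -> F) : cont_linear f -> cont_linear (fun x => - f x).
Proof.
move=> cf; have := cl_scale (-1) cf.
by congr cont_linear; apply/funext => x; rewrite scaleN1r.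
Qed.

Lemma cl_sub E F (f g : E -> F) : cont_linear f -> cont_linear g ->
  cont_linear (fun x => f x - g x).
Proof. by move=> cf cg; apply: cl_add => //; exact: cl_opp. Qed.

Lemma cl_zero E F : cont_linear (fun _ : E => 0 : F).
Proof. by split=> [a u v|x]; [rewrite scaler0 addr0|exact: cvg_cst]. Qed.

Lemma cl_bigsum E F I (r : seq I) (P : pred I) (f : I -> E -> F) :
  (forall i, P i -> cont_linear (f i)) ->
  cont_linear (fun x => \sum_(i <- r | P i) f i x).
Proof.
move=> cf; elim: r => [|i r ih].
  have := @cl_zero E F.
  by congr cont_linear; apply/funext => x; rewrite big_nil.
have [Pi|Pi] := boolP (P i); last first.
  by move: ih; congr cont_linear; apply/funext => x; rewrite big_cons (negbTE Pi).
have := cl_add (cf i Pi) ih.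
by congr cont_linear; apply/funext => x; rewrite big_cons Pi.
Qed.

Lemma opnorm_le E F (f : E -> F) K : 0 <= K ->
  (forall v, `|f v| <= K * `|v|) -> opnorm f <= K.
Proof.
move=> K0 fK; apply: ge_sup; first by exists `|f 0|, 0 => //=; rewrite normr0.
by move=> _ [v /= v1 <-]; apply: (le_trans (fK v)); exact: ler_piMr.
Qed.

Lemma opnorm_ge0 E F (f : E -> F) : 0 <= opnorm f.
Proof.
rewrite /opnorm; have [[_ fb]|/sup_out->//] :=
  pselect (has_sup [set `|f v| | v in [set v : E | `|v| <= 1]]).
apply: (@le_trans _ _ `|f 0|) => //; apply: ub_le_sup => //.
by exists 0 => //=; rewrite normr0.
Qed.

Lemma opnormP E F (f : E -> F) v : cont_linear f -> `|f v| <= opnorm f * `|v|.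
Proof.
move=> cf; have [K K0 fK] := cl_bound cf.
have [->|v0] := eqVneq v 0; first by rewrite cl0// !normr0 mulr0.
have v0' : 0 < `|v| by rewrite normr_gt0.
rewrite -ler_pdivrMr//.
have -> : `|f v| / `|v| = `|f (`|v|^-1 *: v)|.
  by rewrite clZ// normrZ normfV normr_id mulrC.
apply: ub_le_sup; last first.
  by exists (`|v|^-1 *: v) => //=; rewrite normrZ normfV normr_id mulVf// normr_eq0.
exists K => _ [w /= w1 <-]; apply: (le_trans (fK w)); exact: ler_piMr.
Qed.

End ContinuousLinear.

Section Tensor.
Context {R : realType} (TS : tensor_system R).
Implicit Types E F G : completeNormedModType R.

(** Continuous linear maps on a completed tensor product are determined by
    their values on elementary tensors. *)
Lemma tens_ext E F (G : normedModType R) (f g : TS E F -> G) :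
  cont_linear f -> cont_linear g ->
  (forall u v, f (tens TS u v) = g (tens TS u v)) -> f = g.
Proof.
move=> cf cg fg; apply/funext => w.
pose h w := f w - g w; have ch : cont_linear h by exact: cl_sub.
suff : h w = 0 by move/eqP; rewrite subr_eq0 => /eqP.
have clh : closed (h @^-1` [set 0]).
  apply: closed_comp => [x _|]; first by case: ch => _; exact.
  exact/accessible_closed_set1/hausdorff_accessible/norm_hausdorff.
have /closureS : [set w | exists (m : nat) (u : 'I_m -> E) (v : 'I_m -> F),
    w = \sum_(i < m) tens TS (u i) (v i)] `<=` h @^-1` [set 0].
  move=> _ [m [u [v ->]]] /=.
  by rewrite (cl_sum _ _ _ ch) big1// => i _; rewrite /h fg subrr.
by rewrite -((closure_id _).1 clh) tens_dense; apply.
Qed.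

Lemma tmap_le E F E' F' (A : E -> E') (B : F -> F') a b :
  cont_linear A -> cont_linear B -> 0 <= a -> 0 <= b ->
  (forall u, `|A u| <= a * `|u|) -> (forall v, `|B v| <= b * `|v|) ->
  forall w, `|tmap TS A B w| <= a * b * `|w|.
Proof.
move=> cA cB a0 b0 Aa Bb w.
apply: (le_trans (opnormP _ (tmap_cont_linear _ cA cB))).
rewrite ler_wpM2r//; apply: (le_trans (tmap_norm TS cA cB)).
by apply: ler_pM; rewrite ?opnorm_ge0// opnorm_le.
Qed.

Lemma tmap_comp E F E' F' E'' F'' (A : E -> E') (B : F -> F')
    (A' : E' -> E'') (B' : F' -> F'') w :
  cont_linear A -> cont_linear B -> cont_linear A' -> cont_linear B' ->
  tmap TS A' B' (tmap TS A B w) = tmap TS (A' \o A) (B' \o B) w.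
Proof.
move=> cA cB cA' cB'.
have cAA := cl_comp cA cA'; have cBB := cl_comp cB cB'.
suff /(congr1 (@^~ w)) : tmap TS A' B' \o tmap TS A B = tmap TS (A' \o A) (B' \o B) by [].
apply: tens_ext; first by apply: cl_comp; exact: tmap_cont_linear.
- exact: tmap_cont_linear.
- by move=> u v /=; rewrite !tmap_tens.
Qed.

Lemma tmap_sum2 E F E' F' I J (r : seq I) (s : seq J) (P : pred I) (Q : pred J)
    (A : I -> E -> E') (B : J -> F -> F') w :
  (forall i, P i -> cont_linear (A i)) -> (forall j, Q j -> cont_linear (B j)) ->
  tmap TS (fun u => \sum_(i <- r | P i) A i u)
    (fun v => \sum_(j <- s | Q j) B j v) w =
  \sum_(i <- r | P i) \sum_(j <- s | Q j) tmap TS (A i) (B j) w.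
Proof.
move=> cA cB; have cAs := cl_bigsum r cA; have cBs := cl_bigsum s cB.
suff /(congr1 (@^~ w)) : tmap TS (fun u => \sum_(i <- r | P i) A i u)
    (fun v => \sum_(j <- s | Q j) B j v) =
    fun w => \sum_(i <- r | P i) \sum_(j <- s | Q j) tmap TS (A i) (B j) w by [].
apply: tens_ext; first exact: tmap_cont_linear.
- apply: cl_bigsum => i Pi; apply: cl_bigsum => j Qj.
  by apply: tmap_cont_linear; [exact: cA|exact: cB].
- move=> u v /=; rewrite tmap_tens// linear_sumlz/=; apply: eq_bigr => i Pi.
  rewrite linear_sumr; apply: eq_bigr => j Qj.
  by rewrite tmap_tens//; [exact: cA|exact: cB].
Qed.

Lemma tmapB E F E' F' (A A' : E -> E') (B B' : F -> F') w :
  cont_linear A -> cont_linear B -> cont_linear A' -> cont_linear B' ->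
  tmap TS A B w - tmap TS A' B' w =
  tmap TS (fun u => A u - A' u) B w + tmap TS A' (fun v => B v - B' v) w.
Proof.
move=> cA cB cA' cB'.
have cAA := cl_sub cA cA'; have cBB := cl_sub cB cB'.
suff /(congr1 (@^~ w)) : (fun w => tmap TS A B w - tmap TS A' B' w) =
   fun w => tmap TS (fun u => A u - A' u) B w + tmap TS A' (fun v => B v - B' v) w
   by [].
apply: tens_ext; first by apply: cl_sub; exact: tmap_cont_linear.
- by apply: cl_add; exact: tmap_cont_linear.
- by move=> u v /=; rewrite !tmap_tens// linearBl linearBr/= addrA subrK.
Qed.

Lemma cl_tensl E F (G : normedModType R) (A : G -> E) (v : F) : cont_linear A ->
  cont_linear (fun x => tens TS (A x) v).
Proof.
move=> cA; have [K K0 AK] := cl_bound cA.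
apply: (@bound_cl _ _ _ _ (K * `|v|)) => [a x y|x].
  by rewrite (clP _ _ _ cA) linearPl.
by rewrite tens_norm mulrAC ler_wpM2r.
Qed.

Lemma cl_tensr E F (G : normedModType R) (u : E) (B : G -> F) : cont_linear B ->
  cont_linear (fun x => tens TS u (B x)).
Proof.
move=> cB; have [K K0 BK] := cl_bound cB.
apply: (@bound_cl _ _ _ _ (`|u| * K)) => [a x y|x].
  by rewrite (clP _ _ _ cB) linearPr.
by rewrite tens_norm -mulrA ler_wpM2l.
Qed.

End Tensor.

(** * The grading of the algebra *)

Section Grading.
Context {R : realType} {TS : tensor_system R} {V : completeNormedModType R}.
Context {TP : tensor_powers TS V} {n : nat} (X : triple TP n).
Local Notation one := (bone (alg X)).

(** The scalar component of an element. *)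
Definition counit (a : X) : R := proj X 0 a.
(** The map s of P_n, seen as an endomorphism of the whole algebra. *)
Definition hcomp (s : idx X) (a : X) : X := inj X (deg s) (sig X s a).
(** The element deprived of its scalar component; it is a - 1 on the group. *)
Definition aug (a : X) : X := a - counit a *: one.

Lemma counitP k a b : counit (k *: a + b) = k * counit a + counit b.
Proof. by rewrite /counit linearP. Qed.

Lemma norm_inj k (v : tpow TP k) : (k <= n)%N -> `|inj X k v| = `|v|.
Proof.
move=> kn; rewrite norm_proj (bigD1 (Ordinal (kn : (k < n.+1)%N)))//= injK//.
rewrite big1 ?addr0// => -[i/= lin] /eqP ik.
rewrite proj_inj0 ?normr0//.
by move=> ik'; apply: ik; apply: val_inj.
Qed.

Lemma inj_cl k : (k <= n)%N -> cont_linear (inj X k).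
Proof. by move=> kn; apply: isom_cl => v; exact: norm_inj. Qed.

Lemma norm_proj_le k a : (k <= n)%N -> `|proj X k a| <= `|a|.
Proof.
move=> kn; rewrite [leRHS]norm_proj (bigD1 (Ordinal (kn : (k < n.+1)%N)))//=.
by rewrite lerDl sumr_ge0.
Qed.

Lemma proj_cl k : (k <= n)%N -> cont_linear (proj X k).
Proof.
move=> kn; apply: (@bound_cl _ _ _ _ 1) => [a u v|v]; first by rewrite linearP.
by rewrite mul1r norm_proj_le.
Qed.

Lemma hcomp_cl s : cont_linear (hcomp s).
Proof.
have := cl_comp (cl_linear (@sig_cont _ _ _ _ _ X s)) (inj_cl (deg_le s)).
exact.
Qed.

Lemma norm_hcomp s a : `|hcomp s a| = `|sig X s a|.
Proof. by rewrite norm_inj// deg_le. Qed.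

Lemma proj_injE j k (v : tpow TP j) : (j <= n)%N -> (k <= n)%N ->
  inj X k (proj X k (inj X j v)) = if j == k then inj X j v else 0.
Proof.
move=> jn kn; have [jk|/eqP jk] := eqVneq j k; last first.
  by rewrite proj_inj0// ?linear0//; exact/nesym.
by subst k; rewrite injK.
Qed.

Lemma proj_hcomp k a : (k <= n)%N ->
  inj X k (proj X k a) = \sum_(s | deg s == k) hcomp s a.
Proof.
move=> kn; rewrite {1}[a]sum_sig linear_sum linear_sum/= [RHS]big_mkcond/=.
by apply: eq_bigr => s _; rewrite proj_injE// deg_le.
Qed.

Lemma counit_inj0 a : inj X 0 (proj X 0 a) = counit a *: inj X 0 (1 : R).
Proof.
rewrite /counit -linearZ; congr (inj X 0 _).
by rewrite [RHS](mulr1 (proj X 0 a : R)).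
Qed.

(** The maps of degree 0 add up to the scalar component, whatever their number. *)
Lemma sum_hcomp a :
  a = counit a *: inj X 0 (1 : R) + \sum_(s | (1 <= deg s)%N) hcomp s a.
Proof.
rewrite -counit_inj0 proj_hcomp// {1}[a]sum_sig (bigID (fun s => deg s == 0%N))/=.
by congr (_ + _); apply: eq_bigl => s; rewrite lt0n.
Qed.

Lemma counit1 : counit one = 1.
Proof. exact/grp_sig0/grp1. Qed.

Lemma hcomp_mul s a b : (1 <= deg s)%N -> hcomp s (alg X a b) =
  counit b *: hcomp s a + counit a *: hcomp s b +
  \sum_(q <- comul_red s)
    inj X (deg q.1 + deg q.2) (tp_cat TP (sig X q.1 a) (sig X q.2 b)).
Proof. by move=> s1; exact: (sig_mul s1 a b). Qed.

(** By induction on the degree: the multiplication rule at 1 1 = 1 expresses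
    hcomp s 1 through components of 1 of lower positive degree. *)
Lemma hcomp1 s : (1 <= deg s)%N -> hcomp s one = 0.
Proof.
have [m] := ubnP (deg s); elim: m s => // m ih s sm s1.
have := hcomp_mul one one s1; rewrite bmul1l counit1 scale1r.
rewrite big_seq big1 => [|q qs]; last first.
  have [q1 q2 qd] := comul_red_deg s1 qs.
  have c1 : hcomp q.1 one = 0 by apply: ih => //; lia.
  have /eqP : `|sig X q.1 one| = 0 by rewrite -norm_hcomp c1 normr0.
  by rewrite normr_eq0 => /eqP ->; rewrite linear0l linear0.
by rewrite addr0 => /eqP; rewrite -subr_eq subrr eq_sym => /eqP.
Qed.

Lemma one_inj0 : one = inj X 0 (1 : R).
Proof.
by rewrite [LHS]sum_hcomp counit1 scale1r big1 ?addr0// => s /hcomp1.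
Qed.

Lemma aug_sum a : aug a = \sum_(s | (1 <= deg s)%N) hcomp s a.
Proof. by rewrite /aug {1}[a]sum_hcomp one_inj0 addrAC subrr add0r. Qed.

Lemma norm_one : `|one| = 1.
Proof. by rewrite one_inj0 norm_inj// normr1. Qed.

Lemma aug_cl : cont_linear aug.
Proof.
apply: (@bound_cl _ _ _ _ 2) => [a u v|v].
  by rewrite /aug counitP scalerDl scalerBr !scalerA opprD addrACA.
rewrite (le_trans (ler_normB _ _))// normrZ norm_one mulr1 mulr_natl mulr2n.
by rewrite lerD2l; exact: (@norm_proj_le 0).
Qed.

Lemma aug_id a : counit a = 0 -> aug a = a.
Proof. by rewrite /aug => ->; rewrite scale0r subr0. Qed.

Lemma counit_inj k (v : tpow TP k) : (1 <= k <= n)%N -> counit (inj X k v) = 0.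
Proof.
by case/andP=> k0 kn; rewrite /counit proj_inj0// => k1; rewrite -k1 in k0.
Qed.

Lemma mull_cl (a : X) : cont_linear (fun b => alg X a b).
Proof.
apply: (@bound_cl _ _ _ _ `|a|) => [k u v|v]; last exact: bmul_norm.
by rewrite linearPr.
Qed.

Lemma norm_cat j k (u : tpow TP j) (v : tpow TP k) :
  `|tp_cat TP u v| = `|u| * `|v|.
Proof.
have [f [fn _ fuv]] := tp_cat_tensor TP j k.
by rewrite -fuv fn tens_norm.
Qed.

Section Conditions.
Hypotheses (h1 : S1 X) (h2 : S2 X).

(** Condition (S1): the group spans a dense subspace, in dual form. *)
Lemma S1_eq (U : completeNormedModType R) (f f' : X -> U) :
  cont_linear f -> cont_linear f' -> (forall a, grp X a -> f a = f' a) ->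
  forall v, f v = f' v.
Proof.
move=> cf cf' ff' v; apply/eqP; rewrite -subr_eq0; apply/eqP.
apply: (h1 (cl_sub cf cf')) => a Ga; by rewrite ff'// subrr.
Qed.

Lemma tpow_cat1 k (v : tpow TP k) :
  inj X (k + 0) (@tp_cat _ _ _ TP k 0 v (1 : R)) = inj X k v.
Proof.
have /(congr1 (fun z : {k & tpow TP k} => inj X (projT1 z) (projT2 z))) :=
  tp_cat1r v; exact.
Qed.

(** A map of P_n vanishes on the tensor powers of another degree.  For the
    one-element list [:: s], (S2) says that on the group it factors through the
    projection of degree [deg s], and (S1) propagates this to the algebra. *)
Lemma hcomp_inj0 s k (v : tpow TP k) : (k <= n)%N -> k <> deg s ->
  hcomp s (inj X k v) = 0.
Proof.
move=> kn ks; have dn : (degs [:: s] <= n)%N by rewrite /degs/= addn0 deg_le.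
have [f [cf fE]] := h2 dn.
have E : forall a, hcomp s a = inj X (degs [:: s]) (f (proj X (degs [:: s]) a)).
  apply: S1_eq.
  - exact: hcomp_cl.
  - exact: (cl_comp (cl_comp (proj_cl dn) cf) (inj_cl dn)).
  - by move=> a Ga; rewrite fE//= tpow_cat1.
rewrite E proj_inj0 ?(cl0 cf) ?linear0//; rewrite /degs/= addn0; exact/nesym.
Qed.

Lemma hcomp_idem s a : hcomp s (hcomp s a) = hcomp s a.
Proof. by rewrite /hcomp sig_idem. Qed.

End Conditions.
End Grading.

(** * Products in the group and linearization of pairs *)

Section Multiplication.
Context {R : realType} {TS : tensor_system R} {V : completeNormedModType R}.
Context {TP : tensor_powers TS V} {n : nat} (X : triple TP n).
Hypotheses (h1 : S1 X) (h2 : S2 X).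

Lemma hcomp_bound : exists2 B, 0 <= B &
  forall (s : idx X) a, `|hcomp s a| <= B * `|a|.
Proof.
exists (\sum_(s : idx X) opnorm (hcomp s)).
  by apply: sumr_ge0 => s _; exact: opnorm_ge0.
move=> s a; apply: (le_trans (opnormP a (hcomp_cl s))); rewrite ler_wpM2r//.
by rewrite (bigD1 s)//= lerDl sumr_ge0// => t _; exact: opnorm_ge0.
Qed.

(** The element [a] has scalar component 1 and its components of positive degree d
    have norm at most r^d; thus [r] bounds its homogeneous norm up to a constant. *)
Definition small (r : R) (a : X) : Prop :=
  counit a = 1 /\ forall s : idx X, (1 <= deg s)%N -> `|hcomp s a| <= r ^+ deg s.

(** The size of the part of degree d of a c, for [a] of size r and c of
    degree k: this part vanishes when d < k. *)
Definition trpow (r : R) (d k : nat) : R := if (d < k)%N then 0 else r ^+ (d - k).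

Lemma trpow_ge0 r d k : 0 <= r -> 0 <= trpow r d k.
Proof. by move=> r0; rewrite /trpow; case: ifP => // _; exact: exprn_ge0. Qed.

Lemma sig_eq0 (s : idx X) a : hcomp s a = 0 -> sig X s a = 0.
Proof.
by move=> ca; apply/eqP; rewrite -normr_eq0 -norm_hcomp ca normr0.
Qed.

(** Multiplication does not lower degrees. *)
Lemma hcomp_mul_inj0 (s : idx X) a k (v : tpow TP k) :
  (1 <= deg s)%N -> (deg s < k <= n)%N -> hcomp s (alg X a (inj X k v)) = 0.
Proof.
move=> s1 /andP[sk kn]; rewrite hcomp_mul// counit_inj ?scale0r ?add0r; last by lia.
rewrite hcomp_inj0//; last by move=> ks; rewrite ks ltnn in sk.
rewrite scaler0 add0r big_seq big1// => q qs.
have [q1 q2 qd] := comul_red_deg s1 qs.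
rewrite [sig X q.2 _]sig_eq0 ?linear0r ?linear0//.
by apply: hcomp_inj0 => // kq; lia.
Qed.

Lemma hcomp_mul_inj : exists2 C, 0 <= C &
  forall (a : X) r, 0 <= r -> small r a ->
  forall (s : idx X) k (v : tpow TP k), (1 <= deg s)%N -> (1 <= k <= n)%N ->
  `|hcomp s (alg X a (inj X k v))| <= C * trpow r (deg s) k * `|v|.
Proof.
have [B B0 Bc] := hcomp_bound.
pose N := \sum_(s : idx X) size (comul_red s).
exists (B * (1 + N%:R)); first by rewrite mulr_ge0// addr_ge0.
move=> a r r0 [a1 ar] s k v s1 kn; have [_ kn'] := andP kn.
rewrite /trpow; case: ifP => sk.
  by rewrite hcomp_mul_inj0 ?normr0 ?mulr0 ?mul0r// sk kn'.
rewrite hcomp_mul// counit_inj// scale0r add0r a1 scale1r.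
rewrite (le_trans (ler_normD _ _))// mulrDr mulr1 -mulrA mulrDl lerD//.
  have [ks|/eqP ks] := eqVneq k (deg s).
    by rewrite -[in r ^+ _]ks subnn expr0 mul1r (le_trans (Bc _ _))// norm_inj.
  by rewrite hcomp_inj0// normr0 !mulr_ge0// exprn_ge0.
rewrite (le_trans (ler_norm_sum _ _ _))//.
apply: (@le_trans _ _ (\sum_(q <- comul_red s) B * (r ^+ (deg s - k) * `|v|))).
  rewrite big_seq [leRHS]big_seq; apply: ler_sum => q qs.
  have [q1 q2 qd] := comul_red_deg s1 qs.
  rewrite norm_inj ?norm_cat; last by rewrite qd; exact: deg_le.
  have [qk|/eqP qk] := eqVneq k (deg q.2); last first.
    rewrite [sig X q.2 _]sig_eq0 ?normr0 ?mulr0; first by rewrite !mulr_ge0// exprn_ge0.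
    exact: hcomp_inj0.
  rewrite -!norm_hcomp mulrCA; apply: ler_pM => //.
    by apply: (le_trans (ar _ q1)); rewrite -qd qk addnK.
  by apply: (le_trans (Bc _ _)); rewrite norm_inj.
rewrite big_const_seq count_predT iter_addr_0 -[leLHS]mulr_natr.
rewrite -!mulrA ler_wpM2l// mulrA mulrC ler_wpM2r ?mulr_ge0 ?exprn_ge0//.
by rewrite ler_nat /N (bigD1 s)//= leq_addr.
Qed.

(** Pairs of maps of P_n of positive degree. *)
Definition pairs : pred (idx X * idx X) :=
  fun q => (1 <= deg q.1)%N && (1 <= deg q.2)%N.
(** Pairs whose total degree is at most n, to which (S2) applies. *)
Definition lowpairs : pred (idx X * idx X) :=
  fun q => pairs q && (deg q.1 + deg q.2 <= n)%N.

(** A surjective linear isometry has a continuous linear inverse. *)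
Lemma isom_inv (E F : normedModType R) (f : {linear E -> F}) :
  (forall w, `|f w| = `|w|) -> (forall x, exists w, f w = x) ->
  exists2 e, cont_linear e & cancel f e.
Proof.
move=> fn fs; pose e x := sval (cid (fs x)).
have fe x : f (e x) = x by rewrite /e; case: cid.
have fI : injective f.
  move=> x y fxy; apply/eqP; rewrite -subr_eq0 -normr_eq0 -fn linearB fxy.
  by rewrite subrr normr0.
exists e; last by move=> w; apply: fI; rewrite fe.
apply: (@bound_cl _ _ _ _ 1) => [a u v|v]; last by rewrite mul1r -fn fe.
by apply: fI; rewrite linearP !fe.
Qed.

(** The map J sends b to q.1 b (x) q.2 b on the group.  It is the map of (S2)
    for the list [:: q.1; q.2], followed by the identification of the tensor
    power with a tensor product. *)
Lemma pair_linearization q : lowpairs q -> exists J : X -> TS X X,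
  [/\ cont_linear J,
      forall b, grp X b -> J b = tens TS (hcomp q.1 b) (hcomp q.2 b) &
      forall k (v : tpow TP k), (k <= n)%N -> k <> (deg q.1 + deg q.2)%N ->
        J (inj X k v) = 0].
Proof.
case/andP=> _ qn.
have dE : degs [:: q.1; q.2] = (deg q.1 + deg q.2)%N by rewrite /degs/= addn0.
have dn : (degs [:: q.1; q.2] <= n)%N by rewrite dE.
have [f [cf fE]] := h2 dn.
have [e [en es et]] := tp_cat_tensor TP (deg q.1) (deg q.2 + 0).
have [e' ce' eK] := isom_inv en es.
have i1 : cont_linear (inj X (deg q.1)) by exact/inj_cl/deg_le.
have i2 : cont_linear (inj X (deg q.2 + 0)).
  by apply: inj_cl; rewrite addn0 deg_le.
exists (tmap TS (inj X (deg q.1)) (inj X (deg q.2 + 0)) \o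
   (e' \o (f \o proj X (degs [:: q.1; q.2])))); split.
- apply: cl_comp; last exact: tmap_cont_linear.
  by apply: cl_comp => //; apply: cl_comp => //; exact: proj_cl.
- move=> b Gb /=; rewrite fE//= -et eK tmap_tens// /hcomp.
  by rewrite tpow_cat1.
- move=> k v kn kq /=; rewrite proj_inj0//; last by rewrite dE; exact/nesym.
  by rewrite (cl0 cf) (cl0 ce') (cl0 (tmap_cont_linear _ i1 i2)).
Qed.

(** A choice of linear maps J q with J q b = q.1 b (x) q.2 b on the group. *)
Definition linearization (J : idx X * idx X -> X -> TS X X) : Prop :=
  forall q, lowpairs q ->
  [/\ cont_linear (J q),
      forall b, grp X b -> J q b = tens TS (hcomp q.1 b) (hcomp q.2 b),
      forall k (v : tpow TP k), (k <= n)%N -> k <> (deg q.1 + deg q.2)%N ->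
        J q (inj X k v) = 0 &
      forall c, tmap TS (hcomp q.1) (hcomp q.2) (J q c) = J q c].

Lemma linearization_exists : exists J, linearization J.
Proof.
have H q : exists J : X -> TS X X, lowpairs q ->
  [/\ cont_linear J,
      forall b, grp X b -> J b = tens TS (hcomp q.1 b) (hcomp q.2 b) &
      forall k (v : tpow TP k), (k <= n)%N -> k <> (deg q.1 + deg q.2)%N ->
        J (inj X k v) = 0].
  have [/pair_linearization[J HJ]|_] := boolP (lowpairs q); first by exists J.
  by exists (fun=> 0).
have [J HJ] := choice H; exists J => q /HJ[cJ JG J0]; split=> // c.
have ct := tmap_cont_linear TS (hcomp_cl q.1) (hcomp_cl q.2).
apply: (S1_eq h1 (cl_comp cJ ct) cJ) => a Ga /=.
by rewrite JG// tmap_tens ?hcomp_idem//; exact: hcomp_cl.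
Qed.

Section WithJ.
Variables (J : idx X * idx X -> X -> TS X X) (HJ : linearization J).

Lemma J_cl q : lowpairs q -> cont_linear (J q). Proof. by case/HJ. Qed.
Lemma J_grp q b : lowpairs q -> grp X b ->
  J q b = tens TS (hcomp q.1 b) (hcomp q.2 b).
Proof. by case/HJ => _ + _ _ => /[apply]. Qed.
Lemma J_one q : lowpairs q -> J q (bone (alg X)) = 0.
Proof.
move=> qQ; have /andP[/andP[q1 _] _] := qQ.
by rewrite J_grp//; [rewrite hcomp1// linear0l|exact: grp1].
Qed.

Lemma mul_aug (a b : X) : counit b = 1 ->
  alg X a b = a + alg X a (aug b).
Proof.
by move=> b1; rewrite /aug b1 scale1r linearBr/= bmul1r addrC subrK.
Qed.

Lemma sum_pair_tens (U1 U2 : completeNormedModType R) (f : X -> U1)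
    (g : X -> U2) (x y : X) : cont_linear f -> cont_linear g ->
  \sum_(p | pairs p) tens TS (f (hcomp p.1 x)) (g (hcomp p.2 y)) =
  tens TS (f (aug x)) (g (aug y)).
Proof.
move=> cf cg; rewrite !aug_sum (cl_sum _ _ _ cf) (cl_sum _ _ _ cg).
rewrite linear_sumlz/=; under [RHS]eq_bigr do rewrite linear_sumr.
by rewrite pair_big/=.
Qed.

(** On the group, J q (a b) - J q a is the increment of the elementary tensor
    q.1 (x) q.2 from a to a b.  It is expanded, and its quadratic part in b is
    linearized by the maps J again; (S1) then allows any c in place of b - 1. *)
Lemma J_mul q a c : lowpairs q -> grp X a -> counit c = 0 ->
  J q (alg X a c) =
  tens TS (hcomp q.1 a) (hcomp q.2 (alg X a c)) +
  tens TS (hcomp q.1 (alg X a c)) (hcomp q.2 a) +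
  \sum_(q' | lowpairs q') tmap TS (hcomp q.1 \o alg X a) (hcomp q.2 \o alg X a)
    (J q' c).
Proof.
move=> qQ Ga c0; have cq1 := hcomp_cl q.1; have cq2 := hcomp_cl q.2.
have cx := cl_comp (mull_cl a) cq1; have cy := cl_comp (mull_cl a) cq2.
pose rhs c := tens TS (hcomp q.1 a) (hcomp q.2 (alg X a c)) +
  tens TS (hcomp q.1 (alg X a c)) (hcomp q.2 a) +
  \sum_(q' | lowpairs q') tmap TS (hcomp q.1 \o alg X a) (hcomp q.2 \o alg X a)
    (J q' c).
have crhs : cont_linear rhs.
  apply: cl_add; first by apply: cl_add; [exact: cl_tensr|exact: cl_tensl].
  apply: cl_bigsum => q' Qq'.
  exact: (cl_comp (J_cl Qq') (tmap_cont_linear TS cx cy)).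
suff /(_ c) : forall c, (J q \o alg X a \o @aug _ _ _ _ _ X) c =
    (rhs \o @aug _ _ _ _ _ X) c by rewrite /= aug_id.
have caug := @aug_cl _ _ _ _ _ X.
apply: (S1_eq h1 _ (cl_comp caug crhs)) => [|b Gb].
  exact: (cl_comp caug (cl_comp (mull_cl a) (J_cl qQ))).
have b1 : counit b = 1 by exact: grp_sig0.
have -> : (J q \o alg X a \o @aug _ _ _ _ _ X) b = J q (alg X a b) - J q a.
  by rewrite /= (mul_aug a b1) (clD _ _ (J_cl qQ)) addrC addKr.
rewrite !J_grp//; last exact: grpM.
rewrite (mul_aug a b1) (clD _ _ cq1) (clD _ _ cq2).
rewrite /rhs; set z := alg X a (aug b); set x := hcomp q.1; set y := hcomp q.2.
rewrite linearDl !linearDr/=.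
rewrite addrAC [X in X - _]addrC addrK addrA; congr (_ + _).
have cxa : cont_linear (x \o alg X a) by [].
have cya : cont_linear (y \o alg X a) by [].
have /= := sum_pair_tens b b cxa cya; rewrite -/z => <-.
rewrite (bigID lowpairs)/= [X in _ + X]big1 ?addr0.
  apply: eq_big => [q'|q' Qq']; first by rewrite /lowpairs; case: pairs.
  have {}Qq' : lowpairs q' by case/andP: Qq'.
  rewrite /aug b1 scale1r (clB _ _ (J_cl Qq')) J_one// subr0 J_grp//.
  by rewrite tmap_tens.
(* in total degree above n >= deg q.1 + deg q.2 one factor has too low a degree *)
move=> q' /andP[pq']; rewrite /lowpairs pq' /= -ltnNge => nq'.
have /andP[/andP[q1 q2] qn] := qQ.
have [lt1|le1] := ltnP (deg q.1) (deg q'.1).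
  by rewrite /x [hcomp q.1 _]hcomp_mul_inj0 ?lt1 ?deg_le// linear0l.
have lt2 : (deg q.2 < deg q'.2)%N by lia.
by rewrite /y [hcomp q.2 _]hcomp_mul_inj0 ?lt2 ?deg_le// linear0r.
Qed.

End WithJ.
End Multiplication.

(** * The product of two linear maps on the group *)

Section Product.
Context {R : realType} {TS : tensor_system R} {V : completeNormedModType R}.
Context {TP : tensor_powers TS V} {n : nat} (X : triple TP n).
Hypotheses (h1 : S1 X) (h2 : S2 X).
Variables (J : idx X * idx X -> X -> TS X X) (HJ : linearization J).
Local Notation one := (bone (alg X)).

Section Fixed.
Context {U1 U2 : completeNormedModType R}.
Implicit Types (A : X -> U1) (B : X -> U2).

(** The linear map that agrees on the group with the components of total
    degree at most n of a |-> A a (x) B a. *)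
Definition quad A B (c : X) : TS U1 U2 := \sum_(q | lowpairs q) tmap TS A B (J q c).

Lemma quad_cl A B : cont_linear A -> cont_linear B -> cont_linear (quad A B).
Proof.
move=> cA cB; apply: cl_bigsum => q Qq.
exact: (cl_comp (J_cl HJ Qq) (tmap_cont_linear TS cA cB)).
Qed.

(** Pairs whose total degree exceeds n: these produce the error terms. *)
Definition highpairs : pred (idx X * idx X) :=
  fun q => pairs q && ~~ lowpairs q.

Lemma sum_pairs_split (f : idx X * idx X -> TS U1 U2) :
  \sum_(q | pairs q) f q = \sum_(q | lowpairs q) f q + \sum_(q | highpairs q) f q.
Proof.
rewrite (bigID (@lowpairs _ _ _ _ _ X))/=; congr (_ + _).
by apply: eq_bigl => q; rewrite /lowpairs; case: pairs.
Qed.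

Lemma quad_grp A B a : cont_linear A -> cont_linear B -> grp X a ->
  A one = 0 -> B one = 0 ->
  quad A B a = tens TS (A a) (B a) -
    \sum_(p | highpairs p) tens TS (A (hcomp p.1 a)) (B (hcomp p.2 a)).
Proof.
move=> cA cB Ga A1 B1.
have -> : tens TS (A a) (B a) = tens TS (A (aug a)) (B (aug a)).
  by rewrite /aug !(clB _ _ cA, clB _ _ cB, clZ _ _ cA, clZ _ _ cB) A1 B1
    !scaler0 !subr0.
rewrite -sum_pair_tens// sum_pairs_split addrK; apply: eq_bigr => q Qq.
by rewrite (J_grp HJ)// tmap_tens.
Qed.

(** The components of total degree above n that are missing from the complete
    expansion of A (a c) (x) B (a c). *)
Definition quad_rem A B a c : TS U1 U2 := \sum_(p | highpairs p)
  (tens TS (A (hcomp p.1 a)) (B (hcomp p.2 (alg X a c))) +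
   tens TS (A (hcomp p.1 (alg X a c))) (B (hcomp p.2 a)) +
   \sum_(q | lowpairs q)
     tmap TS (A \o (hcomp p.1 \o alg X a)) (B \o (hcomp p.2 \o alg X a)) (J q c)).

Lemma aug_kill (U : completeNormedModType R) (f : X -> U) x : cont_linear f ->
  f one = 0 -> f (aug x) = f x.
Proof. by move=> cf f1; rewrite /aug (clB _ _ cf) (clZ _ _ cf) f1 scaler0 subr0. Qed.

(** The exact increment of [quad A B] under left multiplication by [a]. *)
Lemma quad_mul A B a c : cont_linear A -> cont_linear B -> grp X a ->
  A one = 0 -> B one = 0 -> counit c = 0 ->
  quad A B (alg X a c) =
  tens TS (A a) (B (alg X a c)) + tens TS (A (alg X a c)) (B a) +
  quad (A \o alg X a) (B \o alg X a) c - quad_rem A B a c.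
Proof.
move=> cA cB Ga A1 B1 c0.
have cL := mull_cl a.
have cp s : cont_linear (hcomp s \o alg X a) := cl_comp cL (hcomp_cl s).
have cAp s : cont_linear (A \o (hcomp s \o alg X a)) := cl_comp (cp s) cA.
have cBp s : cont_linear (B \o (hcomp s \o alg X a)) := cl_comp (cp s) cB.
pose f p := tens TS (A (hcomp p.1 a)) (B (hcomp p.2 (alg X a c))) +
   tens TS (A (hcomp p.1 (alg X a c))) (B (hcomp p.2 a)) +
   \sum_(q | lowpairs q)
     tmap TS (A \o (hcomp p.1 \o alg X a)) (B \o (hcomp p.2 \o alg X a)) (J q c).
have -> : quad A B (alg X a c) = \sum_(p | lowpairs p) f p.
  apply: eq_bigr => q Qq; have ct := tmap_cont_linear TS cA cB.
  rewrite (J_mul h1 h2 HJ)// !(clD _ _ ct) (cl_sum _ _ _ ct) !tmap_tens//.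
  by congr (_ + _); apply: eq_bigr => q' Qq'; rewrite tmap_comp.
rewrite -/f /quad_rem -/f; apply/eqP; rewrite eq_sym subr_eq -sum_pairs_split.
rewrite /f !big_split/= !sum_pair_tens// !aug_kill//; apply/eqP; congr (_ + _).
rewrite exchange_big/=; apply: eq_bigr => q Qq.
under eq_bigl => p do rewrite /pairs.
rewrite -(pair_big (fun s => 1 <= deg s)%N (fun s => 1 <= deg s)%N
  (fun s s' => tmap TS (A \o (hcomp s \o alg X a)) (B \o (hcomp s' \o alg X a)) (J q c)))/=.
rewrite -tmap_sum2//; congr (tmap TS _ _ _); apply/funext => u /=.
  by rewrite -(cl_sum _ _ _ cA) -aug_sum aug_kill.
by rewrite -(cl_sum _ _ _ cB) -aug_sum aug_kill.
Qed.

End Fixed.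

Lemma norm_sum_le (I : finType) (W : normedModType R) (P : pred I) (f : I -> W) (K : R) :
  0 <= K -> (forall i, P i -> `|f i| <= K) ->
  `|\sum_(i | P i) f i| <= #|I|%:R * K.
Proof.
move=> K0 fK; apply: (le_trans (ler_norm_sum _ _ _)).
apply: (@le_trans _ _ (\sum_(i : I) K)).
  rewrite big_mkcond/=; apply: ler_sum => i _; case: ifP => // Pi; exact: fK.
by rewrite sumr_const mulr_natl cardT enumT.
Qed.

Lemma J_bound : exists2 BJ, 0 <= BJ &
  forall (q : idx X * idx X) c, lowpairs q -> `|J q c| <= BJ * `|c|.
Proof.
exists (\sum_(q | lowpairs q) opnorm (J q)).
  by apply: sumr_ge0 => q _; exact: opnorm_ge0.
move=> q c Qq; apply: (le_trans (opnormP c (J_cl HJ Qq))); rewrite ler_wpM2r//.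
by rewrite (bigD1 q)//= lerDl sumr_ge0// => t _; exact: opnorm_ge0.
Qed.

Lemma small_norm (Q r : R) (a : X) : 1 <= Q -> 0 <= r <= Q -> small r a ->
  `|a| <= 1 + #|idx X|%:R * Q ^+ n.
Proof.
move=> Q1 /andP[r0 rQ] [a1 ar]; rewrite {1}[a](_ : _ = one + aug a); last first.
  by rewrite /aug a1 scale1r addrC subrK.
rewrite (le_trans (ler_normD _ _))// norm_one lerD2l aug_sum.
have Q0 : 0 <= Q by exact: le_trans Q1.
apply: norm_sum_le => [|s s1]; first exact: exprn_ge0.
apply: (le_trans (ar _ s1)); apply: (@le_trans _ _ (Q ^+ deg s)).
  exact: lerXn2r.
by apply: ler_weXn2l => //; exact: deg_le.
Qed.

Section Estimates.
Variables (Bc BJ C3 Q : R).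
Hypotheses (Bc0 : 0 <= Bc) (HBc : forall (s : idx X) a, `|hcomp s a| <= Bc * `|a|).
Hypotheses (BJ0 : 0 <= BJ)
  (HBJ : forall (q : idx X * idx X) c, lowpairs q -> `|J q c| <= BJ * `|c|).
Hypotheses (C30 : 0 <= C3)
  (HC3 : forall (a : X) r, 0 <= r -> small r a ->
  forall (s : idx X) k (v : tpow TP k), (1 <= deg s)%N -> (1 <= k <= n)%N ->
  `|hcomp s (alg X a (inj X k v))| <= C3 * trpow r (deg s) k * `|v|).
Hypothesis Q1 : 1 <= Q.
Let Q0 : 0 <= Q. Proof. exact: le_trans Q1. Qed.
Let N : R := #|{: idx X * idx X}|%:R.
Let Ba : R := 1 + #|idx X|%:R * Q ^+ n.
Let N0 : 0 <= N. Proof. exact: ler0n. Qed.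
Let Ba0 : 0 <= Ba.
Proof. by rewrite addr_ge0// mulr_ge0// exprn_ge0. Qed.

Section Fixed2.
Context {U1 U2 : completeNormedModType R}.
Implicit Types (A : X -> U1) (B : X -> U2).

Lemma quad_bound A B M1 M2 c : cont_linear A -> cont_linear B ->
  0 <= M1 -> 0 <= M2 ->
  (forall v, `|A v| <= M1 * `|v|) -> (forall v, `|B v| <= M2 * `|v|) ->
  `|quad A B c| <= N * (M1 * M2 * (BJ * `|c|)).
Proof.
move=> cA cB M10 M20 AM BM; apply: norm_sum_le => [|q Qq].
  by rewrite !mulr_ge0.
apply: (le_trans (tmap_le cA cB M10 M20 AM BM _)).
by rewrite ler_wpM2l ?mulr_ge0// HBJ.
Qed.

Variables (a : X) (r : R) (rho : nat -> R).
Hypotheses (Ga : grp X a) (rQ : 0 <= r <= Q) (ar : small r a).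
Hypotheses (rho0 : forall k, 0 <= rho k)
  (rhoQ : forall j k, (j <= k <= n)%N -> rho j <= Q * rho k)
  (rrho : forall m k, (k <= n)%N -> (n < m + k)%N -> (m <= n + n)%N ->
     r ^+ m <= Q * rho k).
Let r0 : 0 <= r. Proof. by case/andP: rQ. Qed.

(** Sizes at degrees adding up to more than n are of the order of the remainder. *)
Lemma trpow_rho d1 d2 k1 k2 : (d1 <= n)%N -> (d2 <= n)%N -> (n < d1 + d2)%N ->
  (k1 + k2 <= n)%N -> trpow r d1 k1 * trpow r d2 k2 <= Q * rho (k1 + k2).
Proof.
move=> d1n d2n dn kn; rewrite /trpow.
case: ifPn => k1d; first by rewrite mul0r mulr_ge0.
case: ifPn => k2d; first by rewrite mulr0 mulr_ge0.
by rewrite -exprD; apply: rrho => //; lia.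
Qed.

Lemma mul_small A M1 v : 0 <= M1 ->
  (forall v, `|A v| <= M1 * `|v|) -> `|A (alg X a v)| <= M1 * Ba * `|v|.
Proof.
move=> M10 AM; apply: (le_trans (AM _)); rewrite -mulrA ler_wpM2l//.
by apply: (le_trans (bmul_norm _ _ _)); rewrite ler_wpM2r// (small_norm Q1 rQ).
Qed.

Lemma highpairsP (p : idx X * idx X) : highpairs p ->
  [/\ (1 <= deg p.1)%N, (1 <= deg p.2)%N & (n < deg p.1 + deg p.2)%N].
Proof.
case/andP => pp; rewrite /lowpairs pp /= -ltnNge => np.
by case/andP: pp.
Qed.

Lemma lowpairsP (p : idx X * idx X) : lowpairs p ->
  [/\ (1 <= deg p.1)%N, (1 <= deg p.2)%N & (deg p.1 + deg p.2 <= n)%N].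
Proof. by case/andP => /andP[]. Qed.

Lemma trpow_r0 s : trpow r s 0 = r ^+ s.
Proof. by rewrite /trpow ltn0 subn0. Qed.

(** The truncation error of [quad A B a]. *)
Lemma high_bound A B M1 M2 : 0 <= M1 -> 0 <= M2 ->
  (forall v, `|A v| <= M1 * `|v|) -> (forall v, `|B v| <= M2 * `|v|) ->
  `|\sum_(p | highpairs p) tens TS (A (hcomp p.1 a)) (B (hcomp p.2 a))| <=
  N * (M1 * M2 * (Q * rho 0)).
Proof.
move=> M10 M20 AM BM; apply: norm_sum_le => [|p /highpairsP[p1 p2 pn]].
  by rewrite !mulr_ge0.
have [_ ar2] := ar.
rewrite tens_norm (@le_trans _ _ ((M1 * r ^+ deg p.1) * (M2 * r ^+ deg p.2)))//.
  apply: ler_pM => //.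
    by apply: (le_trans (AM _)); rewrite ler_wpM2l// ar2.
  by apply: (le_trans (BM _)); rewrite ler_wpM2l// ar2.
rewrite mulrACA ler_wpM2l ?mulr_ge0// -!trpow_r0.
by apply: (@trpow_rho _ _ 0 0) => //; exact: deg_le.
Qed.

(** The truncation error of [quad A B] along left multiplication by [a]. *)
Lemma rem_bound A B M1 M2 k (v : tpow TP k) : (1 <= k <= n)%N ->
  cont_linear A -> cont_linear B -> 0 <= M1 -> 0 <= M2 ->
  (forall v, `|A v| <= M1 * `|v|) -> (forall v, `|B v| <= M2 * `|v|) ->
  `|quad_rem A B a (inj X k v)| <=
  N * (M1 * M2 * (C3 + C3 + N * (C3 * Bc * (C3 * Bc) * BJ)) * (Q * rho k) * `|v|).
Proof.
move=> kn cA cB M10 M20 AM BM; have [k1 kn'] := andP kn; have [_ ar2] := ar.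
apply: norm_sum_le => [|p /highpairsP[p1 p2 pn]].
  by rewrite !(mulr_ge0, addr_ge0).
have dp1 := deg_le p.1; have dp2 := deg_le p.2.
rewrite mulrDr !mulrDl (le_trans (ler_normD _ _))//; apply: lerD.
  rewrite mulrDr !mulrDl (le_trans (ler_normD _ _))//; apply: lerD.
  - rewrite tens_norm.
    apply: (@le_trans _ _ ((M1 * r ^+ deg p.1) *
        (M2 * (C3 * trpow r (deg p.2) k * `|v|)))).
      apply: ler_pM => //.
        by apply: (le_trans (AM _)); rewrite ler_wpM2l// ar2.
      by apply: (le_trans (BM _)); rewrite ler_wpM2l// HC3.
    have := @trpow_rho (deg p.1) (deg p.2) 0 k dp1 dp2 pn kn'.
    rewrite trpow_r0 add0n => H.
    rewrite (_ : _ * _ = M1 * M2 * C3 * (r ^+ deg p.1 * trpow r (deg p.2) k) * `|v|);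
      last by ring.
    by rewrite ler_wpM2r// ler_wpM2l// !mulr_ge0.
  - rewrite tens_norm.
    apply: (@le_trans _ _ ((M1 * (C3 * trpow r (deg p.1) k * `|v|)) *
        (M2 * r ^+ deg p.2))).
      apply: ler_pM => //.
        by apply: (le_trans (AM _)); rewrite ler_wpM2l// HC3.
      by apply: (le_trans (BM _)); rewrite ler_wpM2l// ar2.
    have := @trpow_rho (deg p.1) (deg p.2) k 0 dp1 dp2 pn.
    rewrite trpow_r0 addn0 => /(_ kn') H.
    rewrite (_ : _ * _ = M1 * M2 * C3 * (trpow r (deg p.1) k * r ^+ deg p.2) * `|v|);
      last by ring.
    by rewrite ler_wpM2r// ler_wpM2l// !mulr_ge0.
have cL := mull_cl a.
have cp s : cont_linear (hcomp s \o alg X a) := cl_comp cL (hcomp_cl s).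
have cAp s : cont_linear (A \o (hcomp s \o alg X a)) := cl_comp (cp s) cA.
have cBp s : cont_linear (B \o (hcomp s \o alg X a)) := cl_comp (cp s) cB.
rewrite (_ : _ * `|v| = N * (M1 * M2 * (C3 * Bc * (C3 * Bc) * BJ) * (Q * rho k) * `|v|));
  last by ring.
apply: norm_sum_le => [|q Qq]; first by rewrite !mulr_ge0.
have [q1 q2 qn] := lowpairsP Qq.
have [_ _ J0 Jq] := HJ Qq.
have [qk|/eqP qk] := eqVneq k (deg q.1 + deg q.2)%N; last first.
  rewrite J0// (cl0 (tmap_cont_linear TS (cAp _) (cBp _))) normr0.
  by rewrite !mulr_ge0.
rewrite -Jq tmap_comp//; try exact: hcomp_cl.
pose ca s d := M1 * C3 * trpow r (deg s) d * Bc.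
have bA (s s' : idx X) (U : completeNormedModType R) (D : X -> U) M u : 0 <= M ->
    (forall v, `|D v| <= M * `|v|) -> (1 <= deg s)%N -> (1 <= deg s')%N ->
    `|D (hcomp s (alg X a (hcomp s' u)))| <=
    M * C3 * trpow r (deg s) (deg s') * Bc * `|u|.
  move=> M0 DM s1 s'1; apply: (le_trans (DM _)); rewrite -!mulrA ler_wpM2l//.
  apply: (le_trans (HC3 r0 ar _ s1 _)); first by rewrite s'1 deg_le.
  rewrite -mulrA ler_wpM2l// ler_wpM2l ?trpow_ge0//.
  by rewrite -norm_hcomp HBc.
apply: (le_trans (@tmap_le _ _ _ _ _ _ _ _
  (M1 * C3 * trpow r (deg p.1) (deg q.1) * Bc)
  (M2 * C3 * trpow r (deg p.2) (deg q.2) * Bc) _ _ _ _ _ _ _)).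
- exact: (cl_comp (hcomp_cl _) (cAp _)).
- exact: (cl_comp (hcomp_cl _) (cBp _)).
- by rewrite !mulr_ge0// trpow_ge0.
- by rewrite !mulr_ge0// trpow_ge0.
- by move=> u; apply: bA.
- by move=> u; apply: bA.
apply: (@le_trans _ _ (M1 * C3 * trpow r (deg p.1) (deg q.1) * Bc *
  (M2 * C3 * trpow r (deg p.2) (deg q.2) * Bc) * (BJ * `|v|))).
  apply: ler_wpM2l; first by rewrite !mulr_ge0 ?trpow_ge0.
  by apply: (le_trans (HBJ _ Qq)); rewrite norm_inj.
have := @trpow_rho (deg p.1) (deg p.2) (deg q.1) (deg q.2) dp1 dp2 pn qn.
rewrite -qk => H.
rewrite (_ : _ * _ = M1 * M2 * (C3 * Bc * (C3 * Bc) * BJ) * (trpow r (deg p.1) (deg q.1) * trpow r (deg p.2) (deg q.2)) * `|v|);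
  last by ring.
by rewrite ler_wpM2r// ler_wpM2l// !mulr_ge0.
Qed.

(** The contribution to [quad] of replacing A and B, transported by [a], with
    A' and B'. *)
Lemma quad_diff A A' B B' M1 M2 k (v : tpow TP k) : (1 <= k <= n)%N ->
  cont_linear A -> cont_linear B -> cont_linear A' -> cont_linear B' ->
  0 <= M1 -> 0 <= M2 ->
  (forall v, `|A v| <= M1 * `|v|) -> (forall v, `|B v| <= M2 * `|v|) ->
  (forall v, `|A' v| <= M1 * `|v|) -> (forall v, `|B' v| <= M2 * `|v|) ->
  (forall k (v : tpow TP k), (1 <= k <= n)%N ->
     `|A' (inj X k v) - A (alg X a (inj X k v))| <= M1 * rho k * `|v|) ->
  (forall k (v : tpow TP k), (1 <= k <= n)%N ->
     `|B' (inj X k v) - B (alg X a (inj X k v))| <= M2 * rho k * `|v|) ->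
  `|quad A' B' (inj X k v) - quad (A \o alg X a) (B \o alg X a) (inj X k v)| <=
  N * (M1 * M2 * (Bc * Bc * (1 + Ba) * BJ) * (Q * rho k) * `|v|).
Proof.
move=> kn cA cB cA' cB' M10 M20 AM BM A'M B'M dA dB.
have Ba1 : 0 <= 1 + Ba by rewrite addr_ge0.
have [k1 kn'] := andP kn; rewrite /quad -sumrB.
have cAa := cl_comp (mull_cl a) cA; have cBa := cl_comp (mull_cl a) cB.
apply: norm_sum_le => [|q Qq]; first by rewrite !mulr_ge0.
have [q1 q2 qn] := lowpairsP Qq.
have [_ _ J0 Jq] := HJ Qq.
have [qk|/eqP qk] := eqVneq k (deg q.1 + deg q.2)%N; last first.
  rewrite J0// (cl0 (tmap_cont_linear TS cA' cB')).
  by rewrite (cl0 (tmap_cont_linear TS cAa cBa)) subrr normr0 !mulr_ge0.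
have c1 := hcomp_cl q.1; have c2 := hcomp_cl q.2.
rewrite -Jq !tmap_comp// tmapB//; try exact: cl_comp.
have D (U : completeNormedModType R) (D D' : X -> U) M s u : 0 <= M ->
  (forall k (v : tpow TP k), (1 <= k <= n)%N ->
     `|D' (inj X k v) - D (alg X a (inj X k v))| <= M * rho k * `|v|) ->
  (1 <= deg s)%N -> (deg s <= k)%N ->
  `|D' (hcomp s u) - D (alg X a (hcomp s u))| <= M * (Q * rho k) * Bc * `|u|.
  move=> M0 DM s1 sk; apply: (le_trans (DM _ _ _)); first by rewrite s1 deg_le.
  rewrite -[leRHS]mulrA -norm_hcomp; apply: ler_pM => //.
    by rewrite mulr_ge0.
  by rewrite ler_wpM2l// rhoQ// sk.
have cd1 := cl_sub (cl_comp c1 cA') (cl_comp c1 cAa).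
have cd2 := cl_sub (cl_comp c2 cB') (cl_comp c2 cBa).
have Qr : 0 <= Q * rho k by rewrite mulr_ge0.
rewrite (le_trans (ler_normD _ _))//.
rewrite (_ : _ * `|v| = M1 * (Q * rho k) * Bc * (M2 * Bc) * (BJ * `|v|) +
  M1 * Ba * Bc * (M2 * (Q * rho k) * Bc) * (BJ * `|v|)); last by ring.
have Jv : `|J q (inj X k v)| <= BJ * `|v| by rewrite -(@norm_inj _ _ _ _ _ X _ v kn') HBJ.
apply: lerD.
  apply: (le_trans (@tmap_le _ _ _ _ _ _ _ _
    (M1 * (Q * rho k) * Bc) (M2 * Bc) cd1 (cl_comp c2 cB') _ _ _ _ _)).
  - by rewrite !mulr_ge0.
  - by rewrite !mulr_ge0.
  - by move=> u /=; apply: D => //; rewrite qk leq_addr.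
  - by move=> u /=; rewrite (le_trans (B'M _))// -mulrA ler_wpM2l.
  by rewrite ler_wpM2l// !mulr_ge0.
apply: (le_trans (@tmap_le _ _ _ _ _ _ _ _
    (M1 * Ba * Bc) (M2 * (Q * rho k) * Bc) (cl_comp c1 cAa) cd2 _ _ _ _ _)).
- by rewrite !mulr_ge0.
- by rewrite !mulr_ge0.
- move=> u /=; rewrite (le_trans (mul_small _ M10 AM))// -[leRHS]mulrA.
  by rewrite ler_wpM2l// mulr_ge0.
- by move=> u /=; apply: D => //; rewrite qk leq_addl.
by rewrite ler_wpM2l// !mulr_ge0.
Qed.

End Fixed2.
End Estimates.
End Product.

Section ProductBounds.
Context {R : realType} {TS : tensor_system R} {V : completeNormedModType R}.
Context {TP : tensor_powers TS V} {n : nat} (X : triple TP n).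
Hypotheses (h1 : S1 X) (h2 : S2 X).
Variables (J : idx X * idx X -> X -> TS X X) (HJ : linearization J).
Local Notation one := (bone (alg X)).

(** The linear map whose value at a group element a approximates the increment
    of the tensor product of two paths that start from x and y and whose
    increments are close to A a and B a. *)
Definition prod_form {U1 U2 : completeNormedModType R} (A : X -> U1) (B : X -> U2)
    (x : U1) (y : U2) (c : X) : TS U1 U2 :=
  tens TS (A c) y + tens TS x (B c) + quad J A B c.

Lemma prod_form_cl (U1 U2 : completeNormedModType R) (A : X -> U1) (B : X -> U2) x y :
  cont_linear A -> cont_linear B -> cont_linear (prod_form A B x y).
Proof.
move=> cA cB; apply: cl_add; last exact: quad_cl.
by apply: cl_add; [exact: cl_tensl|exact: cl_tensr].
Qed.

(** The bounds relating the linear maps A, A' and the values x, x' of a path at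
    two times whose increment in the group is [a]; [rho k] is the size allowed in
    degree k. *)
Definition step_data (U : completeNormedModType R) (a : X) (rho : nat -> R)
    (A A' : X -> U) (x x' : U) (M : R) : Prop :=
  [/\ [/\ cont_linear A, cont_linear A', A one = 0, A' one = 0 & 0 <= M],
      [/\ forall v, `|A v| <= M * `|v|, forall v, `|A' v| <= M * `|v|,
          `|x| <= M & `|x'| <= M],
      forall k (v : tpow TP k), (1 <= k <= n)%N ->
        `|A' (inj X k v) - A (alg X a (inj X k v))| <= M * rho k * `|v| &
      `|x' - x - A a| <= M * rho 0%N].

(** The relations between the size r of an increment and the sizes allowed in
    the various degrees, up to the constant Q.  The last one bounds the terms of
    total degree above n. *)
Definition step_scale (Q : R) (a : X) (r : R) (rho : nat -> R) : Prop :=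
  [/\ grp X a, 0 <= r <= Q, small r a & [/\
      forall k, 0 <= rho k,
      forall j k, (j <= k <= n)%N -> rho j <= Q * rho k &
      forall m k, (k <= n)%N -> (n < m + k)%N -> (m <= n + n)%N ->
        r ^+ m <= Q * rho k]].

Lemma diff_expand (W : zmodType) (p s K' u w d e K2 rm q z : W) :
  p + s + K' - (u + w + (d + e + K2 - rm)) =
  (p - q) + (q - u - e) + (s - z) + (z - w - d) + (K' - K2) + rm.
Proof.
rewrite !opprD opprK !addrA !subrK.
by rewrite [LHS](ACl (1*4*7*2*5*6*3*8*9)).
Qed.

Lemma incr_expand (W : zmodType) (x'y' xy ay xb ab hh xy' ay' : W) :
  x'y' - xy - (ay + xb + (ab - hh)) =
  (x'y' - xy' - ay') + ((xy' - xy - xb) + (ay' - ay - ab)) + hh.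
Proof.
rewrite !opprD opprK !addrA.
rewrite [RHS](ACl ((2*4)*((3*7)*(1*5*8*6*9*10))))/= !addNr !add0r.
by [].
Qed.

(** The bounds at one step pass from two factors to their product. *)
Lemma product_bounds (Q : R) : 1 <= Q -> exists2 C, 0 <= C &
  forall (U1 U2 : completeNormedModType R) (a : X) r rho
    (A A' : X -> U1) (B B' : X -> U2) x x' y y' M1 M2,
  step_scale Q a r rho -> step_data a rho A A' x x' M1 ->
  step_data a rho B B' y y' M2 ->
  [/\ forall v, `|prod_form A B x y v| <= C * (M1 * M2) * `|v|,
      forall k (v : tpow TP k), (1 <= k <= n)%N ->
       `|prod_form A' B' x' y' (inj X k v) - prod_form A B x y (alg X a (inj X k v))|
         <= C * (M1 * M2) * rho k * `|v| &
      `|tens TS x' y' - tens TS x y - prod_form A B x y a|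
         <= C * (M1 * M2) * rho 0%N].
Proof.
move=> Q1; have Q0 : 0 <= Q by exact: le_trans Q1.
have [Bc Bc0 HBc] := @hcomp_bound _ _ _ _ _ X.
have [BJ BJ0 HBJ] := J_bound HJ.
have [C3 C30 HC3] := hcomp_mul_inj h1 h2.
pose N : R := #|{: idx X * idx X}|%:R.
pose Ba : R := 1 + #|idx X|%:R * Q ^+ n.
have N0 : 0 <= N by exact: ler0n.
have Ba0 : 0 <= Ba by rewrite addr_ge0// mulr_ge0// exprn_ge0.
pose Ka := 2 + N * BJ.
pose Kb := N * (Bc * Bc * (1 + Ba) * BJ) * Q.
pose Kc := N * (C3 + C3 + N * (C3 * Bc * (C3 * Bc) * BJ)) * Q.
pose Kd := 2 + 2 * Ba * Q + Kb + Kc.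
pose Ke := 2 + Ba + N * Q.
have Ka0 : 0 <= Ka by rewrite addr_ge0// mulr_ge0.
have Ba1 : 0 <= 1 + Ba by rewrite addr_ge0.
have Kb0 : 0 <= Kb by rewrite !mulr_ge0.
have Kc0 : 0 <= Kc by do !(apply: mulr_ge0 || apply: addr_ge0 || assumption).
have Kd0 : 0 <= Kd by rewrite !addr_ge0// !mulr_ge0.
have Ke0 : 0 <= Ke by do !(done || apply: mulr_ge0 || apply: addr_ge0).
exists (Ka + Kd + Ke); first by rewrite addr_ge0// addr_ge0.
move=> U1 U2 a r rho A A' B B' x x' y y' M1 M2.
move=> [Ga rQ ar [rho0 rhoQ rrho]].
move=> [[cA cA' A1 A'1 M10] [AM A'M xM x'M] dA hA].
move=> [[cB cB' B1 B'1 M20] [BM B'M yM y'M] dB hB].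
have MM : 0 <= M1 * M2 by rewrite mulr_ge0.
have HK K z : 0 <= z -> K <= Ka + Kd + Ke -> K * (M1 * M2) * z <= (Ka + Kd + Ke) * (M1 * M2) * z.
  by move=> z0 Kle; rewrite ler_wpM2r// ler_wpM2r.
have aB : `|a| <= Ba by exact: small_norm Q1 rQ ar.
have Aa_le : `|A a| <= M1 * Ba.
  by apply: (le_trans (AM _)); rewrite ler_wpM2l.
split.
- move=> v; apply: (@le_trans _ _ (Ka * (M1 * M2) * `|v|)); last first.
    by apply: HK => //; rewrite -addrA lerDl addr_ge0.
  rewrite /prod_form (_ : _ * `|v| = M1 * `|v| * M2 + M1 * (M2 * `|v|) +
    N * (M1 * M2 * (BJ * `|v|))); last by rewrite /Ka; ring.
  rewrite (le_trans (ler_normD _ _))//; apply: lerD; last exact: quad_bound.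
  rewrite (le_trans (ler_normD _ _))// !tens_norm; apply: lerD; exact: ler_pM.
- move=> k v kn; set c := inj X k v; have [k1 kn'] := andP kn.
  have cv : `|c| = `|v| by exact: norm_inj.
  rewrite -mulrA; apply: (@le_trans _ _ (Kd * (M1 * M2) * (rho k * `|v|))); last first.
    apply: HK; first by rewrite mulr_ge0.
    by rewrite addrAC lerDr addr_ge0.
  rewrite {1 2}/prod_form (quad_mul h1 h2 HJ)//; last exact: counit_inj.
  rewrite (diff_expand _ _ _ _ _ _ _ _ _ (tens TS (A (alg X a c)) y')
     (tens TS x' (B (alg X a c)))).
  rewrite -!linearBl -!linearBr/=.
  have Aac : `|A (alg X a c)| <= M1 * Ba * `|v|.
    by rewrite -cv; exact: (mul_small Q1 rQ ar).
  have Bac : `|B (alg X a c)| <= M2 * Ba * `|v|.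
    by rewrite -cv; exact: (mul_small Q1 rQ ar).
  have r0k : rho 0%N <= Q * rho k by apply: rhoQ.
  have t1 : `|tens TS (A' c - A (alg X a c)) y'| <= M1 * rho k * `|v| * M2.
    by rewrite tens_norm; apply: ler_pM => //; exact: dA.
  have t2 : `|tens TS (A (alg X a c)) (y' - y - B a)| <= M1 * Ba * `|v| * (M2 * (Q * rho k)).
    rewrite tens_norm; apply: ler_pM => //; apply: (le_trans hB); exact: ler_wpM2l.
  have t3 : `|tens TS x' (B' c - B (alg X a c))| <= M1 * (M2 * rho k * `|v|).
    by rewrite tens_norm; apply: ler_pM => //; exact: dB.
  have t4 : `|tens TS (x' - x - A a) (B (alg X a c))| <= M1 * (Q * rho k) * (M2 * Ba * `|v|).
    rewrite tens_norm; apply: ler_pM => //; apply: (le_trans hA); exact: ler_wpM2l.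
  have t5 : `|quad J A' B' c - quad J (A \o alg X a) (B \o alg X a) c| <=
      N * (M1 * M2 * (Bc * Bc * (1 + Ba) * BJ) * (Q * rho k) * `|v|).
    exact: (quad_diff HJ Bc0 HBc BJ0 HBJ Q1 rQ ar rho0 rhoQ).
  have t6 : `|quad_rem J A B a c| <=
      N * (M1 * M2 * (C3 + C3 + N * (C3 * Bc * (C3 * Bc) * BJ)) * (Q * rho k) * `|v|).
    exact: (rem_bound HJ Bc0 HBc BJ0 HBJ C30 HC3 Q1 rQ ar rho0 rrho).
  rewrite (_ : _ * (_ * `|v|) = M1 * rho k * `|v| * M2 + M1 * Ba * `|v| * (M2 * (Q * rho k))
    + M1 * (M2 * rho k * `|v|) + M1 * (Q * rho k) * (M2 * Ba * `|v|) +
    N * (M1 * M2 * (Bc * Bc * (1 + Ba) * BJ) * (Q * rho k) * `|v|) +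
    N * (M1 * M2 * (C3 + C3 + N * (C3 * Bc * (C3 * Bc) * BJ)) * (Q * rho k) * `|v|)); last first.
    by rewrite /Kd /Kb /Kc; ring.
  rewrite (le_trans (ler_normD _ _))//; apply: lerD => //.
  rewrite (le_trans (ler_normD _ _))//; apply: lerD => //.
  rewrite (le_trans (ler_normD _ _))//; apply: lerD => //.
  rewrite (le_trans (ler_normD _ _))//; apply: lerD => //.
  by rewrite (le_trans (ler_normD _ _))//; apply: lerD.
- apply: (@le_trans _ _ (Ke * (M1 * M2) * rho 0%N)); last first.
    by apply: HK => //; rewrite lerDr addr_ge0.
  rewrite /prod_form (quad_grp HJ)//.
  rewrite (incr_expand _ _ _ _ _ _ (tens TS x y') (tens TS (A a) y')).
  rewrite -!(linearBl, linearBr)/= -linearDl/=.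
  have xA : `|x + A a| <= M1 * (1 + Ba).
    by rewrite (le_trans (ler_normD _ _))// mulrDr mulr1 lerD.
  rewrite (_ : _ * rho 0%N = M1 * rho 0%N * M2 + M1 * (1 + Ba) * (M2 * rho 0%N) +
     N * (M1 * M2 * (Q * rho 0%N))); last by rewrite /Ke; ring.
  rewrite (le_trans (ler_normD _ _))//; apply: lerD; last first.
    apply: high_bound; try eassumption.
  rewrite (le_trans (ler_normD _ _))//; apply: lerD; rewrite tens_norm; exact: ler_pM.
Qed.

End ProductBounds.

(** * Partitions and sewing *)

Section Partitions.
Context {R : realType}.
Implicit Types (s t : R) (D : seq R).

Lemma part_sum_nil (U : zmodType) (F : R -> R -> U) s : part_sum F s [::] = 0.
Proof. by rewrite /part_sum big_geq. Qed.

Lemma part_sum_cons (U : zmodType) (F : R -> R -> U) s x D :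
  part_sum F s (x :: D) = F s x + part_sum F x D.
Proof. by rewrite /part_sum/= big_nat_recl. Qed.

Lemma part_sum_cat (U : zmodType) (F : R -> R -> U) s D1 D2 :
  part_sum F s (D1 ++ D2) = part_sum F s D1 + part_sum F (last s D1) D2.
Proof.
elim: D1 s => [|x D1 ih] s /=; first by rewrite part_sum_nil add0r.
by rewrite !part_sum_cons ih addrA.
Qed.

Lemma mesh_nil s : mesh s [::] = 0.
Proof. by rewrite /mesh big_geq. Qed.

Lemma mesh_cons s x D : mesh s (x :: D) = Num.max (x - s) (mesh x D).
Proof. by rewrite /mesh/= big_nat_recl. Qed.

Lemma mesh_cat s D1 D2 d : 0 < d -> mesh s D1 < d -> mesh (last s D1) D2 < d ->
  mesh s (D1 ++ D2) < d.
Proof.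
move=> d0; elim: D1 s => [|x D1 ih] s //=.
by rewrite !mesh_cons !gt_max => /andP[-> m1] m2 /=; exact: ih.
Qed.

Lemma itv_partition_consP s t x D : itv_partition s t (x :: D) ->
  s < x /\ itv_partition x t D.
Proof. by move=> [/= /andP[sx px] l]. Qed.

Lemma itv_partition_catP s t D1 D2 : itv_partition s t (D1 ++ D2) ->
  itv_partition s (last s D1) D1 /\ itv_partition (last s D1) t D2.
Proof.
by move=> [+ +]; rewrite cat_path last_cat => /andP[p1 p2] l; split.
Qed.

Lemma fine_partition s t d : s <= t -> 0 < d ->
  exists D, itv_partition s t D /\ mesh s D < d.
Proof.
move=> st d0.
have [m] : exists m : nat, t - s <= m%:R * (d / 2).
  exists (Num.truncn ((t - s) / (d / 2))).+1.
  by rewrite -ler_pdivrMr ?divr_gt0// ltW// truncnS_gt.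
elim: m s st => [|m ih] s st.
  rewrite mul0r subr_le0 => ts; have -> : s = t by apply/eqP; rewrite eq_le st ts.
  by exists [::]; rewrite mesh_nil; split => //; split.
move=> ts; have [std|std] := ltP (s + d / 2) t.
  have [||D [pD mD]] := ih (s + d / 2); first exact: ltW.
    by move: ts; rewrite -natr1; lra.
  have sd : s < s + d / 2 by rewrite ltrDl divr_gt0.
  exists (s + d / 2 :: D); rewrite mesh_cons gt_max mD andbT; split; last lra.
  by case: pD => pD lD; split => //=; rewrite sd.
move: st; rewrite le_eqVlt => /predU1P[->|st].
  by exists [::]; rewrite mesh_nil; split => //; split.
exists [:: t]; split; first exact: itv_partition1.
by rewrite mesh_cons mesh_nil gt_max d0 andbT; lra.
Qed.

(** Every interval has partitions of arbitrarily small mesh. *)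
Global Instance mesh_to0_proper s t : s <= t -> ProperFilter (mesh_to0 s t).
Proof.
move=> st; apply: filter_from_proper; last by move=> d /= /(fine_partition st).
apply: filter_from_filter; first by exists 1 => /=.
move=> d e /= d0 e0; exists (Num.min d e); first by rewrite /= lt_min d0.
by move=> D [pD]; rewrite lt_min => /andP[mD mE]; split.
Qed.

Lemma split_first (T : Type) (P : pred T) (D : seq T) : has P D ->
  exists (D1 : seq T) (x : T) (D2 : seq T), [/\ D = D1 ++ x :: D2, all (predC P) D1 & P x].
Proof.
elim: D => //= y D ih; have [Py _|Py /= /ih[D1 [x [D2 [-> aD1 Px]]]]] := boolP (P y).
  by exists [::], y, D.
by exists (y :: D1), x, D2; split => //=; rewrite Py.
Qed.

(** A control without its continuity. *)
Definition superadd (T : R) (w : R -> R -> R) : Prop :=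
  [/\ forall s t, 0 <= s <= t -> t <= T -> 0 <= w s t,
      forall t, 0 <= t <= T -> w t t = 0 &
      forall s u t, 0 <= s <= u -> u <= t <= T -> w s u + w u t <= w s t].

Lemma superadd_mono T w s u v t : superadd T w ->
  0 <= s -> s <= u -> u <= v -> v <= t -> t <= T -> w u v <= w s t.
Proof.
move=> [w0 _ wa] s0 su uv vt tT.
have h1 := wa s u t; have h2 := wa u v t.
have h3 := w0 s u; have h4 := w0 v t.
have : w s u + w u t <= w s t by apply: h1; lra.
have : w u v + w v t <= w u t by apply: h2; lra.
have : 0 <= w s u by apply: h3; lra.
have : 0 <= w v t by apply: h4; lra.
lra.
Qed.

(** If the defect of additivity of Xi is at most K w^th with th > 1, then
    refining a partition changes its sum by a multiple of K w^th only.  The proof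
    is by induction on the partition, cut where w reaches half of its value; the
    two outer parts have each at most half of the control. *)
Lemma sewing_bound (U : normedModType R) (T : R) (w : R -> R -> R)
    (Xi : R -> R -> U) (K th : R) : superadd T w -> 1 < th -> 0 <= K ->
  (forall s u t, 0 <= s -> s <= u -> u <= t -> t <= T ->
     `|Xi s u + Xi u t - Xi s t| <= K * w s t `^ th) ->
  forall D s t, 0 <= s -> t <= T -> itv_partition s t D ->
    `|part_sum Xi s D - Xi s t| <=
      2 * K / (1 - 2 * 2^-1 `^ th) * w s t `^ th.
Proof.
move=> sw th1 K0 HX D.
have [w0 wtt wa] := sw.
set q := 2 * 2^-1 `^ th.
have q0 : 0 <= q by rewrite mulr_ge0// powR_ge0.
have q1 : q < 1.
  have h : (2^-1 : R) `^ (th - 1) < 1 `^ (th - 1).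
    by apply: gt0_ltr_powR; rewrite ?subr_gt0 ?nnegrE//; lra.
  rewrite /q -(subrK 1 th) powRD ?invr_eq0 ?pnatr_eq0 ?implybT// powRr1//.
  by rewrite powR1 in h; lra.
set K' := 2 * K / (1 - q).
have K'0 : 0 <= K' by rewrite divr_ge0 ?mulr_ge0// subr_ge0 ltW.
have K'E : K' * q + 2 * K = K' by rewrite /K'; field; rewrite subr_eq0 gt_eqF.
have [m] := ubnP (size D); elim: m D => // m ih D sD s t s0 tT pD.
have st := itv_partition_le pD.
have Xss x : 0 <= x <= T -> Xi x x = 0.
  move=> /andP[x0 xT]; have := HX x x x x0 (lexx _) (lexx _) xT.
  rewrite wtt ?x0// powR0 ?gt_eqF//; last by lra.
  by rewrite mulr0 addrK normr_le0 => /eqP.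
case: D sD pD => [|x0 D0] sD pD.
  have <- := itv_partition_nil pD.
  by rewrite part_sum_nil Xss ?s0 ?(le_trans st)// subrr normr0 mulr_ge0 ?powR_ge0.
move: sD pD; set D := x0 :: D0 => sD pD.
(* [u'] is the first point with w s u' > w s t / 2, or t if there is none *)
pose P := [pred x | ~~ ((w s x <= w s t / 2) && (x != t))].
have tD : t \in D.
  by case: pD => _ /= /eqP <-; exact: mem_last.
have hP : has P D by apply/hasP; exists t => //=; rewrite eqxx andbF.
have [D1 [u' [D2 [DE aD1 Pu']]]] := split_first hP.
set u := last s D1.
have [p1 p2] : itv_partition s u D1 /\ itv_partition u t (u' :: D2).
  by apply: itv_partition_catP; rewrite -DE.
have [uu' p3] := itv_partition_consP p2.
have su := itv_partition_le p1; have u't := itv_partition_le p3.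
have wst0 : 0 <= w s t by apply: w0; rewrite ?s0.
have wsu : w s u <= w s t / 2.
  have : u \in s :: D1 by exact: mem_last.
  rewrite in_cons => /predU1P[->|]; first by rewrite wtt; lra.
  by move/(allP aD1); rewrite /= negbK => /andP[].
have wu't : w u' t <= w s t / 2.
  have [->|u't'] := eqVneq u' t; first by rewrite wtt; lra.
  move: Pu'; rewrite /= u't' andbT -ltNge => wsu'.
  have : w s u' + w u' t <= w s t by apply: wa; lra.
  by lra.
have half a : 0 <= a -> a <= w s t / 2 -> K' * a `^ th <= K' * (q / 2 * w s t `^ th).
  move=> a0 al; rewrite ler_wpM2l//.
  apply: (@le_trans _ _ ((w s t / 2) `^ th)).
    by apply: ge0_ler_powR; rewrite ?nnegrE//; lra.
  by rewrite powRM// /q mulrC [2 * _]mulrC mulfK.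
have d1 : `|part_sum Xi s D1 - Xi s u| <= K' * (q / 2 * w s t `^ th).
  apply: (@le_trans _ _ (K' * w s u `^ th)).
    apply: ih => //; last by lra.
    by move: sD; rewrite ltnS; apply: leq_trans; rewrite DE size_cat/= addnS ltnS leq_addr.
  by apply: half => //; apply: w0; lra.
have d2 : `|part_sum Xi u' D2 - Xi u' t| <= K' * (q / 2 * w s t `^ th).
  apply: (@le_trans _ _ (K' * w u' t `^ th)).
    apply: ih => //; last by lra.
    by move: sD; rewrite ltnS; apply: leq_trans; rewrite DE size_cat/= addnS ltnS leq_addl.
  by apply: half => //; apply: w0; lra.
have d3 : `|Xi s u + Xi u u' - Xi s u'| <= K * w s t `^ th.
  apply: (le_trans (HX _ _ _ _ _ _ _)) => //; try lra.
  rewrite ler_wpM2l//; apply: ge0_ler_powR; rewrite ?nnegrE//; first lra.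
    by apply: w0; lra.
  by apply: (superadd_mono sw); lra.
have d4 : `|Xi s u' + Xi u' t - Xi s t| <= K * w s t `^ th.
  by apply: HX; lra.
rewrite DE part_sum_cat part_sum_cons -/u.
rewrite (_ : _ - _ = (part_sum Xi s D1 - Xi s u) + (part_sum Xi u' D2 - Xi u' t) +
  (Xi s u + Xi u u' - Xi s u') + (Xi s u' + Xi u' t - Xi s t)); last first.
  rewrite !addrA [RHS](ACl ((2*5)*((4*9)*((7*8)*(1*6*3*10)))))/=.
  by rewrite !addNr !add0r.
rewrite -[leRHS](_ : K' * (q / 2 * w s t `^ th) + K' * (q / 2 * w s t `^ th) +
  K * w s t `^ th + K * w s t `^ th = _); last first.
  by rewrite -[in RHS]K'E; field.
rewrite (le_trans (ler_normD _ _))//; apply: lerD => //.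
rewrite (le_trans (ler_normD _ _))//; apply: lerD => //.
by rewrite (le_trans (ler_normD _ _))//; apply: lerD.
Qed.

End Partitions.

Section Integrals.
Context {R : realType}.

(** Convergence along partitions whose mesh tends to 0, in terms of epsilon. *)
Lemma part_cvgP (U : normedModType R) (F : R -> R -> U) s t l : s <= t ->
  (part_sum F s @ mesh_to0 s t --> l) <->
  (forall e, 0 < e -> exists2 d, 0 < d & forall D, itv_partition s t D ->
     mesh s D < d -> `|part_sum F s D - l| < e).
Proof.
move=> st; have pf := mesh_to0_proper st; split.
  move=> /cvgrPdist_lt H e e0; have [d /= d0 dH] := H e e0.
  by exists d => // D pD mD; rewrite distrC; apply: dH.
move=> H; apply/cvgrPdist_lt => e e0; have [d d0 dH] := H e e0.
by exists d => //= D [pD mD]; rewrite distrC; apply: dH.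
Qed.

Lemma control_superadd T w : is_control T w -> @superadd R T w.
Proof. by case. Qed.

(** A control is uniformly small near the diagonal, by compactness. *)
Lemma control_diag (T : R) w : is_control T w -> forall e, 0 < e ->
  exists2 d, 0 < d & forall s t, 0 <= s -> s <= t -> t <= T -> t - s < d -> w s t < e.
Proof.
move=> [w0 wtt /subspace_continuousP wc wa] e e0.
have /compact_near_coveringP/(_ R (0^'+) (fun d s => forall t, s <= t -> t <= T -> 0 <= s ->
   t - s < d -> w s t < e)) : compact `[0, T]%classic.
  exact: segment_compact.
case.
  move=> x; rewrite /= in_itv/= => xT; have /andP[x0 xT'] := xT.
  have /cvgrPdist_lt/(_ _ e0) := wc (x, x) (conj x0 (conj (lexx _) xT')).
  rewrite /from_subspace/= wtt// => -[[A1 A2] [/= /nbhs_ballP[d1 /= d10 H1] /nbhs_ballP[d2 /= d20 H2]] HA].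
  pose d := Num.min d1 d2.
  have d0 : 0 < d by rewrite lt_min d10.
  exists (ball x (d / 2), [set d' | d' < d / 2]).
    split; first by apply: nbhsx_ballx; rewrite divr_gt0.
    by apply: nbhs_right_lt; rewrite divr_gt0.
  move=> [s d'] [/= sx d'd] t st tT s0 tsd.
  have sx' : `|x - s| < d by apply: (lt_trans sx); lra.
  have tx' : `|x - t| < d.
    rewrite (_ : x - t = x - s - (t - s)); last by ring.
    apply: (le_lt_trans (ler_normB _ _)).
    rewrite [`|t - s|]ger0_norm ?subr_ge0//.
    by move: sx; rewrite /ball/= => sx; lra.
  have : `|0 - w s t| < e.
    apply: (HA (s, t)) => /=; last by [].
    split => /=.
      by apply: H1; rewrite /ball/= (lt_le_trans sx')// ge_min lexx.
    by apply: H2; rewrite /ball/= (lt_le_trans tx')// ge_min lexx orbT.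
  by rewrite sub0r normrN; apply: le_lt_trans; exact: ler_norm.
move=> d /= d0 H; exists (d / 2); first by rewrite divr_gt0.
move=> s t s0 st tT tsd.
apply: (H (d / 2) _ _ s) => //=.
- by rewrite sub0r normrN ger0_norm; lra.
- by rewrite divr_gt0.
- by rewrite in_itv/= s0 (le_trans st).
Qed.

(** If the increments of h are within K w^th of Xi, with th > 1, then the sums
    of Xi converge to the increment of h. *)
Lemma telescope_cvg (U : normedModType R) (T K th : R) (w : R -> R -> R)
    (Xi : R -> R -> U) (h : R -> U) : is_control T w -> 1 < th -> 0 <= K ->
  (forall s t, 0 <= s -> s <= t -> t <= T ->
     `|h t - h s - Xi s t| <= K * w s t `^ th) ->
  forall t, 0 <= t -> t <= T ->
  part_sum Xi 0 @ mesh_to0 0 t --> h t - h 0.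
Proof.
move=> cw th1 K0 HX t t0 tT; apply/part_cvgP => // e e0.
have sw := control_superadd cw; have [w0 wtt wa] := sw.
have W0 : 0 <= w 0 t by apply: w0; rewrite ?lexx.
pose e1 := e / (K + 1) / (w 0 t + 1).
have e10 : 0 < e1 by rewrite !divr_gt0//; lra.
pose eta := e1 `^ (th - 1)^-1.
have eta0 : 0 < eta by rewrite powR_gt0.
have th10 : 0 < th - 1 by rewrite subr_gt0.
have etaE : eta `^ (th - 1) = e1.
  by rewrite /eta -powRrM mulVf ?gt_eqF// powRr1// ltW.
have [d d0 dH] := control_diag cw eta0.
clearbody eta.
have key D s : 0 <= s -> itv_partition s t D -> mesh s D < d ->
    `|part_sum Xi s D - (h t - h s)| <= K * e1 * w s t.
  elim: D s => [|x D ih] s s0 pD.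
    have <- := itv_partition_nil pD => _.
    have sT : s <= T by rewrite (le_trans (itv_partition_le pD)).
    by rewrite part_sum_nil subrr subr0 normr0 mulr_ge0 ?w0 ?s0 ?lexx// mulr_ge0// ltW.
  have [sx px] := itv_partition_consP pD.
  rewrite mesh_cons gt_max => /andP[xsd mD].
  have xt := itv_partition_le px.
  have x0 : 0 <= x by rewrite (le_trans s0)// ltW.
  have {}ih := ih x x0 px mD.
  rewrite part_sum_cons.
  rewrite (_ : _ - _ = - (h x - h s - Xi s x) + (part_sum Xi x D - (h t - h x))); last first.
    rewrite !opprD !opprK !addrA [RHS](ACl ((1*6)*(3*4*5*2)))/=.
    by rewrite addNr add0r.
  rewrite (le_trans (ler_normD _ _))// normrN.
  apply: (@le_trans _ _ (K * e1 * w s x + K * e1 * w x t)); last first.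
    rewrite -mulrDr ler_wpM2l//; first by rewrite mulr_ge0// ltW.
    by apply: wa; rewrite ?s0 ?xt ?(ltW sx).
  apply: lerD => //.
  have xT : x <= T by exact: le_trans tT.
  have wsx0 : 0 <= w s x by apply: w0; rewrite ?s0// ltW.
  apply: (le_trans (HX _ _ s0 (ltW sx) xT)).
  rewrite -mulrA ler_wpM2l// -[in leLHS](subrK 1 th) powRD; last first.
    by rewrite subrK gt_eqF//; lra.
  rewrite powRr1// ler_wpM2r// -etaE.
  apply: ge0_ler_powR; rewrite ?nnegrE//; [exact: ltW|exact: ltW|].
  by apply/ltW/dH => //; exact: ltW.
exists d => // D pD mD; apply: (le_lt_trans (key _ _ (lexx _) pD mD)).
rewrite /e1 (_ : K * _ * _ = e * (K / (K + 1)) * (w 0 t / (w 0 t + 1))); last first.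
  by field; rewrite !gt_eqF//; lra.
rewrite -[ltRHS]mulr1 -[in ltRHS](mulr1 e); apply: ltr_pM => //.
- by rewrite !mulr_ge0 ?invr_ge0//; lra.
- by rewrite divr_ge0//; lra.
- by rewrite ltr_pM2l// ltr_pdivrMr; lra.
- by rewrite ltr_pdivrMr; lra.
Qed.

(** The increments of an integral are within a multiple of K w^th of its
    integrand. *)
Lemma integral_increment (U : normedModType R) (T : R) (w : R -> R -> R)
    (Xi : R -> R -> U) (h : R -> U) (K th : R) : superadd T w -> 1 < th -> 0 <= K ->
  (forall s u t, 0 <= s -> s <= u -> u <= t -> t <= T ->
     `|Xi s u + Xi u t - Xi s t| <= K * w s t `^ th) ->
  (forall t, 0 <= t -> t <= T -> part_sum Xi 0 @ mesh_to0 0 t --> h t) ->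
  forall s t, 0 <= s -> s <= t -> t <= T ->
    `|h t - h s - Xi s t| <= 2 * K / (1 - 2 * 2^-1 `^ th) * w s t `^ th.
Proof.
move=> sw th1 K0 HX hl s t s0 st tT; apply/ler_addgt0Pl => e e0.
have sT : s <= T by exact: le_trans tT.
have t0 : 0 <= t by exact: le_trans st.
have e20 : 0 < e / 2 by rewrite divr_gt0.
have /(part_cvgP _ _ t0)/(_ _ e20)[d1 d10 H1] := hl t t0 tT.
have /(part_cvgP _ _ s0)/(_ _ e20)[d2 d20 H2] := hl s s0 sT.
have d0 : 0 < Num.min d1 d2 by rewrite lt_min d10.
have [D1 [p1]] := fine_partition s0 d0; rewrite lt_min => /andP[m11 m12].
have [D2 [p2]] := fine_partition st d0; rewrite lt_min => /andP[m21 m22].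
have l1 : last 0 D1 = s by case: p1 => _ /eqP.
have /H1 : itv_partition 0 t (D1 ++ D2) by exact: itv_partition_cat p1 p2.
rewrite part_sum_cat l1 => /(_ (mesh_cat d10 m11 _)); rewrite l1 => /(_ m21) h1.
have h2 := H2 _ p1 m12.
have h3 := sewing_bound sw th1 K0 HX s0 tT p2.
rewrite (_ : h t - h s - Xi s t = - (part_sum Xi 0 D1 + part_sum Xi s D2 - h t) +
  (part_sum Xi 0 D1 - h s) + (part_sum Xi s D2 - Xi s t)); last first.
  rewrite !opprD !opprK !addrA [RHS](ACl ((1*4)*((2*6)*(3*5*7))))/=.
  by rewrite !addNr !add0r.
rewrite (le_trans (ler_normD _ _))//; apply: lerD => //.
rewrite (le_trans (ler_normD _ _))// normrN; move/ltW: h1; move/ltW: h2; lra.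
Qed.

End Integrals.

(** * The p-variation is a control *)

Section PVariation.
Context {R : realType}.

Lemma cvg_powR (I : Type) (FF : set_system I) {_ : Filter FF} (f : I -> R) (a e : R) :
  0 < e -> 0 <= a -> (forall x, 0 <= f x) -> f @ FF --> a ->
  (fun x => f x `^ e) @ FF --> a `^ e.
Proof.
move=> e0; rewrite le_eqVlt => /predU1P[<-|a0] f0 fa; last first.
  apply: (@cvg_comp _ _ _ f (fun y => y `^ e) _ _ _ fa).
  have : derivable (@powR R ^~ e) a 1.
    by apply: derivable_powR; rewrite in_itv/= a0.
  by move=> /derivable1_diffP/differentiable_continuous.
rewrite powR0 ?gt_eqF//; apply/cvgrPdist_lt => d d0.
move/cvgrPdist_lt : fa => /(_ (d `^ e^-1)); rewrite powR_gt0// => /(_ isT).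
apply: filterS => x; rewrite !sub0r !normrN !ger0_norm ?powR_ge0// => fd.
rewrite -[ltRHS](_ : (d `^ e^-1) `^ e = _); last first.
  by rewrite -powRrM mulVf ?gt_eqF// powRr1// ltW.
by apply: gt0_ltr_powR; rewrite // nnegrE ?powR_ge0.
Qed.

Implicit Types (s t u v c e : R) (D : seq R).
Variables (T : R) (F W : R -> R -> R).
Hypotheses (F0 : forall u v, 0 <= F u v) (Fuu : forall u, 0 <= u <= T -> F u u = 0).
Hypothesis FU : forall e, 0 < e -> exists2 d, 0 < d & forall u v u' v',
  0 <= u <= T -> 0 <= v <= T -> 0 <= u' <= T -> 0 <= v' <= T ->
  `|u' - u| < d -> `|v' - v| < d -> `|F u' v' - F u v| < e.
Hypothesis WU : forall s t D, 0 <= s -> t <= T -> itv_partition s t D ->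
  part_sum F s D <= W s t.
Hypothesis WL : forall s t e, 0 <= s -> s <= t -> t <= T -> 0 < e ->
  exists2 D, itv_partition s t D & W s t - e < part_sum F s D.

Lemma W_diag t : 0 <= t <= T -> W t t = 0.
Proof.
move=> /andP[t0 tT]; apply/eqP; rewrite eq_le; apply/andP; split.
  apply/ler_addgt0Pl => e e0; rewrite addr0.
  have [D /itv_partitionxx ->] := WL t0 (lexx _) tT e0.
  by rewrite part_sum_nil subr_lt0 => /ltW.
by rewrite -(@part_sum_nil _ _ F t); apply: WU.
Qed.

Lemma W_add s u t : 0 <= s <= u -> u <= t <= T -> W s u + W u t <= W s t.
Proof.
move=> /andP[s0 su] /andP[ut tT]; apply/ler_addgt0Pl => e e0.
have e20 : 0 < e / 2 by rewrite divr_gt0.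
have uT : u <= T by exact: le_trans tT.
have u0 : 0 <= u by exact: le_trans su.
have [D1 p1 h1] := WL s0 su uT e20; have [D2 p2 h2] := WL u0 ut tT e20.
have := WU s0 tT (itv_partition_cat p1 p2).
by rewrite part_sum_cat (_ : last s D1 = u); [lra|case: p1 => _ /eqP].
Qed.

Lemma part_sum_ge0 s D : 0 <= part_sum F s D.
Proof. by apply: sumr_ge0 => i _; exact: F0. Qed.

Lemma W_ge0 s t : 0 <= s <= t -> t <= T -> 0 <= W s t.
Proof.
move=> /andP[s0 st] tT; have [D pD _] := WL s0 st tT ltr01.
exact: le_trans (part_sum_ge0 s D) (WU s0 tT pD).
Qed.

Lemma W_superadd : superadd T W.
Proof. by split; [exact: W_ge0|exact: W_diag|exact: W_add]. Qed.

(** A partition of [s, t] cut at the first of its points beyond c. *)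
Lemma split_at s c t D : s <= c -> c <= t -> itv_partition s t D ->
  (exists2 D1, D = D1 & c = t) \/ exists (D1 : seq R) (v : R) (D2 : seq R), [/\ D = D1 ++ v :: D2,
    itv_partition s (last s D1) D1, last s D1 <= c, c < v &
    last s D1 < v /\ itv_partition v t D2].
Proof.
move=> sc; rewrite le_eqVlt => /predU1P[-> pD|ct pD]; first by left; exists D.
right; have hD : has (fun x => c < x) D.
  apply/hasP; exists t => //; case: pD => _ /eqP lt.
  have : t \in s :: D by rewrite -lt; exact: mem_last.
  by rewrite in_cons => /predU1P[ts|//]; move: ct; rewrite ts ltNge sc.
have [D1 [v [D2 [DE aD1 cv]]]] := split_first hD.
rewrite DE in pD; have [p1 p2] := itv_partition_catP pD.
have [lv p3] := itv_partition_consP p2.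
exists D1, v, D2; split => //.
have : last s D1 \in s :: D1 by exact: mem_last.
by rewrite in_cons => /predU1P[->//|/(allP aD1)]; rewrite /= -leNgt.
Qed.

(** Near an end of the interval the supremum W is almost additive: a point c
    inserted in a partition splits one term only, and one of the two new terms is
    close to the old one while the other is nonnegative. *)
Lemma W_insert e : 0 < e -> exists2 d, 0 < d & forall s c t,
  0 <= s -> s <= c -> c <= t -> t <= T -> c - s < d \/ t - c < d ->
  W s t <= W s c + W c t + e.
Proof.
move=> e0; have e20 : 0 < e / 2 by rewrite divr_gt0.
have [d d0 dH] := FU e20; exists d => // s c t s0 sc ct tT dd.
have c0 : 0 <= c by exact: le_trans sc.
have cT : c <= T by exact: le_trans tT.
have sT : s <= T by exact: le_trans cT.
have [D pD hD] := WL s0 (le_trans sc ct) tT e20.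
have [[_ _ ct']|[D1 [v [D2 [DE p1 uc cv [uv p3]]]]]] := split_at sc ct pD.
  by rewrite -ct' [W c c]W_diag ?c0//; lra.
set u := last s D1 in p1 uc uv.
have su := itv_partition_le p1; have vt := itv_partition_le p3.
move: hD; rewrite DE part_sum_cat part_sum_cons -/u => hD.
have u0 : 0 <= u by exact: le_trans su.
have v0 : 0 <= v by exact: le_trans (ltW uv).
have uT : u <= T by exact: le_trans cT.
have vT : v <= T by exact: le_trans tT.
have h1 : part_sum F s D1 + F u c <= W s c.
  move: uc; rewrite le_eqVlt => /predU1P[<-|uc].
    by rewrite Fuu ?addr0 ?u0//; exact: WU.
  have := WU s0 cT (itv_partition_cat p1 (itv_partition1 uc)).
  by rewrite part_sum_cat part_sum_cons part_sum_nil addr0.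
have h2 : F c v + part_sum F v D2 <= W c t.
  have : itv_partition c t (v :: D2) by case: p3 => p3 l3; split => //=; rewrite cv.
  by move/(WU c0 tT); rewrite part_sum_cons.
have : F u v <= F u c + F c v + e / 2.
  have Fuc := F0 u c; have Fcv := F0 c v.
  case: dd => dd.
    have : `|F c v - F u v| < e / 2.
      apply: dH; rewrite ?u0 ?v0 ?c0//; last by rewrite subrr normr0.
      by rewrite ger0_norm; lra.
    by rewrite ltr_norml; lra.
  have : `|F u c - F u v| < e / 2.
    apply: dH; rewrite ?u0 ?v0 ?c0//; first by rewrite subrr normr0.
    by rewrite distrC ger0_norm; lra.
  by rewrite ltr_norml; lra.
by lra.
Qed.

(** Near-optimal partitions of a short interval [t, t2] start with a small term,
    so that the interval that remains carries almost all of W; by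
    superadditivity the first one carries almost nothing. *)
Lemma W_right t e : 0 <= t <= T -> 0 < e -> exists2 d, 0 < d &
  forall t', t <= t' -> t' <= T -> t' - t < d -> W t t' < e.
Proof.
move=> /andP[t0 tT] e0.
move: (tT); rewrite le_eqVlt => /predU1P[tT'|tT'].
  exists 1 => // t' tt' t'T _; have -> : t' = t by apply/eqP; rewrite eq_le tt' tT' t'T.
  by rewrite W_diag// t0.
pose e4 := e / 4; have e40 : 0 < e4 by rewrite divr_gt0.
pose S := [set W t t' | t' in [set t' | t < t' <= T]].
have lbS : lbound S 0.
  by move=> _ [t' /= /andP[tt' t'T] <-]; apply: W_ge0; rewrite // t0 ltW.
have infS : has_inf S by split; [exists (W t T), T; rewrite //= tT' lexx|exists 0].
have [_ [t1 /= /andP[tt1 t1T] <-] ht1] := inf_adherent e40 infS.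
have [d1 d10 dH] := FU e40.
pose t2 := Num.min t1 (t + d1 / 2).
have tt2 : t < t2 by rewrite lt_min tt1 ltrDl divr_gt0.
have t2T : t2 <= T by rewrite ge_min t1T.
have t2t1 : t2 <= t1 by rewrite ge_min lexx.
have t2d : t2 <= t + d1 / 2 by rewrite ge_min lexx orbT.
have Wt2 : W t t2 <= W t t1 by apply: (superadd_mono W_superadd) => //; exact: ltW.
have [[|x D] pD hD] := WL t0 (ltW tt2) t2T e40.
  by move: tt2; rewrite (itv_partition_nil pD) ltxx.
have [tx px] := itv_partition_consP pD; have xt2 := itv_partition_le px.
have x0 : 0 <= x by rewrite (le_trans t0)// ltW.
have xT : x <= T by exact: le_trans t2T.
exists (x - t); first by rewrite subr_gt0.
move=> t' tt' t'T t'x; rewrite part_sum_cons in hD.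
have h1 := WU x0 t2T px.
have h2 : F t x < e4.
  have : `|F t x - F t t| < e4.
    apply: dH; rewrite ?t0 ?x0 ?subrr ?normr0//.
    by rewrite gtr0_norm ?subr_gt0//; lra.
  by rewrite [F t t]Fuu ?t0// subr0 ger0_norm.
have h3 : W t x + W x t2 <= W t t2 by apply: W_add; rewrite ?t0 ?xt2 ?(ltW tx).
have h4 : inf S <= W t t2.
  by apply: ge_inf; [exists 0|exists t2; rewrite //= tt2].
have h5 : W t t' <= W t x.
  by apply: (superadd_mono W_superadd) => //; lra.
rewrite /e4 in ht1 hD h2 *; lra.
Qed.

(** The mirror image of [W_right]. *)
Lemma W_left t e : 0 <= t <= T -> 0 < e -> exists2 d, 0 < d &
  forall t', t' <= t -> 0 <= t' -> t - t' < d -> W t' t < e.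
Proof.
move=> /andP[t0 tT] e0.
move: (t0); rewrite le_eqVlt => /predU1P[t0'|t0'].
  exists 1 => // t' tt' t'0 _; have -> : t' = t by apply/eqP; rewrite eq_le tt' -t0' t'0.
  by rewrite W_diag// t0.
pose e4 := e / 4; have e40 : 0 < e4 by rewrite divr_gt0.
pose S := [set W t' t | t' in [set t' | 0 <= t' < t]].
have lbS : lbound S 0.
  by move=> _ [t' /= /andP[t'0 t't] <-]; apply: W_ge0; rewrite // t'0 ltW.
have infS : has_inf S by split; [exists (W 0 t), 0; rewrite //= t0' lexx|exists 0].
have [_ [t1 /= /andP[t10 t1t] <-] ht1] := inf_adherent e40 infS.
have [d1 d10 dH] := FU e40.
pose t2 := Num.max t1 (t - d1 / 2).
have t2t : t2 < t by rewrite gt_max t1t ltrBlDr ltrDl divr_gt0.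
have t20 : 0 <= t2 by rewrite le_max t10.
have t1t2 : t1 <= t2 by rewrite le_max lexx.
have t2d : t - d1 / 2 <= t2 by rewrite le_max lexx orbT.
have Wt2 : W t2 t <= W t1 t by apply: (superadd_mono W_superadd) => //; exact: ltW.
have [D pD hD] := WL t20 (ltW t2t) tT e40.
case/lastP: D pD hD => [|D y] pD hD.
  by move: t2t; rewrite (itv_partition_nil pD) ltxx.
rewrite -cats1 in pD hD.
have [p1 p2] := itv_partition_catP pD.
have [xy p3] := itv_partition_consP p2.
have yt : y = t by exact: itv_partition_nil p3.
rewrite {}yt in xy pD hD p2 p3; set x := last t2 D in p1 p2 xy.
have t2x := itv_partition_le p1.
have x0 : 0 <= x by exact: le_trans t2x.
have xT : x <= T by rewrite (le_trans (ltW xy)).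
exists (t - x); first by rewrite subr_gt0.
move=> t' t't t'0 t'x; rewrite part_sum_cat part_sum_cons part_sum_nil addr0 in hD.
have h1 := WU t20 xT p1.
have h2 : F x t < e4.
  have : `|F x t - F t t| < e4.
    apply: dH; rewrite ?t0 ?x0 ?subrr ?normr0//.
    by rewrite distrC gtr0_norm ?subr_gt0//; lra.
  by rewrite [F t t]Fuu ?t0// subr0 ger0_norm.
have h3 : W t2 x + W x t <= W t2 t.
  by apply: W_add; rewrite ?t20 ?t2x ?(ltW xy).
have h4 : inf S <= W t2 t.
  by apply: ge_inf; [exists 0|exists t2; rewrite //= t20].
have h5 : W t' t <= W x t.
  by apply: (superadd_mono W_superadd) => //; lra.
rewrite -/x in hD; rewrite /e4 in ht1 hD h2 *; lra.
Qed.

Lemma min_max_dist (x y d : R) : `|x - y| < d ->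
  x - Num.min x y < d /\ Num.max x y - x < d.
Proof. by rewrite ltr_norml; case: (leP x y) => xy /andP[h1 h2]; split; lra. Qed.

Lemma crossing_dist (s t s' t' d : R) : s' <= t' ->
  `|s - s'| < d -> `|t - t'| < d -> Num.min t t' < Num.max s s' -> t - s < d.
Proof.
rewrite !ltr_norml => st' /andP[h1 h2] /andP[h3 h4].
by case: (leP t t') => tt'; case: (leP s s') => ss' h; lra.
Qed.

(** The supremum W of the sums of a continuous nonnegative F that vanishes on
    the diagonal is a control as soon as it is finite. *)
Lemma W_control : is_control T W.
Proof.
split; [exact: W_ge0|exact: W_diag| |exact: W_add].
apply/subspace_continuousP => -[s t] /= [s0 [st tT]].
rewrite /from_subspace/=; apply/cvgrPdist_lt => e e0.
have e60 : 0 < e / 6 by rewrite divr_gt0.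
have sT : 0 <= s <= T by rewrite s0 (le_trans st).
have tT' : 0 <= t <= T by rewrite tT (le_trans s0).
have [d1 d10 H1] := W_insert e60.
have [d2 d20 H2] := W_right sT e60; have [d3 d30 H3] := W_left sT e60.
have [d4 d40 H4] := W_right tT' e60; have [d5 d50 H5] := W_left tT' e60.
pose d := Num.min d1 (Num.min (Num.min d2 d3) (Num.min d4 d5)).
have d0 : 0 < d by rewrite !lt_min d10 d20 d30 d40 d50.
have [D1 D2 D3 D4 D5] : [/\ d <= d1, d <= d2, d <= d3, d <= d4 & d <= d5].
  by rewrite /d; split; rewrite !ge_min lexx ?orbT.
exists (ball s d, ball t d) => /=; first by split; exact: nbhsx_ballx.
move=> [s' t'] /= [bs bt] [s'0 [s't' t'T]].
have [smd sMd] := min_max_dist bs; have [tmd tMd] := min_max_dist bt.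
have cross := crossing_dist s't' bs bt.
set sm := Num.min s s' in smd; set sM := Num.max s s' in sMd cross.
set tm := Num.min t t' in tmd cross; set tM := Num.max t t' in tMd.
have [sms sms' sm0] : [/\ sm <= s, sm <= s' & 0 <= sm].
  by rewrite /sm !ge_min !lexx ?orbT le_min s0.
have [tM1 tM2 tMT] : [/\ t <= tM, t' <= tM & tM <= T].
  by rewrite /tM !le_max !lexx ?orbT ge_max tT.
have [sM1 sM2 sM0] : [/\ s <= sM, s' <= sM & 0 <= sM].
  by rewrite /sM !le_max !lexx ?orbT s0.
have [tm1 tm2 tmT] : [/\ tm <= t, tm <= t' & tm <= T].
  by rewrite /tm !ge_min !lexx ?orbT tT.
clearbody sm sM tm tM d.
have smono := superadd_mono W_superadd.
have sT' := le_trans st tT; have t0 := le_trans s0 st.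
have up : W s' t' < W s t + e.
  have u1 : W s' t' <= W sm tM by apply: smono.
  have u2 : W sm tM <= W sm s + W s tM + e / 6.
    apply: H1 => //; first exact: le_trans tM1.
    by left; exact: lt_le_trans smd D1.
  have u3 : W s tM <= W s t + W t tM + e / 6.
    by apply: H1 => //; right; exact: lt_le_trans tMd D1.
  have u4 : W sm s < e / 6 by apply: H3 => //; exact: lt_le_trans smd D3.
  have u5 : W t tM < e / 6 by apply: H4 => //; exact: lt_le_trans tMd D4.
  by move: u1 u2 u3 u4 u5 e0; clear; lra.
have W0' : 0 <= W s' t' by apply: W_ge0; rewrite ?s'0.
have low : W s t < W s' t' + e.
  have [sMt|tsM] := leP sM tm.
    have u1 : W s t <= W s sM + W sM t + e / 6.
      apply: H1 => //; first exact: le_trans tm1.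
      by left; exact: lt_le_trans sMd D1.
    have u2 : W sM t <= W sM tm + W tm t + e / 6.
      by apply: H1 => //; right; exact: lt_le_trans tmd D1.
    have u3 : W sM tm <= W s' t' by apply: smono.
    have u4 : W s sM < e / 6.
      apply: H2 => //; first exact: le_trans tmT.
      exact: lt_le_trans sMd D2.
    have u5 : W tm t < e / 6.
      apply: H5 => //; first exact: le_trans sMt.
      exact: lt_le_trans tmd D5.
    by move: u1 u2 u3 u4 u5 e0; clear; lra.
  have : W s t < e / 6 by apply: H2 => //; exact: lt_le_trans (cross tsM) D2.
  by lra.
by rewrite ltr_norml; apply/andP; split; lra.
Qed.

End PVariation.

Section UniformContinuity.
Context {R : realType}.

Lemma square_uniform (T : R) (F : R -> R -> R) :
  (forall u v, 0 <= u <= T -> 0 <= v <= T ->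
    F q.1 q.2 @[q --> within [set q | 0 <= q.1 <= T /\ 0 <= q.2 <= T] (nbhs (u, v))]
      --> F u v) ->
  forall e, 0 < e -> exists2 d, 0 < d & forall u v u' v',
  0 <= u <= T -> 0 <= v <= T -> 0 <= u' <= T -> 0 <= v' <= T ->
  `|u' - u| < d -> `|v' - v| < d -> `|F u' v' - F u v| < e.
Proof.
move=> cF e e0; have e20 : 0 < e / 2 by rewrite divr_gt0.
have : compact (`[0, T]%classic `*` `[0, T]%classic : set (R * R)).
  by apply: compact_setX; exact: segment_compact.
move/compact_near_coveringP/(_ R (0^'+) (fun d q => forall u' v',
  0 <= u' <= T -> 0 <= v' <= T -> `|u' - q.1| < d -> `|v' - q.2| < d ->
  0 <= q.1 <= T -> 0 <= q.2 <= T ->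
  `|F u' v' - F q.1 q.2| < e)).
case.
  move=> [u v] /= []; rewrite !in_itv/= => uT vT.
  have /cvgrPdist_lt/(_ _ e20) := cF u v uT vT.
  move=> [[A1 A2] [/= /nbhs_ballP[d1 /= d10 H1] /nbhs_ballP[d2 /= d20 H2]] HA].
  pose d := Num.min d1 d2.
  have d0 : 0 < d by rewrite lt_min d10.
  have [dd1 dd2] : d <= d1 /\ d <= d2 by rewrite /d !ge_min !lexx orbT.
  have Fd u' v' : 0 <= u' <= T -> 0 <= v' <= T -> `|u - u'| < d -> `|v - v'| < d ->
     `|F u v - F u' v'| < e / 2.
    move=> u'T v'T uu' vv'; apply: (HA (u', v')) => //=; split => /=.
      by apply: H1; rewrite /ball/=; exact: lt_le_trans dd1.
    by apply: H2; rewrite /ball/=; exact: lt_le_trans dd2.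
  exists (ball u (d / 2) `*` ball v (d / 2), [set d' | d' < d / 2]).
    split; last by apply: nbhs_right_lt; rewrite divr_gt0.
    by exists (ball u (d / 2), ball v (d / 2)) => //; split; apply: nbhsx_ballx;
      rewrite divr_gt0.
  move=> [[u1 v1] d'] [/= [uu1 vv1] d'd] u' v' u'T v'T u'd v'd u1T v1T.
  move: uu1 vv1; rewrite /ball/= => uu1 vv1.
  have h1 : `|F u v - F u1 v1| < e / 2 by apply: Fd => //; lra.
  have h2 : `|F u v - F u' v'| < e / 2.
    apply: Fd => //.
      rewrite (_ : u - u' = (u - u1) - (u' - u1)); last by ring.
      by rewrite (le_lt_trans (ler_normB _ _))//; lra.
    rewrite (_ : v - v' = (v - v1) - (v' - v1)); last by ring.
    by rewrite (le_lt_trans (ler_normB _ _))//; lra.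
  rewrite (_ : F u' v' - F u1 v1 = (F u v - F u1 v1) - (F u v - F u' v')); last by ring.
  by rewrite (le_lt_trans (ler_normB _ _))//; lra.
move=> d /= d0 H; exists (d / 2); first by rewrite divr_gt0.
move=> u v u' v' uT vT u'T v'T ud vd.
apply: (H (d / 2) _ _ (u, v)) => //=.
  by rewrite sub0r normrN ger0_norm; lra.
by rewrite divr_gt0.
Qed.

End UniformContinuity.

Section PathVariation.
Context {R : realType} {TS : tensor_system R} {V : completeNormedModType R}.
Context {TP : tensor_powers TS V} {n : nat} (X : triple TP n).

Lemma hnorm_ge0 (a : X) : 0 <= hnorm a.
Proof. by apply: sumr_ge0 => s _; exact: powR_ge0. Qed.

Lemma hcomp_le_hnorm (a : X) (s : idx X) : (1 <= deg s)%N ->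
  `|hcomp s a| <= hnorm a ^+ deg s.
Proof.
move=> s1; rewrite norm_hcomp.
have s0 : (deg s)%:R != 0 :> R by rewrite pnatr_eq0; case: (deg s) s1.
have -> : `|sig X s a| = (`|sig X s a| `^ (deg s)%:R^-1) ^+ deg s.
  by rewrite -powR_mulrn ?powR_ge0// -powRrM mulVf// powRr1.
apply: lerXn2r; rewrite ?nnegrE ?powR_ge0 ?hnorm_ge0//.
rewrite /hnorm (bigD1 s)//= lerDl sumr_ge0// => t _; exact: powR_ge0.
Qed.

Lemma hnorm1 : hnorm (bone (alg X)) = 0.
Proof.
apply: big1 => s s1; rewrite sig_eq0 ?hcomp1// normr0 powR0// invr_eq0 pnatr_eq0.
by case: (deg s) s1.
Qed.

Lemma cvg_hnorm (I : Type) (FF : set_system I) {_ : Filter FF} (f : I -> X) (a : X) :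
  f @ FF --> a -> (fun x => hnorm (f x)) @ FF --> hnorm a.
Proof.
move=> fa; rewrite /hnorm.
apply: cvg_big => //=; first by move=> x; exact: add_continuous.
move=> s s1; apply: cvg_powR => //.
  by rewrite invr_gt0 ltr0n.
apply: cvg_norm; apply: continuous_cvg => //.
exact: sig_cont.
Qed.

Lemma cvg_mul (I : Type) (FF : set_system I) {_ : Filter FF} (f h : I -> X) (a b : X) :
  f @ FF --> a -> h @ FF --> b -> (fun x => alg X (f x) (h x)) @ FF --> alg X a b.
Proof.
move=> fa hb; apply/subr_cvg0; apply: norm_cvg0.
have fa0 : (fun x => `|f x - a|) @ FF --> (0 : R).
  by apply/norm_cvg0P/subr_cvg0.
have hb0 : (fun x => `|h x - b|) @ FF --> (0 : R).
  by apply/norm_cvg0P/subr_cvg0.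
apply: (@squeeze_cvgr _ _ _ _ (cst 0)
  (fun x => `|f x - a| * `|h x - b| + `|f x - a| * `|b| + `|a| * `|h x - b|)).
- apply: nearW => x; rewrite normr_ge0/=.
  rewrite (_ : _ - _ = alg X (f x - a) (h x - b) + alg X (f x - a) b +
     alg X a (h x - b)); last first.
    by rewrite -linearDr subrK linearBl linearBr/= addrA subrK.
  rewrite (le_trans (ler_normD _ _))//; apply: lerD; last exact: bmul_norm.
  by rewrite (le_trans (ler_normD _ _))//; apply: lerD; exact: bmul_norm.
- exact: cvg_cst.
- rewrite [X in _ --> X](_ : 0 = 0 * 0 + 0 * `|b| + `|a| * 0); last by ring.
  apply: cvgD; last by apply: cvgM => //; exact: cvg_cst.
  by apply: cvgD; apply: cvgM => //; exact: cvg_cst.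
Qed.

Section Path.
Variables (p T : R) (g : R -> X).
Hypotheses (p1 : 1 <= p) (T0 : 0 <= T) (pg : pvar_path p T g).

Let gG t : 0 <= t <= T -> grp X (g t). Proof. by case: pg => + _ _; exact. Qed.
Let p0 : 0 < p. Proof. exact: lt_le_trans p1. Qed.

Lemma grp_incr s t : 0 <= s <= T -> 0 <= t <= T -> grp X (incr g s t).
Proof. by move=> sT tT; apply: grpM; [apply: grpV; exact: gG|exact: gG]. Qed.

Lemma path_cvg t : 0 <= t <= T -> g s @[s --> within `[0, T] (nbhs t)] --> g t.
Proof.
by move=> tT; have [_ /subspace_continuousP gc _] := pg; apply: gc; rewrite /= in_itv.
Qed.

Lemma cvg_to_within (I : Type) (Y : topologicalType) (FF : set_system I)
    {_ : Filter FF} (f : I -> Y) (a : Y) (P : set Y) :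
  f @ FF --> a -> (\forall x \near FF, P (f x)) ->
  f @ FF --> within P (nbhs a).
Proof.
move=> fa fP A /= HA; have := fa _ HA; apply: filterS2 fP.
by move=> x Pf; exact.
Qed.

Lemma path_inv_cvg t : 0 <= t <= T ->
  ginv X (g s) @[s --> within `[0, T] (nbhs t)] --> ginv X (g t).
Proof.
move=> tT; have /subspace_continuousP/(_ _ (gG tT)) vc := @grpV_cont _ _ _ _ _ X.
apply: (@cvg_comp _ _ _ g (ginv X) _ _ _ _ vc).
apply: cvg_to_within; first exact: path_cvg.
by apply: filterS (withinT _ _) => s /=; rewrite in_itv => /gG.
Qed.

(** The terms of the sums that define the p-variation. *)
Definition pvar_term (u v : R) : R := hnorm (incr g u v) `^ p.

Lemma pvar_term_cvg u v : 0 <= u <= T -> 0 <= v <= T ->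
    pvar_term q.1 q.2 @[q --> within [set q | 0 <= q.1 <= T /\ 0 <= q.2 <= T]
      (nbhs (u, v))] --> pvar_term u v.
Proof.
move=> uT vT; apply: cvg_powR => //; [exact: hnorm_ge0|by move=> x; exact: hnorm_ge0|].
apply: cvg_hnorm; apply: cvg_mul.
  apply: (@cvg_comp _ _ _ (fun q : R * R => q.1) (fun u => ginv X (g u)) _ _ _ _ (path_inv_cvg uT)).
  apply: cvg_to_within.
    by apply: (cvg_trans (cvg_app _ _)); [exact: cvg_within|exact: cvg_fst].
  by apply: filterS (withinT _ _) => q /= []; rewrite in_itv.
apply: (@cvg_comp _ _ _ (fun q : R * R => q.2) g _ _ _ _ (path_cvg vT)).
apply: cvg_to_within.
  by apply: (cvg_trans (cvg_app _ _)); [exact: cvg_within|exact: cvg_snd].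
by apply: filterS (withinT _ _) => q /= []; rewrite in_itv.
Qed.

Lemma incr_diag t : 0 <= t <= T -> incr g t t = bone (alg X).
Proof. by move=> tT; rewrite /incr grpVl//; exact: gG. Qed.

Lemma pvar_term_diag t : 0 <= t <= T -> pvar_term t t = 0.
Proof. by move=> tT; rewrite /pvar_term incr_diag// hnorm1 powR0// gt_eqF. Qed.

Lemma pvar_term_ge0 u v : 0 <= pvar_term u v.
Proof. exact: powR_ge0. Qed.

Lemma part_ext s t D : 0 <= s -> s <= t -> t <= T -> itv_partition s t D ->
  exists2 D', itv_partition 0 T D' & part_sum pvar_term s D <= part_sum pvar_term 0 D'.
Proof.
move=> s0 st tT pD.
have [D0 [p0' _]] := fine_partition s0 ltr01; have [D1 [p1' _]] := fine_partition tT ltr01.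
exists (D0 ++ (D ++ D1)).
  exact: itv_partition_cat p0' (itv_partition_cat pD p1').
rewrite !part_sum_cat (_ : last 0 D0 = s); last by case: p0' => _ /eqP.
have psum a E : 0 <= part_sum pvar_term a E by apply: part_sum_ge0; exact: pvar_term_ge0.
by rewrite -[leLHS]add0r lerD// lerDl.
Qed.

Let E s t : \bar R := ereal_sup
  [set (part_sum pvar_term s D)%:E | D in itv_partition s t].

(** The p-variation to the power p. *)
Definition pcontrol (s t : R) : R := fine (pvar p g s t) `^ p.

Let E_fin s t : 0 <= s -> s <= t -> t <= T -> E s t \is a fin_num /\ (0 <= E s t)%E.
Proof.
move=> s0 st tT.
have [D [pD _]] := fine_partition st ltr01.
have E0 : (0 <= E s t)%E.
  apply: (@le_trans _ _ (part_sum pvar_term s D)%:E).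
    by rewrite lee_fin; apply: part_sum_ge0; exact: pvar_term_ge0.
  by apply: ereal_sup_ubound; exists D.
split => //; rewrite ge0_fin_numE//.
have [_ _ ] := pg; rewrite /pvar => /lty_poweRy; rewrite invr_eq0 gt_eqF// => /(_ isT).
apply: le_lt_trans; apply: ge_ereal_sup => _ [D' pD' <-].
have [D2 pD2 le2] := part_ext s0 st tT pD'.
apply: (@le_trans _ _ (part_sum pvar_term 0 D2)%:E); first by rewrite lee_fin.
by apply: ereal_sup_ubound; exists D2.
Qed.

Lemma pcontrolE s t : 0 <= s -> s <= t -> t <= T -> (pcontrol s t)%:E = E s t.
Proof.
move=> s0 st tT; have [Ef E0] := E_fin s0 st tT.
rewrite /pcontrol /pvar fine_poweR -powRrM mulVf ?gt_eqF// powRr1 ?fine_ge0//.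
by rewrite fineK.
Qed.

Lemma pcontrol_ub s t D : 0 <= s -> t <= T -> itv_partition s t D ->
  part_sum pvar_term s D <= pcontrol s t.
Proof.
move=> s0 tT pD; have st := itv_partition_le pD.
by rewrite -lee_fin pcontrolE//; apply: ereal_sup_ubound; exists D.
Qed.

Lemma pcontrol_adh s t e : 0 <= s -> s <= t -> t <= T -> 0 < e ->
  exists2 D, itv_partition s t D & pcontrol s t - e < part_sum pvar_term s D.
Proof.
move=> s0 st tT e0; have [Ef _] := E_fin s0 st tT.
have [_ [D pD <-] H] := ub_ereal_sup_adherent e0 Ef.
exists D => //; rewrite -lte_fin EFinB pcontrolE//.
Qed.

Lemma pcontrol_control : is_control T pcontrol.
Proof.
apply: (@W_control _ T pvar_term) => //.
- exact: pvar_term_ge0.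
- exact: pvar_term_diag.
- exact: (square_uniform pvar_term_cvg).
- exact: pcontrol_ub.
- exact: pcontrol_adh.
Qed.

Lemma incr_small s t w : 0 <= s -> s <= t -> t <= T -> pcontrol s t <= w ->
  small (w `^ p^-1) (incr g s t).
Proof.
move=> s0 st tT Ww.
have sT : 0 <= s <= T by rewrite s0 (le_trans st).
have tT' : 0 <= t <= T by rewrite tT (le_trans s0).
have h0 := hnorm_ge0 (incr g s t).
split; first exact: grp_sig0 (grp_incr sT tT').
move=> k k1; apply: (le_trans (hcomp_le_hnorm _ k1)).
apply: lerXn2r; rewrite ?nnegrE ?powR_ge0//.
have H : pvar_term s t <= pcontrol s t.
  move: st; rewrite le_eqVlt => /predU1P[st|st].
    rewrite -st pvar_term_diag//; have [W0 _ _ _] := pcontrol_control.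
    by apply: W0; [rewrite s0 lexx|case/andP: sT].
  have := pcontrol_ub s0 tT (itv_partition1 st).
  by rewrite part_sum_cons part_sum_nil addr0.
rewrite -[leLHS](_ : pvar_term s t `^ p^-1 = _); last first.
  by rewrite /pvar_term -powRrM mulfV ?gt_eqF// powRr1.
apply: ge0_ler_powR; rewrite ?nnegrE ?invr_ge0 ?pvar_term_ge0 ?(ltW p0)//.
  by rewrite (le_trans (pvar_term_ge0 s t))// (le_trans H).
exact: le_trans Ww.
Qed.

End Path.
End PathVariation.

(** * Scales and norms of one-forms *)

Section Scales.
Context {R : realType}.

Lemma powR_big (x Om e L : R) : 0 <= x -> x <= Om -> 0 <= e -> e <= L ->
  x `^ e <= (1 + Om) `^ L.
Proof.
move=> x0 xO e0 eL; apply: (@le_trans _ _ ((1 + Om) `^ e)).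
  by apply: ge0_ler_powR; rewrite ?nnegrE//; lra.
by apply: ler_powR => //; lra.
Qed.

Lemma powR_split (x Om a b L : R) : 0 <= x -> x <= Om -> 0 < b -> b <= a -> a - b <= L ->
  x `^ a <= (1 + Om) `^ L * x `^ b.
Proof.
move=> x0 xO b0 ba abL; rewrite -(subrK b a) powRD; last first.
  by rewrite subrK gt_eqF//; lra.
by rewrite ler_wpM2r ?powR_ge0//; apply: powR_big; lra.
Qed.

End Scales.

Section Forms.
Context {R : realType} {TS : tensor_system R} {V : completeNormedModType R}.
Context {TP : tensor_powers TS V} {n : nat} (X : triple TP n).
Hypotheses (h1 : S1 X).
Local Notation one := (bone (alg X)).
Context {U : completeNormedModType R}.

Lemma form_one (b : X -> X -> U) a : one_form b -> grp X a -> b a one = 0.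
Proof.
move=> [_ _ bc] Ga; have := bc a one one Ga (grp1 X) (grp1 X).
by rewrite bmul1r bmul1l => /eqP; rewrite -subr_eq0 addrK => /eqP.
Qed.

Lemma aug_grp a : grp X a -> aug a = a - one.
Proof. by move=> Ga; rewrite /aug [counit a]grp_sig0// scale1r. Qed.

(** By (S1) the cocycle identity holds for all vectors, not only for group
    elements. *)
Lemma form_shift (b : X -> X -> U) a a' c : one_form b -> grp X a -> grp X a' ->
  b (alg X a a') c = b a (alg X a' (aug c)).
Proof.
move=> bf Ga Ga'; have [bl _ bc] := bf.
have Gaa := grpM Ga Ga'.
move: c; apply: (S1_eq h1 (bl _ Gaa)) => [|c Gc].
  exact: (cl_comp (cl_comp (@aug_cl _ _ _ _ _ X) (mull_cl a')) (bl _ Ga)).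
rewrite aug_grp// linearBr/= bmul1r (clB _ _ (bl _ Ga)) -bc//.
by rewrite addrAC subrr add0r.
Qed.

Lemma opnorm_deg_le (f : X -> U) k K : 0 <= K ->
  (forall v : tpow TP k, `|f (inj X k v)| <= K * `|v|) -> opnorm_deg k f <= K.
Proof.
move=> K0 fK; rewrite /opnorm_deg.
have [[v v1]|nv] := pselect (exists v : tpow TP k, `|v| = 1).
  apply: ge_sup; first by exists `|f (inj X k v)|, v.
  by move=> _ [u /= u1 <-]; rewrite (le_trans (fK u))// u1 mulr1.
rewrite (_ : [set _ | _ in _] = set0) ?sup0//.
by apply/seteqP; split => // _ [v /= v1 _]; apply: nv; exists v.
Qed.

Lemma opnorm_degP (f : X -> U) k (v : tpow TP k) : cont_linear f -> (k <= n)%N ->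
  `|f (inj X k v)| <= opnorm_deg k f * `|v|.
Proof.
move=> cf kn; have cfi := cl_comp (inj_cl X kn) cf.
have [K K0 fK] := cl_bound cfi.
have [->|v0] := eqVneq v 0; first by rewrite linear0 (cl0 cf) !normr0 mulr0.
have v0' : 0 < `|v| by rewrite normr_gt0.
rewrite -ler_pdivrMr//.
have -> : `|f (inj X k v)| / `|v| = `|f (inj X k (`|v|^-1 *: v))|.
  by rewrite linearZ (clZ _ _ cf) normrZ normfV normr_id mulrC.
apply: ub_le_sup; last first.
  by exists (`|v|^-1 *: v) => //=; rewrite normrZ normfV normr_id mulVf// normr_eq0.
exists K => _ [w /= w1 <-]; apply: (le_trans (fK w)).
by rewrite w1 mulr1.
Qed.

Lemma opnorm_deg_ge0 (f : X -> U) k : 0 <= opnorm_deg k f.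
Proof.
rewrite /opnorm_deg.
have [[[x [v v1 _]] fb]|/sup_out->//] :=
  pselect (has_sup [set `|f (inj X k v)| | v in [set v : tpow TP k | `|v| = 1]]).
by apply: (@le_trans _ _ `|f (inj X k v)|) => //; apply: ub_le_sup => //; exists v.
Qed.

End Forms.

Section FormNorm.
Context {R : realType} {TS : tensor_system R} {V : completeNormedModType R}.
Context {TP : tensor_powers TS V} {p : R} (X : triple TP (Num.truncn p)).
Context {U : completeNormedModType R}.
Variables (T : R) (T0 : 0 <= T) (g : R -> X) (w : R -> R -> R) (th : R) (b : R -> X -> X -> U).

Lemma form_norm_ge N : (form_norm p T g w th b <= N%:E)%E ->
  [/\ 0 <= N, forall t, 0 <= t <= T -> opnorm (b t (g t)) <= N &
      forall s t k, 0 <= s -> s < t -> t <= T -> (1 <= k <= Num.truncn p)%N ->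
        opnorm_deg k (form_diff b g s t) <= N * w s t `^ (th - k%:R / p)].
Proof.
rewrite /form_norm; set S1 := ereal_sup _; set S2 := (\big[_/_]_(_ <= _ < _) _)%E.
have S10 : (0 <= S1)%E.
  apply: (@le_trans _ _ (opnorm (b 0 (g 0)))%:E); first by rewrite lee_fin opnorm_ge0.
  by apply: ereal_sup_ubound; exists 0 => //=; rewrite in_itv/= lexx.
have S20 : (0 <= S2)%E by rewrite /S2; exact: bigmax_ge_id.
move=> SN.
have S1N : (S1 <= N%:E)%E by rewrite (le_trans _ SN)// leeDl.
have S2N : (S2 <= N%:E)%E by rewrite (le_trans _ SN)// leeDr.
split.
- by rewrite -lee_fin (le_trans S10).
- move=> t tT; rewrite -lee_fin (le_trans _ S1N)//.
  by apply: ereal_sup_ubound; exists t => //=; rewrite in_itv.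
- move=> s t k s0 st tT /andP[k1 kn].
  set c := opnorm_deg k _; set x := w s t `^ _.
  have : (equot c x <= N%:E)%E.
    apply: le_trans S2N; rewrite /S2.
    apply: (@le_trans _ _ (ereal_sup
         [set equot (opnorm_deg k (form_diff b g q.1 q.2))
                    (w q.1 q.2 `^ (th - k%:R / p))%R
           | q in [set q : R * R | (0 <= q.1 /\ q.1 < q.2 /\ q.2 <= T)%R]])).
      by apply: ereal_sup_ubound; exists (s, t).
    apply: (@le_bigmax_seq _ _ _ _ _ k) => //.
    by rewrite mem_index_iota k1.
  rewrite /equot; case: eqVneq => [->|x0].
    by case: eqVneq => [->|_]; rewrite ?mulr0//.
  by rewrite lee_fin ler_pdivrMr// lt_neqAle eq_sym x0 powR_ge0.
Qed.

Lemma form_norm_le M : 0 <= M ->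
  (forall t, 0 <= t <= T -> opnorm (b t (g t)) <= M) ->
  (forall s t k, 0 <= s -> s < t -> t <= T -> (1 <= k <= Num.truncn p)%N ->
        opnorm_deg k (form_diff b g s t) <= M * w s t `^ (th - k%:R / p)) ->
  (form_norm p T g w th b <= (2 * M)%:E)%E.
Proof.
move=> M0 H1 H2; rewrite (_ : 2 * M = M + M); last by ring.
rewrite /form_norm EFinD; apply: leeD.
  apply: ge_ereal_sup => x [t /=]; rewrite in_itv/= => tT <-.
  by rewrite lee_fin H1.
rewrite big_seq_cond; apply: bigmax_le => [|k]; first by rewrite lee_fin.
rewrite andbT mem_index_iota => kn.
apply: ge_ereal_sup => _ [[s t] /= [s0 [st tT]] <-].
have := H2 s t k s0 st tT kn; rewrite /equot.
case: eqVneq => [->|x0]; last first.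
  by rewrite lee_fin ler_pdivrMr// lt_neqAle eq_sym x0 powR_ge0.
rewrite mulr0 => c0; rewrite ifT ?lee_fin//.
by rewrite eq_le c0 opnorm_deg_ge0.
Qed.

End FormNorm.

(** * Paths of linear maps and their increments *)

Section PathData.
Context {R : realType} {TS : tensor_system R} {V : completeNormedModType R}.
Context {TP : tensor_powers TS V} {p : R} (X : triple TP (Num.truncn p)).
Hypotheses (p1 : 1 <= p) (h1 : S1 X).
Local Notation n := (Num.truncn p).
Local Notation one := (bone (alg X)).

(** The size allowed in degree k over the interval [s, t]. *)
Definition rho (w : R -> R -> R) (th s t : R) (k : nat) : R :=
  w s t `^ (th - k%:R / p).

(** Continuity at t in operator norm, within [0, T]. *)
Definition opcont {U : normedModType R} (T : R) (A : R -> X -> U) (t : R) : Prop :=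
  forall e, 0 < e -> \forall s \near within `[0, T] (nbhs t),
    forall v, `|A s v - A t v| <= e * `|v|.

(** A path A of linear maps and a path h starting from 0, with increments close
    to those of A, with all bounds proportional to M.  This is the content of a
    slowly-varying one-form and of its integral. *)
Definition path_data {U : completeNormedModType R} (T : R) (g : R -> X) (w : R -> R -> R) (th : R)
    (A : R -> X -> U) (h : R -> U) (M : R) : Prop :=
  [/\ h 0 = 0,
      forall s t, 0 <= s -> s <= t -> t <= T ->
        step_data (incr g s t) (rho w th s t) (A s) (A t) (h s) (h t) M &
      forall t, 0 <= t <= T -> opcont T A t].

Let p0 : 0 < p. Proof. exact: lt_le_trans p1. Qed.
Let np : n%:R <= p. Proof. by rewrite truncn_le// ltW. Qed.

Lemma degree_ratio k : (k <= n)%N -> 0 <= k%:R / p <= 1.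
Proof.
move=> kn; rewrite divr_ge0 ?ler0n ?(ltW p0)//= ler_pdivrMr// mul1r.
by rewrite (le_trans _ np)// ler_nat.
Qed.

Lemma norm_aug (c : X) : `|aug c| <= 2 * `|c|.
Proof.
rewrite (le_trans (ler_normB _ _))// normrZ norm_one mulr1 mulr_natl mulr2n.
by rewrite lerD2l; exact: (@norm_proj_le _ _ _ _ _ X 0).
Qed.

(** The powers of w(s,t) satisfy [step_scale], with a constant that depends on a
    bound for w(0,T) only; th <= (n+1)/p is used here. *)
Lemma step_scale_exists (th Om : R) : 1 < th -> th <= n.+1%:R / p -> 0 <= Om ->
  exists2 Q, 1 <= Q & forall (T : R) (g : R -> X) (w : R -> R -> R),
    0 <= T -> pvar_path p T g -> is_control T w -> w 0 T <= Om ->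
    (forall s t, 0 <= s -> s <= t -> t <= T -> pcontrol p g s t <= w s t) ->
    forall s t, 0 <= s -> s <= t -> t <= T ->
      step_scale Q (incr g s t) (w s t `^ p^-1) (rho w th s t).
Proof.
move=> th1 thn Om0; pose L : R := 2 * n%:R + n.+1%:R + 1.
have n0 : 0 <= n%:R :> R by exact: ler0n.
have L1 : 1 <= L by rewrite /L -natr1; lra.
exists ((1 + Om) `^ L).
  by rewrite -[leLHS](powRr0 (1 + Om)); apply: ler_powR; lra.
move=> T g w T0 pg cw wO pw s t s0 st tT.
have sw := control_superadd cw.
have w0 : 0 <= w s t by have [W0 _ _] := sw; apply: W0; rewrite ?s0.
have wOm : w s t <= Om by apply: le_trans wO; apply: (superadd_mono sw).
have pV : 0 <= p^-1 <= 1 by rewrite invr_ge0 (ltW p0) invf_le1.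
have [pV0 pV1] := andP pV.
split.
- by apply: (grp_incr pg); rewrite ?s0 ?tT ?(le_trans st) ?(le_trans s0).
- rewrite powR_ge0/=; apply: powR_big => //; exact: le_trans L1.
- by apply: (incr_small p1 pg) => //; exact: pw.
- split => [k|j k /andP[jk kn]|m k kn nmk mn].
  + exact: powR_ge0.
  + have /andP[k0 k1] := degree_ratio kn.
    have jkR : j%:R / p <= k%:R / p by rewrite ler_pM2r ?invr_gt0// ler_nat.
    have /andP[j0 _] := degree_ratio (leq_trans jk kn).
    by apply: (powR_split w0 wOm); lra.
  + have /andP[k0 k1] := degree_ratio kn.
    rewrite -powR_mulrn ?powR_ge0// -powRrM [_^-1 * _]mulrC.
    have H : n.+1%:R / p <= m%:R / p + k%:R / p.
      by rewrite -mulrDl -natrD ler_pM2r ?invr_gt0// ler_nat.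
    have H2 : m%:R / p <= 2 * n%:R.
      apply: (@le_trans _ _ m%:R); first by rewrite ler_piMr.
      by rewrite -natrM ler_nat mul2n -addnn.
    apply: (powR_split w0 wOm); [lra|lra|].
    by rewrite /L -natr1; lra.
Qed.

Section OnePath.
Variables (T : R) (g : R -> X).
Hypotheses (T0 : 0 <= T) (pg : pvar_path p T g).
Let gG t : 0 <= t <= T -> grp X (g t). Proof. by case: pg => + _ _; exact. Qed.

Lemma mul_incr s t : 0 <= s <= T -> alg X (g s) (incr g s t) = g t.
Proof. by move=> sT; rewrite /incr bmulA grpVr ?bmul1l//; exact: gG. Qed.

Lemma incr_chain s u t : 0 <= u <= T -> alg X (incr g s u) (incr g u t) = incr g s t.
Proof. by move=> uT; rewrite {1}/incr -bmulA mul_incr. Qed.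

Lemma incr_from_cvg1 t : 0 <= t <= T ->
  incr g t s @[s --> within `[0, T] (nbhs t)] --> one.
Proof.
move=> tT; rewrite -(grpVl (gG tT)); apply: cvg_mul; first exact: cvg_cst.
exact: (path_cvg pg).
Qed.

(** Joint continuity is not assumed of a one-form, but the cocycle identity
    expresses A_s through the form at time s and at the fixed point g_t. *)
Lemma form_opcont (U : completeNormedModType R) (b : R -> X -> X -> U) N t :
  0 <= N -> 0 <= t <= T -> cont_one_forms T b ->
  (forall v, `|b t (g t) v| <= N * `|v|) -> opcont T (fun t => b t (g t)) t.
Proof.
move=> N0 tT [bf bc] bN e e0.
have e80 : 0 < e / 8 by rewrite divr_gt0.
pose d := Num.min 1 (e / (4 * (N + 1))).
have d0 : 0 < d by rewrite lt_min ltr01 divr_gt0//; lra.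
have [d1 dN] : d <= 1 /\ N * (2 * d) <= e / 2.
  split; first by rewrite ge_min lexx.
  have : d <= e / (4 * (N + 1)) by rewrite ge_min lexx orbT.
  rewrite ler_pdivlMr; last lra.
  by have := mulr_ge0 N0 (ltW d0); lra.
have /cvgrPdist_lt/(_ _ e80) := bc (g t) (gG tT) t tT.
have /cvgrPdist_lt/(_ _ d0) := incr_from_cvg1 tT.
have : \forall s \near within `[0, T] (nbhs t), 0 <= s <= T.
  by apply: filterS (withinT _ _) => s /=; rewrite in_itv.
apply: filterS3 => s sT a1d bd v.
set a2 := incr g t s in a1d; set gam := fun v => b s (g t) v - b t (g t) v.
have cgam : cont_linear gam.
  have [b1 _ _] := bf s sT; have [b2 _ _] := bf t tT.
  by apply: cl_sub; [apply: b1|apply: b2]; exact: gG.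
have cbt : cont_linear (b t (g t)).
  by have [b2 _ _] := bf t tT; apply: b2; exact: gG.
have E1 : b s (g s) v = b s (g t) (alg X a2 (aug v)).
  by rewrite -[in LHS](mul_incr s tT) (form_shift h1 _ (bf s sT))//;
    [exact: gG|exact: (grp_incr pg)].
have E2 : b t (g t) v = b t (g t) (aug v).
  by rewrite aug_kill// form_one//; [exact: bf|exact: gG].
rewrite E1 E2.
rewrite (_ : _ - _ = gam (alg X a2 (aug v)) - b t (g t) (alg X (one - a2) (aug v))); last first.
  rewrite /gam; move: (aug v) => c.
  by rewrite linearBl/= bmul1l (clB _ _ cbt) opprB addrA subrK.
have na2 : `|a2| <= 2.
  rewrite -[a2](subrK one) (le_trans (ler_normD _ _))// norm_one -distrC.
  by move/ltW: a1d => a1d; lra.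
have ngam : opnorm gam <= e / 8.
  by move: bd; rewrite sub0r normrN => /ltW; apply: le_trans; exact: ler_norm.
have nv := norm_aug v.
have t1 : `|gam (alg X a2 (aug v))| <= e / 8 * (2 * (2 * `|v|)).
  apply: (le_trans (opnormP _ cgam)); apply: ler_pM => //; first exact: opnorm_ge0.
  by apply: (le_trans (bmul_norm _ _ _)); exact: ler_pM.
have t2 : `|b t (g t) (alg X (one - a2) (aug v))| <= N * (d * (2 * `|v|)).
  apply: (le_trans (bN _)); rewrite ler_wpM2l//.
  by apply: (le_trans (bmul_norm _ _ _)); apply: ler_pM => //; exact: ltW.
rewrite (le_trans (ler_normB _ _))// (le_trans (lerD t1 t2))//.
rewrite (_ : _ + _ = (e / 2 + N * (2 * d)) * `|v|); last by field.
by rewrite ler_wpM2r//; lra.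
Qed.

End OnePath.
End PathData.
Arguments rho {R} p w th s t k.

Section FormToPath.
Context {R : realType} {TS : tensor_system R} {V : completeNormedModType R}.
Context {TP : tensor_powers TS V} {p : R} (X : triple TP (Num.truncn p)).
Hypotheses (p1 : 1 <= p) (h1 : S1 X).
Local Notation n := (Num.truncn p).
Local Notation one := (bone (alg X)).
Let p0 : 0 < p. Proof. exact: lt_le_trans p1. Qed.

Lemma dintegrable_cvg (U : completeNormedModType R) (b : R -> X -> X -> U) (g : R -> X) t :
  0 <= t -> dintegrable b g 0 t ->
  part_sum (fun u v => b u (g u) (incr g u v)) 0 @ mesh_to0 0 t --> dintegral b g 0 t.
Proof. by move=> t0; rewrite /dintegrable /dintegral. Qed.

Lemma part_cvg_diag (U : normedModType R) (F : R -> R -> U) t l :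
  part_sum F t @ mesh_to0 t t --> l -> l = 0.
Proof.
move/(part_cvgP _ _ (lexx t)) => H; apply/eqP; rewrite -normr_le0.
apply/ler_addgt0Pl => e e0; rewrite addr0; have [d d0 dH] := H e e0.
have [D [pD mD]] := fine_partition (lexx t) d0.
have := dH D pD mD; rewrite (itv_partitionxx pD) part_sum_nil sub0r normrN.
exact: ltW.
Qed.

(** The path of linear maps of a dominated path, with a constant proportional to
    the operator norm of the one-form. *)
Lemma form_path_data (th1 th Om : R) : 1 < th -> th <= th1 -> th <= n.+1%:R / p ->
  0 <= Om -> exists2 C, 0 <= C &
  forall (T : R) (g : R -> X) (U : completeNormedModType R) (b : R -> X -> X -> U)
    (w1 w : R -> R -> R) (N : R),
  0 <= T -> pvar_path p T g -> is_control T w -> is_control T w1 -> w 0 T <= Om ->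
  (forall s t, 0 <= s -> s <= t -> t <= T -> w1 s t <= w s t) ->
  (forall s t, 0 <= s -> s <= t -> t <= T -> pcontrol p g s t <= w s t) ->
  cont_one_forms T b -> (forall t, 0 <= t <= T -> dintegrable b g 0 t) ->
  (form_norm p T g w1 th1 b <= N%:E)%E ->
  path_data T g w th (fun t => b t (g t)) (dintegral b g 0) (C * N).
Proof.
move=> th_1 thle thn Om0.
have [Q Q1 HQ] := step_scale_exists X p1 th_1 thn Om0.
pose G := (1 + Om) `^ (th1 - th).
have G0 : 0 <= G by exact: powR_ge0.
pose I : R := #|idx X|%:R.
have I0 : 0 <= I by exact: ler0n.
pose q : R := 1 - 2 * 2^-1 `^ th.
pose Cs := `|2 * (I * G) / q|.
have Cs0 : 0 <= Cs by exact: normr_ge0.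
pose Ba := 1 + I * Q ^+ n.
have Ba0 : 0 <= Ba by rewrite addr_ge0// mulr_ge0// exprn_ge0// (le_trans _ Q1).
pose O := (1 + Om) `^ th.
have O0 : 0 <= O by exact: powR_ge0.
exists (1 + G + Cs + (Cs * O + Ba)).
  by do !(done || apply: addr_ge0); exact: mulr_ge0.
move=> T g U b w1 w N T0 pg cw cw1 wO w1w pw cb ib bN.
have [N0 Nb Nd] := form_norm_ge T0 bN.
have [bf bc] := cb.
have gG t : 0 <= t <= T -> grp X (g t) by case: pg => + _ _; exact.
have sw := control_superadd cw; have [w0 wtt wa] := sw.
pose A t := b t (g t).
have cA t : 0 <= t <= T -> cont_linear (A t).
  by move=> tT; have [bl _ _] := bf t tT; apply/bl/gG.
have A1 t : 0 <= t <= T -> A t one = 0.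
  by move=> tT; apply: form_one; [exact: bf|exact: gG].
have AN t v : 0 <= t <= T -> `|A t v| <= N * `|v|.
  move=> tT; apply: (le_trans (opnormP _ (cA _ tT))).
  by rewrite ler_wpM2r// Nb.
(* the form of time s, transported to g_t *)
have shift s t c : 0 <= s <= T -> 0 <= t <= T ->
    b s (g t) c = A s (alg X (incr g s t) (aug c)).
  move=> sT tT; rewrite -(mul_incr pg t sT) (form_shift h1 _ (bf s sT))//.
    exact: gG.
  exact: (grp_incr pg).
have diff s t k (v : tpow TP k) : 0 <= s -> s <= t -> t <= T -> (1 <= k <= n)%N ->
    `|A t (inj X k v) - A s (alg X (incr g s t) (inj X k v))| <=
    N * G * rho p w th s t k * `|v|.
  move=> s0 st tT kn; have [k1 kn'] := andP kn.
  have sT' : 0 <= s <= T by rewrite s0 (le_trans st).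
  have tT' : 0 <= t <= T by rewrite tT (le_trans s0).
  have rho0 : 0 <= rho p w th s t k by exact: powR_ge0.
  rewrite -[Z in alg X _ Z](aug_id (@counit_inj _ _ _ _ _ X k v kn)).
  rewrite -shift//.
  move: st; rewrite le_eqVlt => /predU1P[<-|st].
    by rewrite subrr normr0 !mulr_ge0// powR_ge0.
  have cd : cont_linear (form_diff b g s t).
    have [bl _ _] := bf s sT'; have [bl' _ _] := bf t tT'.
    by apply: cl_sub; [apply: bl'|apply: bl]; exact: gG.
  apply: (le_trans (opnorm_degP _ cd kn')); rewrite ler_wpM2r//.
  apply: (le_trans (Nd _ _ _ s0 st tT kn)); rewrite -mulrA ler_wpM2l//.
  have /andP[k0 kp] := degree_ratio p1 kn'.
  have w10 : 0 <= w1 s t by have [W _ _ _] := cw1; apply: W => //; rewrite s0 ltW.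
  apply: (@le_trans _ _ (w s t `^ (th1 - k%:R / p))).
    by apply: ge0_ler_powR; rewrite ?nnegrE; [lra|lra|apply: w0 => //; rewrite s0 ltW|apply: w1w => //; exact: ltW].
  have wst0 : 0 <= w s t by apply: w0 => //; rewrite s0 ltW.
  have wstO : w s t <= Om by apply: le_trans wO; apply: (superadd_mono sw) => //; exact: ltW.
  by apply: (powR_split wst0 wstO); lra.
pose Xi s t := A s (incr g s t).
have XiE s t : 0 <= s <= T -> 0 <= t <= T -> Xi s t = A s (aug (incr g s t)).
  by move=> sT tT; rewrite aug_kill//; [exact: cA|exact: A1].
(* the cocycle identity reduces the defect to a difference of forms at g_u *)
have defect s u t : 0 <= s -> s <= u -> u <= t -> t <= T ->
    `|Xi s u + Xi u t - Xi s t| <= N * (I * G) * w s t `^ th.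
  move=> s0 su ut tT.
  have u0 : 0 <= u by exact: le_trans su.
  have uT : u <= T by exact: le_trans tT.
  have sT' : 0 <= s <= T by rewrite s0 (le_trans su).
  have tT' : 0 <= t <= T by rewrite tT (le_trans u0).
  have uT' : 0 <= u <= T by rewrite u0.
  have -> : Xi s u + Xi u t - Xi s t =
     \sum_(k | (1 <= deg k)%N) (A u (hcomp k (incr g u t)) -
        A s (alg X (incr g s u) (hcomp k (incr g u t)))).
    rewrite sumrB -!(cl_sum _ _ _ (cA _ uT')) -aug_sum -XiE//.
    have cL := cl_comp (mull_cl (incr g s u)) (cA _ sT').
    have := cl_sum (index_enum (idx X)) (fun k => 1 <= deg k)%N (fun k => hcomp k (incr g u t)) cL.
    rewrite /= => <-; rewrite -aug_sum -shift// [b s (g u) _](_ : _ = Xi s t - Xi s u).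
      by rewrite opprB addrA [Xi u t + _]addrC.
    have [_ _ bcoc] := bf s sT'.
    have := bcoc (g s) (incr g s u) (incr g u t) (gG _ sT') (grp_incr pg sT' uT')
       (grp_incr pg uT' tT').
    rewrite (mul_incr pg _ sT') (incr_chain pg _ _ uT') /Xi /A => <-.
    by rewrite addrC addKr.
  have wst := superadd_mono sw s0 su ut (lexx _) tT.
  have wsu0 : 0 <= w s u by apply: w0; rewrite ?s0.
  have wut0 : 0 <= w u t by apply: w0; rewrite ?u0.
  have wst0 : 0 <= w s t by apply: w0; rewrite ?s0 ?(le_trans su).
  have wsuw : w s u <= w s t by apply: (superadd_mono sw).
  have -> : N * (I * G) * w s t `^ th = I * (N * G * w s t `^ th) by ring.
  apply: norm_sum_le => [|k k1]; first by rewrite !mulr_ge0// powR_ge0.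
  have kn : (1 <= deg k <= n)%N by rewrite k1 deg_le.
  apply: (le_trans (diff _ _ _ _ s0 su uT kn)).
  rewrite -!mulrA ler_wpM2l// ler_wpM2l//.
  have /andP[k0 kp] := degree_ratio p1 (deg_le k).
  have -> : w s t `^ th = w s t `^ (th - (deg k)%:R / p) * (w s t `^ p^-1) ^+ deg k.
    rewrite -powR_mulrn ?powR_ge0// -powRrM [_^-1 * _]mulrC -powRD ?subrK//.
    by rewrite gt_eqF//; lra.
  apply: ler_pM; rewrite ?powR_ge0//.
    by apply: ge0_ler_powR; rewrite ?nnegrE//; lra.
  rewrite -norm_hcomp.
  have [_ sm] := incr_small p1 pg u0 ut tT (pw _ _ u0 ut tT).
  apply: (le_trans (sm _ k1)); apply: lerXn2r; rewrite ?nnegrE ?powR_ge0//.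
  by apply: ge0_ler_powR; rewrite ?nnegrE ?invr_ge0// ltW.
have NK0 : 0 <= N * (I * G) by rewrite !mulr_ge0.
have hcv t : 0 <= t -> t <= T -> part_sum Xi 0 @ mesh_to0 0 t --> dintegral b g 0 t.
  by move=> t0 tT; apply: dintegrable_cvg => //; apply: ib; rewrite t0.
have incrh := integral_increment sw th_1 NK0 defect hcv.
have h00 : dintegral b g 0 0 = 0.
  by apply: (@part_cvg_diag _ Xi 0); apply: hcv.
have {}incrh s t : 0 <= s -> s <= t -> t <= T ->
    `|dintegral b g 0 t - dintegral b g 0 s - Xi s t| <= Cs * N * w s t `^ th.
  move=> s0 st tT; apply: (le_trans (incrh _ _ s0 st tT)).
  rewrite ler_wpM2r ?powR_ge0//.
  rewrite (_ : 2 * _ / _ = (2 * (I * G) / q) * N); last by rewrite -/q; ring.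
  by rewrite ler_wpM2r// ler_norm.
have sum0 : 0 <= Cs * O + Ba by rewrite addr_ge0// mulr_ge0.
have hM t : 0 <= t <= T -> `|dintegral b g 0 t| <= (Cs * O + Ba) * N.
  move=> /andP[t0 tT].
  have := incrh 0 t (lexx _) t0 tT; rewrite h00 subr0 => H.
  rewrite -[dintegral b g 0 t](subrK (Xi 0 t)) (le_trans (ler_normD _ _))//.
  rewrite mulrDl; apply: lerD.
    apply: (le_trans H); rewrite (mulrAC Cs O N) ler_wpM2l ?mulr_ge0//.
    apply: powR_big => //; [by apply: w0; rewrite ?lexx| |lra].
    by apply: le_trans wO; apply: (superadd_mono sw).
  apply: (le_trans (AN _ _ _)); rewrite ?lexx// mulrC ler_wpM2r//.
  have [_ rQ sm _] := HQ T g w T0 pg cw wO pw 0 t (lexx _) t0 tT.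
  exact: small_norm Q1 rQ sm.
split => // [s t s0 st tT|t tT]; last first.
  by apply: (form_opcont h1 pg N0 tT) => // v; exact: AN.
have sT' : 0 <= s <= T by rewrite s0 (le_trans st).
have tT' : 0 <= t <= T by rewrite tT (le_trans s0).
have leC1 : N <= (1 + G + Cs + (Cs * O + Ba)) * N.
  by rewrite -[leLHS]mul1r ler_wpM2r//; lra.
have leC2 : N * G <= (1 + G + Cs + (Cs * O + Ba)) * N.
  by rewrite mulrC ler_wpM2r//; lra.
have leC3 : Cs * N <= (1 + G + Cs + (Cs * O + Ba)) * N.
  by rewrite ler_wpM2r//; lra.
have leC4 : (Cs * O + Ba) * N <= (1 + G + Cs + (Cs * O + Ba)) * N.
  by rewrite ler_wpM2r//; lra.
split.
- by split; [exact: cA|exact: cA|exact: A1|exact: A1|exact: le_trans leC1].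
- split=> [v|v| |].
  + by apply: (le_trans (AN _ _ sT')); rewrite ler_wpM2r.
  + by apply: (le_trans (AN _ _ tT')); rewrite ler_wpM2r.
  + exact: le_trans (hM _ sT') leC4.
  + exact: le_trans (hM _ tT') leC4.
- move=> k v kn; apply: (le_trans (diff _ _ _ _ s0 st tT kn)).
  by rewrite ler_wpM2r// ler_wpM2r// powR_ge0.
- apply: (le_trans (incrh _ _ s0 st tT)); rewrite /rho mul0r subr0.
  by rewrite ler_wpM2r// powR_ge0.
Qed.

End FormToPath.

(** * The product of two paths *)

Section ProductPath.
Context {R : realType} {TS : tensor_system R} {V : completeNormedModType R}.
Context {TP : tensor_powers TS V} {p : R} (X : triple TP (Num.truncn p)).
Hypotheses (p1 : 1 <= p) (h1 : S1 X) (h2 : S2 X).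
Local Notation n := (Num.truncn p).
Local Notation one := (bone (alg X)).
Let p0 : 0 < p. Proof. exact: lt_le_trans p1. Qed.
Variables (J : idx X * idx X -> X -> TS X X) (HJ : linearization J).

Lemma incr_to_cvg1 (T : R) (g : R -> X) t : pvar_path p T g -> 0 <= t <= T ->
  incr g s t @[s --> within `[0, T] (nbhs t)] --> one.
Proof.
move=> pg tT; have gG : grp X (g t) by case: pg => + _ _; exact.
rewrite -(grpVl gG); apply: cvg_mul; last exact: cvg_cst.
exact: (path_inv_cvg pg).
Qed.

(** The path h is continuous, as its increments are controlled. *)
Lemma path_data_cont (U : completeNormedModType R) (T : R) (g : R -> X) w th
    (A : R -> X -> U) h M t : pvar_path p T g -> is_control T w -> 1 < th ->
  path_data T g w th A h M -> 0 <= t <= T -> forall e, 0 < e ->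
  \forall s \near within `[0, T] (nbhs t), `|h s - h t| <= e.
Proof.
move=> pg cw th1 [_ Hs _] tT e e0; have /andP[t0 tT'] := tT.
have [[_ _ _ _ M0] _ _ _] := Hs t t t0 (lexx _) tT'.
have M1 : 0 < M + 1 by lra.
pose e1 := e / 2 / (M + 1).
have e10 : 0 < e1 by rewrite !divr_gt0.
have Me1 : M * e1 <= e / 2.
  rewrite /e1 mulrA ler_pdivrMr//; nra.
have e20 : 0 < e1 `^ th^-1 by rewrite powR_gt0.
have [d d0 dH] := control_diag cw e20.
have wsmall s u : 0 <= s -> s <= u -> u <= T -> u - s < d -> w s u `^ th <= e1.
  move=> s0 su uT sud; rewrite -[leRHS](_ : (e1 `^ th^-1) `^ th = _); last first.
    by rewrite -powRrM mulVf ?powRr1//; [exact: ltW|rewrite gt_eqF//; lra].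
  have [w0 _ _ _] := cw.
  apply: ge0_ler_powR; rewrite ?nnegrE ?powR_ge0//; first lra.
    by apply: w0 => //; rewrite s0.
  exact/ltW/dH.
have gG s : 0 <= s <= T -> grp X (g s) by case: pg => + _ _; exact.
have key s u : 0 <= s -> s <= u -> u <= T -> u - s < d -> `|one - incr g s u| < e1 ->
    `|h u - h s| <= e.
  move=> s0 su uT sud i1.
  have [[cA _ A1 _ _] [AM _ _ _] _ hA] := Hs s u s0 su uT.
  rewrite -[h u - h s](subrK (A s (incr g s u))) (le_trans (ler_normD _ _))//.
  have t1 : `|h u - h s - A s (incr g s u)| <= e / 2.
    apply: (le_trans hA); apply: le_trans Me1; rewrite ler_wpM2l//.
    by rewrite /rho mul0r subr0; exact: wsmall.
  have t2 : `|A s (incr g s u)| <= e / 2.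
    rewrite -aug_kill// aug_grp; last first.
      by apply: (grp_incr pg); rewrite ?s0 ?uT ?(le_trans su)// (le_trans s0).
    apply: (le_trans (AM _)); apply: le_trans Me1; rewrite ler_wpM2l// distrC.
    exact: ltW.
  lra.
have /cvgrPdist_lt/(_ _ e10) := incr_from_cvg1 pg tT.
have /cvgrPdist_lt/(_ _ e10) := incr_to_cvg1 pg tT.
have : \forall s \near within `[0, T] (nbhs t), 0 <= s <= T /\ `|t - s| < d.
  have F1 : \forall s \near within `[0, T] (nbhs t), 0 <= s <= T.
    by apply: filterS (withinT _ _) => s /=; rewrite in_itv.
  have F2 : \forall s \near within `[0, T] (nbhs t), `|t - s| < d.
    by apply: cvg_within; exact: (nbhsx_ballx t d d0).
  by apply: filterS2 F1 F2 => s sT bd; split.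
apply: filterS3 => s [/andP[s0 sT] std] i1 i2.
have [st|/ltW ts] := leP s t.
  by rewrite distrC; apply: key => //; move: std; rewrite ger0_norm ?subr_ge0.
by apply: key => //; move: std; rewrite distrC ger0_norm ?subr_ge0.
Qed.

Lemma prod_form_opcont (U1 U2 : completeNormedModType R) (T : R)
    (A : R -> X -> U1) (B : R -> X -> U2) (x : R -> U1) (y : R -> U2) M1 M2 t :
  0 <= M1 -> 0 <= M2 -> 0 <= t <= T ->
  (forall s, 0 <= s <= T -> [/\ cont_linear (A s), cont_linear (B s),
     `|x s| <= M1 & `|y s| <= M2]) ->
  (forall s, 0 <= s <= T -> (forall v, `|A s v| <= M1 * `|v|) /\
     (forall v, `|B s v| <= M2 * `|v|)) ->
  opcont T A t -> opcont T B t ->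
  (forall e, 0 < e -> \forall s \near within `[0, T] (nbhs t), `|x s - x t| <= e) ->
  (forall e, 0 < e -> \forall s \near within `[0, T] (nbhs t), `|y s - y t| <= e) ->
  opcont T (fun s => prod_form J (A s) (B s) (x s) (y s)) t.
Proof.
move=> M10 M20 tT HAB HM cA cB cx cy e e0.
have [BJ BJ0 HBJ] := J_bound HJ.
pose N : R := #|{: idx X * idx X}|%:R.
have N0 : 0 <= N by exact: ler0n.
pose L := (M1 + M2) * (2 + N * BJ).
have L0 : 0 <= L by rewrite mulr_ge0 ?addr_ge0// mulr_ge0.
pose d := e / (L + 1).
have d0 : 0 < d by rewrite divr_gt0//; lra.
have dL : d * L <= e.
  by rewrite /d mulrAC ler_pdivrMr; [nra|lra].
have F1 : \forall s \near within `[0, T] (nbhs t), 0 <= s <= T.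
  by apply: filterS (withinT _ _) => s /=; rewrite in_itv.
have F2 : \forall s \near within `[0, T] (nbhs t),
    (forall v, `|A s v - A t v| <= d * `|v|) /\ (forall v, `|B s v - B t v| <= d * `|v|).
  by apply: filterI; [exact: cA|exact: cB].
have F3 : \forall s \near within `[0, T] (nbhs t), `|x s - x t| <= d /\ `|y s - y t| <= d.
  by apply: filterI; [exact: cx|exact: cy].
apply: filterS3 F1 F2 F3 => s sT [dA dB] [dx dy] v.
have [cAs cBs xs ys] := HAB s sT; have [cAt cBt xt yt] := HAB t tT.
have [AsM BsM] := HM s sT; have [AtM BtM] := HM t tT.
rewrite /prod_form.
have -> : tens TS (A s v) (y s) + tens TS (x s) (B s v) + quad J (A s) (B s) v -
    (tens TS (A t v) (y t) + tens TS (x t) (B t v) + quad J (A t) (B t) v) =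
  tens TS (A s v - A t v) (y s) + tens TS (A t v) (y s - y t) +
  (tens TS (x s - x t) (B s v) + tens TS (x t) (B s v - B t v)) +
  (quad J (A s) (B s) v - quad J (A t) (B t) v).
  rewrite !linearBl !linearBr/= !addrA !subrK !opprD !addrA.
  by rewrite [LHS](ACl (1*4*2*5*3*6)).
rewrite (le_trans _ (ler_wpM2r (normr_ge0 v) dL))//.
rewrite (_ : d * L * `|v| = d * `|v| * M2 + M1 * `|v| * d + (d * (M2 * `|v|) +
   M1 * (d * `|v|)) + N * ((d * M2 + M1 * d) * (BJ * `|v|))); last by rewrite /L; ring.
rewrite (le_trans (ler_normD _ _))//; apply: lerD.
  rewrite (le_trans (ler_normD _ _))//; apply: lerD;
  rewrite (le_trans (ler_normD _ _))//; apply: lerD;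
  by rewrite tens_norm; apply: ler_pM.
rewrite /quad -sumrB; apply: norm_sum_le => [|q Qq].
  by rewrite mulr_ge0 ?mulr_ge0// addr_ge0// mulr_ge0// ltW.
rewrite tmapB// (le_trans (ler_normD _ _))// mulrDl.
have Jv := HBJ _ v Qq.
apply: lerD.
  apply: (le_trans (@tmap_le _ _ _ _ _ _ _ _ d M2 (cl_sub cAs cAt) cBs _ _ _ _ _)) => //.
    exact: ltW.
  by rewrite ler_wpM2l// mulr_ge0// ltW.
apply: (le_trans (@tmap_le _ _ _ _ _ _ _ _ M1 d cAt (cl_sub cBs cBt) _ _ _ _ _)) => //.
  exact: ltW.
by rewrite ler_wpM2l// mulr_ge0// ltW.
Qed.

(** The tensor product of two paths. *)
Lemma product_path (th Om : R) : 1 < th -> th <= n.+1%:R / p -> 0 <= Om ->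
  exists2 C, 0 <= C & forall (U1 U2 : completeNormedModType R) (T : R) (g : R -> X)
    (w : R -> R -> R) (A : R -> X -> U1) (B : R -> X -> U2) x y M1 M2,
  0 <= T -> pvar_path p T g -> is_control T w -> w 0 T <= Om ->
  (forall s t, 0 <= s -> s <= t -> t <= T -> pcontrol p g s t <= w s t) ->
  path_data T g w th A x M1 -> path_data T g w th B y M2 ->
  path_data T g w th (fun s => prod_form J (A s) (B s) (x s) (y s))
    (fun s => tens TS (x s) (y s)) (C * (M1 * M2)).
Proof.
move=> th1 thn Om0; have [Q Q1 HQ] := step_scale_exists X p1 th1 thn Om0.
have [C C0 HC] := product_bounds h1 h2 HJ Q1.
exists (1 + C); first lra.
move=> U1 U2 T g w A B x y M1 M2 T0 pg cw wO pw HA HB.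
have [x0 HAs Ac] := HA; have [y0 HBs Bc] := HB.
have [[_ _ _ _ M10] _ _ _] := HAs 0 0 (lexx _) (lexx _) T0.
have [[_ _ _ _ M20] _ _ _] := HBs 0 0 (lexx _) (lexx _) T0.
have MM : 0 <= M1 * M2 by rewrite mulr_ge0.
have leC1 : C * (M1 * M2) <= (1 + C) * (M1 * M2) by rewrite ler_wpM2r//; lra.
have leC2 : M1 * M2 <= (1 + C) * (M1 * M2).
  by rewrite -[leLHS]mul1r ler_wpM2r//; lra.
split.
- by rewrite x0 linear0l.
- move=> s t s0 st tT; have sc := HQ T g w T0 pg cw wO pw s t s0 st tT.
  have dA := HAs s t s0 st tT; have dB := HBs s t s0 st tT.
  have [b1 b2 b3] := HC _ _ _ _ _ _ _ _ _ _ _ _ _ _ _ sc dA dB.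
  have sT : s <= T by exact: le_trans tT.
  have t0 : 0 <= t by exact: le_trans st.
  have sct := HQ T g w T0 pg cw wO pw t t t0 (lexx _) tT.
  have [b1t _ _] := HC _ _ _ _ _ _ _ _ _ _ _ _ _ _ _ sct
     (HAs t t t0 (lexx _) tT) (HBs t t t0 (lexx _) tT).
  have [[cA cA' A1 A1' _] [AM AM' xM xM'] _ _] := dA.
  have [[cB cB' B1 B1' _] [BM BM' yM yM'] _ _] := dB.
  have kill (D : X -> U1) (E : X -> U2) z z' : cont_linear D -> cont_linear E ->
      D one = 0 -> E one = 0 -> prod_form J D E z z' one = 0.
    move=> cD cE D1 E1; rewrite /prod_form D1 E1 linear0l linear0r !add0r.
    rewrite /quad big1// => q Qq; rewrite (J_one HJ)//.
    by rewrite (cl0 (tmap_cont_linear TS cD cE)).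
  split.
  + by split; [exact: prod_form_cl|exact: prod_form_cl|exact: kill|exact: kill|
      exact: le_trans leC2].
  + split.
    * by move=> v; apply: (le_trans (b1 v)); rewrite ler_wpM2r.
    * by move=> v; apply: (le_trans (b1t v)); rewrite ler_wpM2r.
    * by rewrite tens_norm (le_trans _ leC2)//; exact: ler_pM.
    * by rewrite tens_norm (le_trans _ leC2)//; exact: ler_pM.
  + move=> k v kn; apply: (le_trans (b2 k v kn)).
    by rewrite ler_wpM2r// ler_wpM2r// powR_ge0.
  + by apply: (le_trans b3); rewrite ler_wpM2r// powR_ge0.
- move=> t tT.
  have st s : 0 <= s <= T -> _ := fun sT => HAs s s (proj1 (andP sT)) (lexx s) (proj2 (andP sT)).
  have st' s : 0 <= s <= T -> _ := fun sT => HBs s s (proj1 (andP sT)) (lexx s) (proj2 (andP sT)).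
  apply: (@prod_form_opcont _ _ _ _ _ _ _ M1 M2) => //.
  + move=> s sT; have [[? _ _ _ _] [_ _ ? _] _ _] := st s sT.
    by have [[? _ _ _ _] [_ _ ? _] _ _] := st' s sT; split.
  + move=> s sT; have [_ [? _ _ _] _ _] := st s sT.
    by have [_ [? _ _ _] _ _] := st' s sT; split.
  + exact: Ac.
  + exact: Bc.
  + exact: (path_data_cont pg cw th1 HA).
  + exact: (path_data_cont pg cw th1 HB).
Qed.

End ProductPath.

(** * The one-form of a path of linear maps *)

Section PathToForm.
Context {R : realType} {TS : tensor_system R} {V : completeNormedModType R}.
Context {TP : tensor_powers TS V} {p : R} (X : triple TP (Num.truncn p)).
Hypotheses (p1 : 1 <= p).
Local Notation n := (Num.truncn p).
Local Notation one := (bone (alg X)).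
Context {U : completeNormedModType R}.
Variables (T : R) (g : R -> X) (w : R -> R -> R) (th : R) (A : R -> X -> U) (h : R -> U) (M : R).
Hypotheses (T0 : 0 <= T) (pg : pvar_path p T g) (cw : is_control T w) (th1 : 1 < th).
Hypothesis HA : path_data T g w th A h M.

(** The cocyclic one-form whose value at g_t is A_t. *)
Definition path_form (t : R) (a v : X) : U :=
  A t (alg X (alg X (ginv X (g t)) a) (aug v)).

Let gG t : 0 <= t <= T -> grp X (g t). Proof. by case: pg => + _ _; exact. Qed.
Let st s t (s0 : 0 <= s) (hst : s <= t) (tT : t <= T) :
  step_data (incr g s t) (rho p w th s t) (A s) (A t) (h s) (h t) M.
Proof. by case: HA => _ + _; exact. Qed.
Let cA t : 0 <= t <= T -> cont_linear (A t).
Proof. by move=> /andP[t0 tT]; have [[? ? _ _ _] _ _ _] := st t0 (lexx t) tT. Qed.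
Let A1 t : 0 <= t <= T -> A t one = 0.
Proof. by move=> /andP[t0 tT]; have [[_ _ ? _ _] _ _ _] := st t0 (lexx t) tT. Qed.
Let M0 : 0 <= M.
Proof. by have [[_ _ _ _ ?] _ _ _] := st (lexx 0) (lexx 0) T0. Qed.
Let AM t v : 0 <= t <= T -> `|A t v| <= M * `|v|.
Proof. by move=> /andP[t0 tT]; have [_ [? _ _ _] _ _] := st t0 (lexx t) tT. Qed.

Lemma path_form_cl t a : 0 <= t <= T -> cont_linear (path_form t a).
Proof.
move=> tT; exact: (cl_comp (cl_comp (@aug_cl _ _ _ _ _ X) (mull_cl _)) (cA tT)).
Qed.

Lemma path_form_self t v : 0 <= t <= T -> path_form t (g t) v = A t v.
Proof.
move=> tT; rewrite /path_form grpVl; last exact: gG.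
by rewrite bmul1l aug_kill//; [exact: cA|exact: A1].
Qed.

Lemma cvg_opnorm0 (I : Type) (FF : set_system I) {_ : Filter FF} (f : I -> X -> U) (c : I -> R) :
  (forall i, 0 <= c i) -> (\forall i \near FF, forall v, `|f i v| <= c i * `|v|) ->
  c @ FF --> (0 : R) -> (fun i => opnorm (f i)) @ FF --> (0 : R).
Proof.
move=> c0 fc cc; apply: (@squeeze_cvgr _ _ _ _ (cst 0) c) => //; last exact: cvg_cst.
by apply: filterS fc => i fi; rewrite opnorm_ge0/= opnorm_le.
Qed.

Lemma path_form_one_form t : 0 <= t <= T -> one_form (path_form t).
Proof.
move=> tT; split.
- by move=> a _; exact: path_form_cl.
- move=> a Ga.
  apply: (@cvg_opnorm0 _ _ _ _ (fun c => M * (`|alg X (ginv X (g t)) (c - a)| * 2))).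
  + by move=> c; rewrite !mulr_ge0.
  + apply: nearW => c v; rewrite /path_form -(clB _ _ (cA tT)) -linearBl/= -linearBr/=.
    apply: (le_trans (AM _ tT)); rewrite -mulrA ler_wpM2l// -mulrA.
    by apply: (le_trans (bmul_norm _ _ _)); rewrite ler_wpM2l// norm_aug.
  + rewrite [X in _ --> X](_ : 0 = M * (`|alg X (ginv X (g t)) (a - a)| * 2)); last first.
      by rewrite subrr linear0r normr0 mul0r mulr0.
    apply: cvgM; first exact: cvg_cst.
    apply: cvgM; last exact: cvg_cst.
    apply: cvg_norm; apply: cvg_mul; first exact: cvg_cst.
    apply: cvgB; last exact: cvg_cst.
    exact: cvg_within.
- move=> a1 a2 a3 G1 G2 G3; rewrite /path_form -(clD _ _ (cA tT)) !aug_grp//; last exact: grpM.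
  congr (A t _); rewrite -!bmulA -linearDr; congr (alg X _ _).
  by rewrite -linearDr; congr (alg X _ _); rewrite linearBr/= bmul1r addrC addrA subrK.
Qed.

(** For a fixed group element the one-form is continuous in time, since both A
    and the inverse of g are. *)
Lemma path_form_cont : cont_one_forms T path_form.
Proof.
split; first exact: path_form_one_form.
move=> a Ga t tT; have [_ _ oA] := HA; have Mge0 := M0.
set y := fun s => alg X (ginv X (g s)) a.
have cy : y s @[s --> within `[0, T] (nbhs t)] --> y t.
  by apply: cvg_mul; [exact: (path_inv_cvg pg)|exact: cvg_cst].
have F1 : \forall s \near within `[0, T] (nbhs t), 0 <= s <= T.
  by apply: filterS (withinT _ _) => s /=; rewrite in_itv.
apply/cvgrPdist_le => e e0.
pose Y := `|y t| + 1; have Y0 : 0 < Y by rewrite /Y ltr_wpDl.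
have e10 : 0 < e / 4 / Y by rewrite !divr_gt0.
have e20 : 0 < Num.min 1 (e / 4 / (M + 1)).
  by rewrite lt_min ltr01 !divr_gt0//; lra.
have /cvgrPdist_le/(_ _ e20) := cy.
apply: filterS3 F1 (oA t tT _ e10) => s sT dA dy.
rewrite sub0r normrN ger0_norm ?opnorm_ge0//; apply: opnorm_le; first exact: ltW.
move=> v; rewrite /path_form -/(y s) -/(y t).
rewrite (_ : _ - _ = (A s (alg X (y s) (aug v)) - A t (alg X (y s) (aug v))) -
   A t (alg X (y t - y s) (aug v))); last first.
  rewrite linearBl/= (clB _ _ (cA tT)) opprB; move: (aug v) => c.
  by rewrite addrA subrK.
have [dy1 dy2] : `|y t - y s| <= 1 /\ M * `|y t - y s| <= e / 4.
  move: dy; rewrite le_min => /andP[dy1]; rewrite ler_pdivlMr; last lra.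
  by move=> dy2; split => //; have := normr_ge0 (y t - y s); lra.
have ys : `|y s| <= Y.
  rewrite (_ : y s = y t - (y t - y s)); last by rewrite opprB addrC subrK.
  by rewrite (le_trans (ler_normB _ _))// lerD2l.
have nv := norm_aug v.
have t1 : `|A s (alg X (y s) (aug v)) - A t (alg X (y s) (aug v))| <= e / 4 / Y * (Y * (2 * `|v|)).
  apply: (le_trans (dA _)); rewrite ler_wpM2l//; first exact: ltW.
  by apply: (le_trans (bmul_norm _ _ _)); exact: ler_pM.
have t2 : `|A t (alg X (y t - y s) (aug v))| <= M * `|y t - y s| * (2 * `|v|).
  apply: (le_trans (AM _ tT)); rewrite -mulrA ler_wpM2l//.
  by apply: (le_trans (bmul_norm _ _ _)); exact: ler_wpM2l.
rewrite (le_trans (ler_normB _ _))//.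
apply: (@le_trans _ _ (e / 4 / Y * (Y * (2 * `|v|)) + e / 4 * (2 * `|v|))).
  by apply: lerD => //; apply: (le_trans t2); rewrite ler_wpM2r.
rewrite [leLHS](_ : _ = e * `|v|)//; field; exact: lt0r_neq0.
Qed.

Lemma path_form_opnorm t : 0 <= t <= T -> opnorm (path_form t (g t)) <= M.
Proof. by move=> tT; apply: opnorm_le => // v; rewrite path_form_self// AM. Qed.

Lemma path_form_diff s t k : 0 <= s -> s < t -> t <= T -> (1 <= k <= n)%N ->
  opnorm_deg k (form_diff path_form g s t) <= M * w s t `^ (th - k%:R / p).
Proof.
move=> s0 hst tT kn; have sT' : 0 <= s <= T by rewrite s0 (le_trans (ltW hst)).
have tT' : 0 <= t <= T by rewrite tT (le_trans s0 (ltW hst)).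
apply: opnorm_deg_le => [|v]; first by rewrite mulr_ge0// powR_ge0.
rewrite /form_diff path_form_self// /path_form.
rewrite aug_id; last exact: counit_inj.
by have [_ _ H _] := st s0 (ltW hst) tT; exact: H.
Qed.

Lemma scaled_control c : 0 <= c -> is_control T (fun s t => c * w s t).
Proof.
move=> c0; have [w0 wtt /subspace_continuousP wc wa] := cw; split.
- by move=> s t hst tT; rewrite mulr_ge0// w0.
- by move=> t tT; rewrite wtt// mulr0.
- apply/subspace_continuousP => q Dq.
  by apply: cvgM; [exact: cvg_cst|exact: wc].
- by move=> s u t hs hu; rewrite -mulrDr ler_wpM2l// wa.
Qed.

Lemma path_form_slow : slowly_varying p T g path_form.
Proof.
have Mge0 := M0; pose c := (1 + M) `^ (th - 1)^-1.
have th10 : 0 < th - 1 by rewrite subr_gt0.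
have c1 : 1 <= c.
  rewrite -[leLHS](powRr0 (1 + M)); apply: ler_powR; first lra.
  by rewrite invr_ge0 ltW.
(* every exponent th - k / p is at least th - 1, so c absorbs the factor M *)
have cE : c `^ (th - 1) = 1 + M by rewrite -powRrM mulVf ?gt_eqF// powRr1//; lra.
have c0 : 0 <= c by lra.
exists (1 + M), (fun s t => c * w s t), th; split => //; first lra.
- exact: scaled_control.
- by move=> t tT; rewrite (le_trans (path_form_opnorm tT))//; lra.
- move=> s t s0 hst tT k kn; apply: (le_trans (path_form_diff s0 hst tT kn)).
  have [w0 _ _ _] := cw.
  have /andP[k0 k1] : 0 <= k%:R / p <= 1.
    by apply: (degree_ratio p1); case/andP: kn.
  rewrite powRM//; last by apply: w0 => //; rewrite s0 ltW.
  rewrite ler_wpM2r ?powR_ge0//; apply: (@le_trans _ _ (c `^ (th - 1))).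
    by rewrite cE; lra.
  by apply: ler_powR => //; lra.
Qed.

Lemma path_form_cvg t : 0 <= t <= T ->
  part_sum (fun u v => path_form u (g u) (incr g u v)) 0 @ mesh_to0 0 t --> h t.
Proof.
move=> /andP[t0 tT]; have [h0 _ _] := HA; rewrite -[h t]subr0 -[X in _ - X]h0.
apply: (telescope_cvg cw th1 M0 _ t0 tT) => s u s0 su uT.
rewrite path_form_self; last by rewrite s0 (le_trans su).
by have [_ _ _] := st s0 su uT; rewrite /rho mul0r subr0.
Qed.

Lemma path_form_integral t : 0 <= t <= T ->
  dintegrable path_form g 0 t /\ dintegral path_form g 0 t = h t.
Proof.
move=> tT; have cv := path_form_cvg tT; have /andP[t0 _] := tT.
have pf := mesh_to0_proper t0.
split; first by apply/cvg_ex; exists (h t).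
exact: (cvg_lim (@norm_hausdorff _ _) cv).
Qed.

Lemma path_form_dominated : dominated p T g (dintegral path_form g 0) path_form.
Proof.
split; [exact: path_form_cont|exact: path_form_slow|].
move=> t tT; have [i1 i2] := path_form_integral tT; split => //.
have [_ ->] : dintegrable path_form g 0 0 /\ dintegral path_form g 0 0 = h 0.
  by apply: path_form_integral; rewrite lexx.
by have [-> _ _] := HA; rewrite add0r.
Qed.

Lemma path_form_norm : (form_norm p T g w th path_form <= (2 * M)%:E)%E.
Proof.
apply: form_norm_le => // [t tT|]; last exact: path_form_diff.
exact: path_form_opnorm.
Qed.

End PathToForm.

(** The theorem for fixed exponents and a fixed value of w(0,T). *)
Lemma product_form_exists (R : realType) (TS : tensor_system R)
    (V : completeNormedModType R) (TP : tensor_powers TS V) (p : R)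
    (X : triple TP (Num.truncn p)) (th1 th2 Om : R) :
  1 <= p -> S1 X -> S2 X ->
  exists C : R, forall (T : R) (g : R -> X) (U1 U2 : completeNormedModType R)
         (b1 : R -> X -> X -> U1) (b2 : R -> X -> X -> U2)
         (w1 w2 : R -> R -> R),
    0 <= T ->
    pvar_path p T g ->
    is_control T w1 -> is_control T w2 ->
    1 < th1 -> 1 < th2 ->
    dominated p T g (dintegral b1 g 0) b1 ->
    dominated p T g (dintegral b2 g 0) b2 ->
    (form_norm p T g w1 th1 b1 < +oo)%E ->
    (form_norm p T g w2 th2 b2 < +oo)%E ->
    let w := sum_control p g w1 w2 in
    let th := Num.min (Num.min th1 th2) ((Num.truncn p).+1%:R / p) in
    w 0 T = Om ->
    exists b : R -> X -> X -> TS U1 U2,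
    [/\ dominated p T g (dintegral b g 0) b,
        (form_norm p T g w th b <= C%:E *
         (form_norm p T g w1 th1 b1 * form_norm p T g w2 th2 b2))%E &
        forall t, 0 <= t <= T ->
          dintegral b g 0 t = tens TS (dintegral b1 g 0 t) (dintegral b2 g 0 t)].
Proof.
move=> p1 h1 h2; set th := Num.min _ _.
have [cond|ncond] := pselect (1 < th1 /\ 1 < th2 /\ 0 <= Om); last first.
  (* for other parameters the hypotheses are never satisfied *)
  exists 0 => T g U1 U2 b1 b2 w1 w2 T0 pg cw1 cw2 t1 t2 _ _ _ _ w thl wOm.
  case: ncond; split=> //; split=> //; rewrite -wOm /w /sum_control.
  have [W1 _ _ _] := cw1; have [W2 _ _ _] := cw2.
  by rewrite !addr_ge0 ?powR_ge0// ?(W1, W2) ?lexx.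
have [t1 [t2 Om0]] := cond.
have p0 : 0 < p by exact: lt_le_trans p1.
have thn : th <= (Num.truncn p).+1%:R / p by rewrite ge_min lexx orbT.
have le1 : th <= th1 by rewrite !ge_min lexx.
have le2 : th <= th2 by rewrite !ge_min lexx orbT.
have th_1 : 1 < th.
  by rewrite !lt_min t1 t2 ltr_pdivlMr// mul1r truncnS_gt.
have [J HJ] := linearization_exists h1 h2.
have [C1 C10 H1] := form_path_data p1 h1 th_1 le1 thn Om0.
have [C2 C20 H2] := form_path_data p1 h1 th_1 le2 thn Om0.
have [C C0 H3] := product_path p1 h1 h2 HJ th_1 thn Om0.
exists (2 * (C * (C1 * C2))).
move=> T g U1 U2 b1 b2 w1 w2 T0 pg cw1 cw2 _ _ d1 d2 n1 n2 w thl wOm; rewrite {}/thl.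
have cp : is_control T (pcontrol p g) by exact: (pcontrol_control p1 pg).
have [P0 Ptt /subspace_continuousP Pc Pa] := cp.
have [W10 W1tt /subspace_continuousP W1c W1a] := cw1.
have [W20 W2tt /subspace_continuousP W2c W2a] := cw2.
have cw : is_control T w.
  split.
  - by move=> s t hs ht; rewrite /w /sum_control !addr_ge0 ?powR_ge0 ?W10 ?W20.
  - by move=> t tT; rewrite /w /sum_control W1tt// W2tt// !add0r; exact: Ptt.
  - apply/subspace_continuousP => q Dq; apply: cvgD; last exact: Pc.
    by apply: cvgD; [exact: W1c|exact: W2c].
  - move=> s u t hs hu; rewrite /w /sum_control addrACA.
    by rewrite [X in X + _]addrACA !lerD ?W1a ?W2a// Pa.
have wO : w 0 T <= Om by rewrite wOm.
have le_w (f : R -> R -> R) : (forall s t, 0 <= s <= t -> t <= T -> f s t <= w s t) ->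
    forall s t, 0 <= s -> s <= t -> t <= T -> f s t <= w s t.
  by move=> fw s t s0 hst tT; apply: fw; rewrite ?s0.
have w1w : forall s t, 0 <= s -> s <= t -> t <= T -> w1 s t <= w s t.
  apply: le_w => s t hs ht; rewrite /w /sum_control -addrA lerDl addr_ge0 ?powR_ge0//.
  exact: W20.
have w2w : forall s t, 0 <= s -> s <= t -> t <= T -> w2 s t <= w s t.
  apply: le_w => s t hs ht; rewrite /w /sum_control addrAC lerDr addr_ge0 ?powR_ge0//.
  exact: W10.
have pw : forall s t, 0 <= s -> s <= t -> t <= T -> pcontrol p g s t <= w s t.
  apply: le_w => s t hs ht; rewrite /w /sum_control lerDr addr_ge0//.
    exact: W10.
  exact: W20.
have norm_real (U : completeNormedModType R) (b : R -> X -> X -> U) v t :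
    (form_norm p T g v t b < +oo)%E -> exists N, form_norm p T g v t b = N%:E.
  move=> nb; exists (fine (form_norm p T g v t b)); rewrite fineK// ge0_fin_numE//.
  rewrite /form_norm adde_ge0//; last exact: bigmax_ge_id.
  apply: (@le_trans _ _ (opnorm (b 0 (g 0)))%:E); first by rewrite lee_fin opnorm_ge0.
  by apply: ereal_sup_ubound; exists 0 => //=; rewrite in_itv/= lexx.
have [N1 N1E] := norm_real _ _ _ _ n1; have [N2 N2E] := norm_real _ _ _ _ n2.
have [c1 _ i1] := d1; have [c2 _ i2] := d2.
have le1E : (form_norm p T g w1 th1 b1 <= N1%:E)%E by rewrite N1E.
have le2E : (form_norm p T g w2 th2 b2 <= N2%:E)%E by rewrite N2E.
have pd1 := H1 T g U1 b1 w1 w N1 T0 pg cw cw1 wO w1w pw c1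
  (fun t tT => (i1 t tT).1) le1E.
have pd2 := H2 T g U2 b2 w2 w N2 T0 pg cw cw2 wO w2w pw c2
  (fun t tT => (i2 t tT).1) le2E.
have pd := H3 U1 U2 T g w _ _ _ _ _ _ T0 pg cw wO pw pd1 pd2.
exists (path_form g (fun s => prod_form J (b1 s (g s)) (b2 s (g s))
  (dintegral b1 g 0 s) (dintegral b2 g 0 s))); split.
- exact: (path_form_dominated p1 T0 pg cw th_1 pd).
- apply: (le_trans (path_form_norm T0 pg pd)).
  by rewrite N1E N2E -!EFinM lee_fin le_eqVlt; apply/orP; left; apply/eqP; ring.
- by move=> t tT; have [_ ->] := path_form_integral T0 pg cw th_1 pd tT.
Qed.

Theorem proposition35 (R : realType) (TS : tensor_system R)
    (V : completeNormedModType R) (TP : tensor_powers TS V)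
    (p : R) (p_ge1 : 1 <= p)
    (X : triple TP (Num.truncn p))
    (A2 : banach_algebra (TS X X)) (hA2 : is_tensor_square_algebra A2)
    (h1 : S1 X) (h2 : S2 X) (h3 : S3 A2) :
  exists C : R -> R -> R -> R,
  forall (T : R) (g : R -> X) (U1 U2 : completeNormedModType R)
         (b1 : R -> X -> X -> U1) (b2 : R -> X -> X -> U2)
         (w1 w2 : R -> R -> R) (th1 th2 : R),
    0 <= T ->
    pvar_path p T g ->
    is_control T w1 -> is_control T w2 ->
    1 < th1 -> 1 < th2 ->
    dominated p T g (dintegral b1 g 0) b1 ->
    dominated p T g (dintegral b2 g 0) b2 ->
    (form_norm p T g w1 th1 b1 < +oo)%E ->
    (form_norm p T g w2 th2 b2 < +oo)%E ->
    let w := sum_control p g w1 w2 in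
    let th := Num.min (Num.min th1 th2) ((Num.truncn p).+1%:R / p) in
    exists b : R -> X -> X -> TS U1 U2,
    [/\ dominated p T g (dintegral b g 0) b,
        (form_norm p T g w th b <=
         (C th1 th2 (w 0 T))%:E *
         (form_norm p T g w1 th1 b1 * form_norm p T g w2 th2 b2))%E &
        forall t, 0 <= t <= T ->
          dintegral b g 0 t = tens TS (dintegral b1 g 0 t) (dintegral b2 g 0 t)].
Proof.
have ex th1 th2 Om := product_form_exists th1 th2 Om p_ge1 h1 h2.
exists (fun th1 th2 Om => sval (cid (ex th1 th2 Om))).
move=> T g U1 U2 b1 b2 w1 w2 th1 th2 T0 pg cw1 cw2 t1 t2 d1 d2 n1 n2 w th.
have H := svalP (cid (ex th1 th2 (w 0 T))).
exact: (H T g U1 U2 b1 b2 w1 w2 T0 pg cw1 cw2 t1 t2 d1 d2 n1 n2 erefl).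
Qed.
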